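(* For every planar convex body $K\subset\mathbb R^2$, $$\theta(K)>\frac{\operatorname{per}K}{6}.$$ The constant $1/6$ is sharp, i.e. it cannot be replaced by any larger constant: for every $c>1/6$ there exists a planar convex body $K$ with $\theta(K)\le c\,\operatorname{per}K$.
   Context: A convex body is a compact convex set with nonempty interior; $\operatorname{per}K$ is the perimeter (length of $\partial K$). $\theta(K)=\mathbb E|B_1-B_2|$, where $B_1,B_2$ are independent and distributed according to normalized arclength measure on $\partial K$, and $|\cdot|$ is the Euclidean norm. *)

(* Defs.v *)
From HB Require Import structures.
From mathcomp Require Import all_boot all_order all_algebra.
From mathcomp Require Import all_classical all_reals all_analysis.

Set Implicit Arguments.
Unset Strict Implicit.
Unset Printing Implicit Defensive.

Import Order.TTheory GRing.Theory Num.Theory.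
Import numFieldNormedType.Exports.

Local Open Scope classical_set_scope.
Local Open Scope ring_scope.

Section convex_body.
Variable R : realType.
Implicit Types (x : R * R) (K : set (R * R)%type).

(* The library's norm on a product is the sup norm, hence a separate Euclidean
   norm. Both induce the product topology, which is the one used for
   [compact], [closure] and the interior. *)
Definition enorm x : R := Num.sqrt (x.1 ^+ 2 + x.2 ^+ 2).

Definition convex_body K : Prop := [/\ compact K, convex_set K & K° !=set0].

Definition boundary K : set (R * R)%type := closure K `\` K°.

End convex_body.

Section arclength.
Variable R : realType.
Implicit Types (C : set (R * R)%type) (g : R -> R * R) (l : R).

(* Total variation of [g] on [[a, b]] for the Euclidean norm; compare
   [variation] and [total_variation], which are for real-valued functions. *)
Definition curve_length g (a b : R) : \bar R :=
  ereal_sup [set (let F := g \o nth b (a :: s) in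
                  \sum_(0 <= n < size s) enorm (F n.+1 - F n))%:E
            | s in [set s | itv_partition a b s]].

(* [g], restricted to [[0, l]], is a parametrization by arclength of the simple
   closed curve [C]; in particular [l] is the length of [C]. The values of [g]
   outside [[0, l]] play no role. *)
Definition arclength_param C l g : Prop :=
  [/\ 0 < l,
      g 0 = g l,
      {in `[0, l[ &, injective g},
      g @` `[0, l] = C &
      forall s t, 0 <= s -> s <= t -> t <= l -> curve_length g s t = (t - s)%:E].

(* The default values [0] and [cst 0] of [xget] are used only for sets [C] that
   are not rectifiable simple closed curves; the boundary of a planar convex
   body is one. The length and the measure below do not depend on the chosen
   parametrization: any two differ by a translation modulo [l] and possibly a
   change of orientation. A parametrization by arclength is Lipschitz on
   [[0, l]], so taking a measurable function [R -> R * R] is no restriction. *)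
Definition arclength C : R :=
  xget 0 [set l | exists g : {mfun measurableTypeR R >-> (R * R)%type},
                    arclength_param C l g].

Definition arc_param C : {mfun measurableTypeR R >-> (R * R)%type} :=
  xget (cst 0 : {mfun measurableTypeR R >-> (R * R)%type})
       [set g : {mfun measurableTypeR R >-> (R * R)%type} |
            arclength_param C (arclength C) g].

Definition arclength_measure C : set (R * R)%type -> \bar R :=
  pushforward
    (mrestr (@lebesgue_measure R) (measurable_itv `[0, arclength C]))
    (arc_param C).

Section arclength_measure_is_measure.
Variable C : set (R * R)%type.

Let arclength_measure0 : arclength_measure C set0 = 0%E.
Proof. exact: measure0. Qed.

Let arclength_measure_ge0 A : (0 <= arclength_measure C A)%E.
Proof. exact: measure_ge0. Qed.

Let arclength_measure_sigma_additive :
  semi_sigma_additive (arclength_measure C).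
Proof. exact: measure_semi_sigma_additive. Qed.

HB.instance Definition _ := isMeasure.Build _ _ _ (arclength_measure C)
  arclength_measure0 arclength_measure_ge0 arclength_measure_sigma_additive.

End arclength_measure_is_measure.

(* The second argument of [mnormalize] is a default value, used only when the
   total mass is [0] or infinite. *)
Definition normalized_arclength C : probability (R * R)%type R :=
  mnormalize (arclength_measure C) (\d_(0 : R * R)).

End arclength.

Section theta.
Variable R : realType.
Implicit Types K : set (R * R)%type.

Definition per K : R := arclength (boundary K).

(* The coordinates [z.1] and [z.2] under the product measure are independent
   and each distributed according to [normalized_arclength (boundary K)]. *)
Definition theta K : \bar R :=
  let P := normalized_arclength (boundary K) in
  'E_(P \x P)[(fun z => enorm (z.1 - z.2))%R]%E.

End theta.

(* Main.v *)
Require Import Defs.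
From mathcomp Require Import all_boot all_order all_algebra.
From mathcomp Require Import all_classical all_reals all_analysis.
From mathcomp Require Import measurable_realfun.
From mathcomp Require Import ring lra zify.

(** Why the constant is 1 / 6, and why it is not attained.

    Let g be the boundary, parametrized by arclength, and l its length. By
    Crofton's formula ([Lam_abs_dotp]) the length of a vector is a quarter of the
    integral of the lengths of its projections over all directions u, so that the
    mean distance is an average of one-dimensional ones, between the heights
    h = g . u. By convexity h rises along an arc of length a and falls along the
    complementary arc of length b, with a + b = l ([loop_updown]). The identity
    behind the energy distance of two distributions ([updown_energy]) bounds the
    double integral of |h(s) - h(t)| from below by l / a times the part over the
    rising arc plus l / b times the part over the falling one; the difference is
    the energy distance of the two distributions of heights.

    For a rising arc of length a, the double integral divided by 2 a is the sum of
    the rises of its edges with the coefficient x y / (x + y), where x and y are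
    the lengths on the two sides of the edge. This function has a positive mixed
    derivative, so that it is a superposition of windows ([winw], [winsum_mid]): the coefficient counts
    the windows around the edge that fit into the arc. The weights of the windows
    do not depend on the direction u, and the integral over u can be done first
    for a fixed window, over the directions in which all its edges rise. Such a
    window turns by less than a half turn, its marked unit tangent e is a
    combination al e' + be e'' of the end tangents with al, be >= 0, and
    al + be >= 1 since e is a unit vector ([unit_edge_sum_ge1]). Both end tangents
    have the same mean rise 1 + e' . e'' ([Lam_wedge]), so that the marked edge may
    be replaced by the average of the end edges ([window_mass_mid]). Summing back
    over the windows in a fixed direction, every edge of the arc of length a gets
    the weight a / 6 ([winsum_ends_ge]). The two arcs have the same height, their
    weights add up to l / 6, and Crofton's formula turns heights into lengths
    again. All this is done for the inscribed polygons with equally spaced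
    parameters ([polygon_mean_distance]).

    The inequality is strict for one of two reasons ([loop_gain_exists]). If the
    boundary is strictly convex, then al + be - 1 is bounded away from zero on a
    positive proportion of the windows ([strict_gain_exists]). Otherwise three
    boundary points are collinear and the boundary contains a segment; for
    directions close to its normal one of the arcs spends much more length than
    the other near the lowest level, and the energy distance is positive
    ([flat_gain_exists]). Both gains are uniform in the mesh ([loop_sum_gt]).

    To apply this one needs that the boundary of a convex body is a curve of the
    required kind. It is parametrized by angle around an interior point, with a
    Lipschitz radius, and then by arclength ([body_arclength_param]). That it is
    convex as a curve, that is, that triples of points are ordered
    counterclockwise, follows because the triples of unit vectors pointing to them
    are never degenerate and depend continuously on connected parameters
    ([dirdet_sign]). The mean distance is then a double integral and a limit of
    sums over inscribed polygons ([theta_integral], [double_riemann_sum]).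

    Sharpness: the boundary of a thin rectangle is almost a segment covered twice,
    for which the mean distance is a third of the length of the segment and a
    sixth of the perimeter ([rect_theta_le]). *)

Set Implicit Arguments.
Unset Strict Implicit.
Unset Printing Implicit Defensive.

Import Order.TTheory GRing.Theory Num.Theory.
Import numFieldNormedType.Exports.

Local Open Scope classical_set_scope.
Local Open Scope ring_scope.

(** * Integrals of bounded measurable functions over an interval *)

Section bounded_integration.
Variable R : realType.
Implicit Types (f g : R -> R) (a b : R).

Definition ind (p : bool) : R := if p then 1 else 0.

Lemma ind_ge0 p : 0 <= ind p.
Proof. by case: p; rewrite /= ?ler01. Qed.

Lemma ind_and p q : ind (p && q) = ind p * ind q.
Proof. by case: p; case: q; rewrite /= ?mul0r ?mul1r. Qed.

(** Bounded and Borel: the class is stable under the operations below, and its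
    members are integrable over every interval, so that integrals can be
    manipulated without further side conditions. *)
Definition bmeas f := measurable_fun setT f /\ exists M, forall x, `|f x| <= M.

Definition Int a b f := \int[@lebesgue_measure R]_(x in `[a, b]) f x.

Lemma bmeas_cst (r : R) : bmeas (fun=> r).
Proof. by split; [exact: measurable_cst|exists `|r|]. Qed.

Lemma bmeasD f g : bmeas f -> bmeas g -> bmeas (fun x => f x + g x).
Proof.
move=> [mf [M fM]] [mg [M' gM']]; split; first exact: measurable_funD.
exists (M + M') => x; apply: (le_trans (ler_normD _ _)); exact: lerD.
Qed.

Lemma bmeasM f g : bmeas f -> bmeas g -> bmeas (fun x => f x * g x).
Proof.
move=> [mf [M fM]] [mg [M' gM']]; split; first exact: measurable_funM.
exists (M * M') => x; rewrite normrM; exact: ler_pM.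
Qed.

Lemma bmeasN f : bmeas f -> bmeas (fun x => - f x).
Proof.
move=> [mf [M fM]]; split; first exact: measurableT_comp.
by exists M => x; rewrite normrN.
Qed.

Lemma bmeasB f g : bmeas f -> bmeas g -> bmeas (fun x => f x - g x).
Proof. by move=> hf hg; apply: bmeasD => //; exact: bmeasN. Qed.

Lemma bmeas_norm f : bmeas f -> bmeas (fun x => `|f x|).
Proof.
move=> [mf [M fM]]; split; first exact: measurableT_comp.
by exists M => x; rewrite normr_id.
Qed.

Lemma bmeas_sum (I : Type) (s : seq I) (P : pred I) (F : I -> R -> R) :
  (forall i, P i -> bmeas (F i)) -> bmeas (fun x => \sum_(i <- s | P i) F i x).
Proof.
move=> h; elim: s => [|i s ih].
  by under eq_fun do rewrite big_nil; exact: bmeas_cst.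
case Pi : (P i); under eq_fun do rewrite big_cons Pi.
  by apply: bmeasD => //; exact: h.
exact: ih.
Qed.

Lemma bmeas_bool (B : R -> bool) : measurable_fun setT B ->
  bmeas (fun x => ind (B x)).
Proof.
move=> mB; split; last first.
  by exists 1 => x; rewrite /ind; case: (B x); rewrite ?normr1 ?normr0.
exact: measurable_fun_ifT.
Qed.

Lemma bmeas_lt f g : bmeas f -> bmeas g -> bmeas (fun x => ind (f x < g x)).
Proof. by move=> [mf _] [mg _]; apply: bmeas_bool; exact: measurable_fun_ltr. Qed.

Lemma bmeas_le f g : bmeas f -> bmeas g -> bmeas (fun x => ind (f x <= g x)).
Proof. by move=> [mf _] [mg _]; apply: bmeas_bool; exact: measurable_fun_ler. Qed.

Lemma bmeas_id_ge (c : R) : bmeas (fun x => ind (c <= x)).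
Proof. by apply: bmeas_bool; exact: measurable_fun_ler. Qed.

Lemma bmeas_eq0 f : bmeas f -> bmeas (fun x => ind (f x == 0)).
Proof.
move=> [mf _]; apply: bmeas_bool; exact: measurable_fun_eqr.
Qed.

Lemma bmeas_all_gt0 (I : Type) (s : seq I) (F : I -> R -> R) :
  (forall i, bmeas (F i)) ->
  bmeas (fun x => ind (all (fun i => 0 < F i x) s)).
Proof.
move=> h; elim: s => [|i s ih] /=; first exact: bmeas_cst.
under eq_fun do rewrite ind_and; apply: bmeasM => //.
by apply: bmeas_lt => //; exact: bmeas_cst.
Qed.

Lemma bmeas_integrable a b f : bmeas f ->
  (@lebesgue_measure R).-integrable `[a, b] (EFin \o f).
Proof.
move=> [mf [M fM]]; apply: measurable_bounded_integrable => //.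
- by rewrite /= lebesgue_measure_itv /=; case: ifP => // _; rewrite -EFinB ltry.
- exact: measurable_funS mf.
- exists M; split; first exact: num_real.
  by move=> N MN x _ /=; apply: (le_trans (fM x)); exact: ltW.
Qed.

Lemma IntD a b f g : bmeas f -> bmeas g ->
  Int a b (fun x => f x + g x) = Int a b f + Int a b g.
Proof. by move=> hf hg; rewrite /Int RintegralD//; exact: bmeas_integrable. Qed.

Lemma IntZ a b r f : bmeas f -> Int a b (fun x => r * f x) = r * Int a b f.
Proof. by move=> hf; rewrite /Int RintegralZl//; exact: bmeas_integrable. Qed.

Lemma IntN a b f : bmeas f -> Int a b (fun x => - f x) = - Int a b f.
Proof.
by move=> hf; rewrite -mulN1r -IntZ//; congr Int; apply/funext => x; rewrite mulN1r.
Qed.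

Lemma IntB a b f g : bmeas f -> bmeas g ->
  Int a b (fun x => f x - g x) = Int a b f - Int a b g.
Proof. by move=> hf hg; rewrite IntD ?IntN//; exact: bmeasN. Qed.

Lemma Int_sum a b (I : Type) (s : seq I) (P : pred I) (F : I -> R -> R) :
  (forall i, P i -> bmeas (F i)) ->
  Int a b (fun x => \sum_(i <- s | P i) F i x) =
  \sum_(i <- s | P i) Int a b (F i).
Proof.
move=> h; elim: s => [|i s ih].
  rewrite big_nil; under eq_fun do rewrite big_nil.
  by rewrite /Int Rintegral_cst// mul0r.
rewrite big_cons; case Pi : (P i); under eq_fun do rewrite big_cons Pi.
  by rewrite IntD ?ih//; [exact: h|exact: bmeas_sum].
exact: ih.
Qed.

Lemma le_Int a b f g : bmeas f -> bmeas g ->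
  (forall x, a <= x <= b -> f x <= g x) -> Int a b f <= Int a b g.
Proof.
move=> hf hg fg; apply: le_Rintegral; [by []|exact: bmeas_integrable|exact: bmeas_integrable|].
by move=> x /=; rewrite in_itv /=; exact: fg.
Qed.

Lemma eq_Int a b f g : (forall x, a <= x <= b -> f x = g x) ->
  Int a b f = Int a b g.
Proof.
move=> fg; apply: eq_Rintegral => x; rewrite inE /= in_itv /=; exact: fg.
Qed.

Lemma Int_ge0 a b f : (forall x, 0 <= f x) -> 0 <= Int a b f.
Proof. by move=> f0; apply: Rintegral_ge0 => x _. Qed.

Lemma Int_cst a b r : a <= b -> Int a b (fun=> r) = r * (b - a).
Proof.
move=> ab; rewrite /Int Rintegral_cst//; congr (_ * _).
rewrite /= lebesgue_measure_itv /= lte_fin; case: ltP => //= ba.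
by rewrite (@le_anti _ _ a b) ?subrr// ab.
Qed.

End bounded_integration.

(** * The Euclidean plane *)

Section plane.
Variable R : realType.
Implicit Types (u v w x y z : R * R).

Definition dotp u v : R := u.1 * v.1 + u.2 * v.2.
Definition crossp u v : R := u.1 * v.2 - u.2 * v.1.
Definition orient x y z : R := crossp (y - x) (z - x).

Lemma fstB x y : (x - y).1 = x.1 - y.1. Proof. by []. Qed.
Lemma sndB x y : (x - y).2 = x.2 - y.2. Proof. by []. Qed.
Lemma fstD x y : (x + y).1 = x.1 + y.1. Proof. by []. Qed.
Lemma sndD x y : (x + y).2 = x.2 + y.2. Proof. by []. Qed.
Lemma fstN x : (- x).1 = - x.1. Proof. by []. Qed.
Lemma sndN x : (- x).2 = - x.2. Proof. by []. Qed.
Definition pairE := (fstB, sndB, fstD, sndD, fstN, sndN).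

Lemma dotpBl x y u : dotp (x - y) u = dotp x u - dotp y u.
Proof. rewrite /dotp !pairE; ring. Qed.

Lemma dotpNl x u : dotp (- x) u = - dotp x u.
Proof. rewrite /dotp !pairE; ring. Qed.

Lemma enorm_ge0 x : 0 <= enorm x. Proof. exact: sqrtr_ge0. Qed.

Lemma enorm_sq x : enorm x ^+ 2 = dotp x x.
Proof. by rewrite /enorm sqr_sqrtr ?addr_ge0 ?sqr_ge0// /dotp -!expr2. Qed.

Lemma enormN x : enorm (- x) = enorm x.
Proof. by rewrite /enorm !pairE !sqrrN. Qed.

Lemma enormBC x y : enorm (x - y) = enorm (y - x).
Proof. by rewrite -enormN opprB. Qed.

Lemma enorm_eq0 x : enorm x = 0 -> x = 0.
Proof.
move=> h; have := enorm_sq x; rewrite h expr0n /= /dotp -!expr2 => /esym/eqP.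
rewrite paddr_eq0 ?sqr_ge0// !sqrf_eq0 => /andP[/eqP h1 /eqP h2].
by case: x h1 h2 {h} => a b /= -> ->.
Qed.

Lemma enorm0 : enorm (0 : R * R) = 0.
Proof. by rewrite /enorm /= expr0n addr0 sqrtr0. Qed.

Lemma enorm_gt0 x : x <> 0 -> 0 < enorm x.
Proof.
move=> x0; rewrite lt_neqAle enorm_ge0 andbT eq_sym; apply/eqP => h.
exact/x0/enorm_eq0.
Qed.

Lemma dotp_le u v : dotp u v <= enorm u * enorm v.
Proof.
have [h|h] := leP (dotp u v) 0.
  by apply: (le_trans h); rewrite mulr_ge0 ?enorm_ge0.
rewrite -(@ler_pXn2r _ 2)// ?nnegrE ?mulr_ge0 ?enorm_ge0//; last exact: ltW.
rewrite exprMn !enorm_sq /dotp.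
have := sqr_ge0 (u.1 * v.2 - u.2 * v.1); nra.
Qed.

Lemma normr_dotp_le u v : `|dotp u v| <= enorm u * enorm v.
Proof.
by rewrite ler_norml dotp_le andbT lerNl -dotpNl -(enormN u) dotp_le.
Qed.

Lemma enormD u v : enorm (u + v) <= enorm u + enorm v.
Proof.
rewrite -(@ler_pXn2r _ 2)// ?nnegrE ?addr_ge0 ?enorm_ge0//.
rewrite sqrrD !enorm_sq.
have := dotp_le u v; rewrite /dotp !pairE; lra.
Qed.

Lemma enorm_triangle x y z : enorm (x - z) <= enorm (x - y) + enorm (y - z).
Proof. by apply: le_trans (enormD _ _); rewrite addrA subrK. Qed.

Lemma enorm_le_l1 x : enorm x <= `|x.1| + `|x.2|.
Proof.
rewrite -(@ler_pXn2r _ 2)// ?nnegrE ?addr_ge0 ?enorm_ge0 ?normr_ge0//.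
rewrite sqrrD enorm_sq /dotp !real_normK ?num_real//.
by rewrite -!expr2 -addrA lerD2l lerDr mulrn_wge0 ?mulr_ge0.
Qed.

Lemma normr1_le_enorm x : `|x.1| <= enorm x.
Proof.
rewrite -(@ler_pXn2r _ 2)// ?nnegrE ?enorm_ge0 ?normr_ge0//.
by rewrite enorm_sq /dotp real_normK ?num_real// -!expr2 lerDl sqr_ge0.
Qed.

Lemma normr2_le_enorm x : `|x.2| <= enorm x.
Proof.
rewrite -(@ler_pXn2r _ 2)// ?nnegrE ?enorm_ge0 ?normr_ge0//.
by rewrite enorm_sq /dotp real_normK ?num_real// -!expr2 lerDr sqr_ge0.
Qed.

End plane.

(** * Integrals over all directions *)
Section directions.
Variable R : realType.
Implicit Types (f : R * R -> R) (u v : R * R).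

(** Functions of a vector are integrated over the unit circle, that is, over
    all directions on which the plane is projected. *)
Definition dmeas f := bmeas (fun w : R => f (cos w, sin w)).
Definition Lam f := Int 0 (pi *+ 2) (fun w : R => f (cos w, sin w)).

Lemma pi2_ge0 : 0 <= pi *+ 2 :> R.
Proof. by rewrite mulrn_wge0 ?pi_ge0. Qed.

Lemma enorm_circle (w : R) : enorm (cos w, sin w) = 1.
Proof. by rewrite /enorm /= cos2Dsin2 sqrtr1. Qed.

Lemma continuous_dotp_circle v :
  continuous (fun w : R => dotp v (cos w, sin w)).
Proof.
move=> w; rewrite /dotp /=; apply: cvgD; apply: cvgM; try exact: cvg_cst.
- exact: continuous_cos.
- exact: continuous_sin.
Qed.

Lemma dmeas_dotp v : dmeas (dotp v).
Proof.
split; first by apply: continuous_measurable_fun; exact: continuous_dotp_circle.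
by exists (enorm v) => w; rewrite -[leRHS]mulr1 -(enorm_circle w) normr_dotp_le.
Qed.

Lemma Int_sin (k w0 p q : R) : p <= q ->
  Int p q (fun w => k * sin (w - w0)) = k * cos (p - w0) - k * cos (q - w0).
Proof.
rewrite le_eqVlt => /predU1P[->|pq].
  by rewrite subrr /Int set_itv1 Rintegral_set1.
have dF (w : R) : is_derive w (1 : R) (fun w => - (k * cos (w - w0)))
    (k * sin (w - w0)).
  apply: is_derive_eq.
  by rewrite /GRing.scale /=; ring.
have cF : continuous (fun w : R => - (k * cos (w - w0))).
  by move=> w; apply/differentiable_continuous/derivable1_diffP; apply: ex_derive.
rewrite /Int /Rintegral (@continuous_FTC2 _ _ (fun w => - (k * cos (w - w0)))) //.
- by rewrite -EFinB /= opprK addrC.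
- apply: continuous_subspaceT => w; apply: cvgM; first exact: cvg_cst.
  apply: continuous_comp; last exact: continuous_sin.
  by apply: cvgB => //; exact: cvg_cst.
- split.
  + by move=> w _; apply: ex_derive.
  + exact/cvg_at_right_filter/cF.
  + exact/cvg_at_left_filter/cF.
- by move=> w _; rewrite derive1E; apply: derive_val.
Qed.

Lemma Int_split (a c b : R) (g : R -> R) : bmeas g -> a <= c -> c <= b ->
  Int a b g = Int a c g + Int c b g.
Proof.
move=> hg ac cb; rewrite /Int.
have := @Rintegral_itvB _ g (BLeft a) (BRight b) c (bmeas_integrable a b hg).
rewrite !bnd_simp => /(_ ac cb) h.
rewrite -(@Rintegral_itv_obnd_cbnd _ c).
  by rewrite -h addrC subrK.
apply: (integrableS _ _ _ (bmeas_integrable c b hg)) => //.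
exact: subset_itv_oc_cc.
Qed.

(** Crofton: the length of a vector is, up to the factor 4, the integral of the
    lengths of its projections. This is what reduces mean distances in the plane
    to mean distances on lines. *)
Lemma Lam_abs_dotp v : Lam (fun u => `|dotp v u|) = 4 * enorm v.
Proof.
pose f (w : R) := dotp v (cos w, sin w).
have [w0 w0pi fw0] : exists2 w0 : R, w0 \in `[0, pi] & f w0 = 0.
  apply: (@IVT R f 0 pi 0); first exact: pi_ge0.
    exact/continuous_subspaceT/continuous_dotp_circle.
  rewrite /f /dotp /= cos0 sin0 cospi sinpi !mulr0 !addr0 mulr1 mulrN1.
  by case: (leP 0 v.1) => h; rewrite ge_min le_max;
    [rewrite oppr_le0 h orbT|rewrite oppr_ge0 (ltW h) /= orbT].
pose k := - v.1 * sin w0 + v.2 * cos w0.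
have f0 : v.1 * cos w0 + v.2 * sin w0 = 0 := fw0.
have cs := cos2Dsin2 w0.
have v1E : v.1 = - k * sin w0.
  transitivity (v.1 * (cos w0 ^+ 2 + sin w0 ^+ 2)); first by rewrite cs mulr1.
  transitivity (cos w0 * (v.1 * cos w0 + v.2 * sin w0) - k * sin w0).
    by rewrite /k; ring.
  by rewrite f0 mulr0 sub0r mulNr.
have v2E : v.2 = k * cos w0.
  transitivity (v.2 * (cos w0 ^+ 2 + sin w0 ^+ 2)); first by rewrite cs mulr1.
  transitivity (sin w0 * (v.1 * cos w0 + v.2 * sin w0) + k * cos w0).
    by rewrite /k; ring.
  by rewrite f0 mulr0 add0r.
have fE w : f w = k * sin (w - w0).
  rewrite sinB /f /dotp /= v1E v2E; ring.
have kv : `|k| = enorm v.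
  rewrite /enorm v1E v2E -sqrtr_sqr; congr Num.sqrt.
  by rewrite !exprMn sqrrN -mulrDr addrC cs mulr1.
move: w0pi; rewrite in_itv /= => /andP[w0_ge0 w0_le].
have pi0 := @pi_gt0 R.
have mf : bmeas (fun w => `|f w|) by apply: bmeas_norm; exact: dmeas_dotp.
rewrite /Lam -/f (@Int_split _ w0)//; last by rewrite mulr2n; lra.
rewrite (@Int_split w0 (w0 + pi))//; try (rewrite ?mulr2n; lra).
have absE p q : (forall w, p <= w <= q -> 0 <= sin (w - w0)) ->
    Int p q (fun w => `|f w|) = Int p q (fun w => `|k| * sin (w - w0)).
  by move=> h; apply: eq_Int => w /h h0; rewrite fE normrM (ger0_norm h0).
have absE' p q : (forall w, p <= w <= q -> sin (w - w0) <= 0) ->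
    Int p q (fun w => `|f w|) = Int p q (fun w => - `|k| * sin (w - w0)).
  by move=> h; apply: eq_Int => w /h h0; rewrite fE normrM (ler0_norm h0) mulrN mulNr.
rewrite absE'; last first.
  move=> w hw; rewrite -[w - w0]opprB sinN oppr_le0 sin_ge0_pi//; lra.
rewrite absE; last first.
  move=> w hw; rewrite sin_ge0_pi//; lra.
rewrite absE'; last first.
  move=> w; rewrite mulr2n => hw; rewrite -[w - w0](subrK pi) sinDpi oppr_le0 sin_ge0_pi//; lra.
rewrite !Int_sin//; try (rewrite ?mulr2n; lra).
rewrite sub0r cosN subrr cos0 (addrC w0) addrK cospi.
have -> : cos (pi *+ 2 - w0) = cos w0.
  by rewrite addrC cosD2pi cosN.
rewrite -kv; ring.
Qed.

Lemma Lam_cst (r : R) : Lam (fun=> r) = r * (pi *+ 2).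
Proof. by rewrite /Lam Int_cst ?subr0// pi2_ge0. Qed.

Lemma LamD f g : dmeas f -> dmeas g -> Lam (fun u => f u + g u) = Lam f + Lam g.
Proof. by move=> hf hg; rewrite /Lam IntD. Qed.

Lemma LamZ r f : dmeas f -> Lam (fun u => r * f u) = r * Lam f.
Proof. by move=> hf; rewrite /Lam IntZ. Qed.

Lemma LamB f g : dmeas f -> dmeas g -> Lam (fun u => f u - g u) = Lam f - Lam g.
Proof. by move=> hf hg; rewrite /Lam IntB. Qed.

Lemma Lam_sum (I : Type) (s : seq I) (P : pred I) (F : I -> R * R -> R) :
  (forall i, P i -> dmeas (F i)) ->
  Lam (fun u => \sum_(i <- s | P i) F i u) = \sum_(i <- s | P i) Lam (F i).
Proof. by move=> h; rewrite /Lam Int_sum. Qed.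

Lemma le_Lam f g : dmeas f -> dmeas g ->
  (forall u, enorm u = 1 -> f u <= g u) -> Lam f <= Lam g.
Proof. by move=> hf hg fg; apply: le_Int => // w _; apply: fg; exact: enorm_circle. Qed.

Lemma eq_Lam f g : (forall u, enorm u = 1 -> f u = g u) -> Lam f = Lam g.
Proof. by move=> fg; apply: eq_Int => w _; apply: fg; exact: enorm_circle. Qed.

Lemma sqrt1D_le (s : R) : -1 <= s -> Num.sqrt (1 + s) <= 1 + s / 2.
Proof.
move=> s1; rewrite -(@ler_pXn2r _ 2)// ?nnegrE ?sqrtr_ge0//; last by lra.
rewrite sqr_sqrtr; last by lra.
by have := sqr_ge0 (s / 2); nra.
Qed.

Lemma enorm_affine_le (e e' : R * R) (t : R) : enorm e = 1 -> enorm e' = 1 ->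
  enorm (e'.1 + t * e.1, e'.2 + t * e.2) <= 1 + t * dotp e e' + t ^+ 2 / 2.
Proof.
move=> he he'.
have he2 := enorm_sq e; have he2' := enorm_sq e'.
rewrite he expr1n in he2; rewrite he' expr1n in he2'.
rewrite /dotp in he2 he2' *.
have -> : enorm (e'.1 + t * e.1, e'.2 + t * e.2) =
    Num.sqrt (1 + (2 * t * (e.1 * e'.1 + e.2 * e'.2) + t ^+ 2)).
  rewrite /enorm /=; congr Num.sqrt.
  transitivity ((e'.1 * e'.1 + e'.2 * e'.2) + (2 * t * (e.1 * e'.1 + e.2 * e'.2)
    + t ^+ 2 * (e.1 * e.1 + e.2 * e.2))); first by ring.
  by rewrite -he2 -he2'; ring.
apply: le_trans (sqrt1D_le _) _; last by lra.
have := dotp_le (- e) e'; rewrite enormN he he' mulr1 /dotp !pairE => h1.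
have := dotp_le e e'; rewrite he he' mulr1 /dotp => h2.
have hc : - 1 <= e.1 * e'.1 + e.2 * e'.2 by lra.
move: (e.1 * e'.1 + e.2 * e'.2) hc h2 {h1} => c hc h2.
have [t0|t0] := leP 0 t.
  have := sqr_ge0 (t - 1); nra.
have := sqr_ge0 (t + 1); nra.
Qed.

Lemma dotp_affine (e e' u : R * R) (t : R) :
  dotp (e'.1 + t * e.1, e'.2 + t * e.2) u = dotp e' u + t * dotp e u.
Proof. rewrite /dotp /=; ring. Qed.

Lemma dmeas_sg (v : R * R) : dmeas (fun u => Num.sg (dotp v u)).
Proof.
rewrite (_ : (fun u => _) = (fun u => ind R (0 < dotp v u) - ind R (dotp v u < 0))).
  by apply: bmeasB; apply: bmeas_lt; (exact: bmeas_cst || exact: dmeas_dotp).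
apply/funext => u; rewrite /ind; case: ltrgt0P => h; [rewrite gtr0_sg//|rewrite ltr0_sg//|rewrite h sgr0]; by rewrite ?subr0 ?sub0r ?subrr.
Qed.

End directions.

Ltac dmeas_tac := rewrite /dmeas; repeat (first [exact: bmeas_cst | assumption
  | exact: dmeas_dotp | exact: dmeas_sg | apply: bmeas_norm | apply: bmeasB | apply: bmeasD
  | apply: bmeasM | apply: bmeasN | apply: bmeas_lt | apply: bmeas_le
  | apply: bmeas_eq0]).

Section direction_integrals.
Variable R : realType.
Implicit Types (f g : R * R -> R) (u v : R * R).

Lemma small_le0 (x M : R) : (forall t, 0 < t -> x <= t * M) -> x <= 0.
Proof.
move=> h; rewrite leNgt; apply/negP => x0.
have M0 : 0 < M by rewrite -[M]mul1r; apply: lt_le_trans x0 (h 1 _).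
have := h (x / M / 2); rewrite mulrAC divfK ?gt_eqF// => /(_ _) hh.
by have := hh ltac:(by rewrite !divr_gt0); lra.
Qed.

(** Perturbing [e] by [t] times an orthogonal vector changes its length by
    O(t ^ 2), while the integrand of Crofton's formula has a kink of slope [t] in
    the directions orthogonal to [e]; these therefore have measure zero. *)
Lemma Lam_null_line (e : R * R) : enorm e = 1 ->
  Lam (fun u => ind R (dotp e u == 0)) = 0.
Proof.
move=> he; apply/le_anti/andP; split; last exact/Int_ge0/(fun _ => ind_ge0 _ _).
pose e' : R * R := (- e.2, e.1).
have he2 := enorm_sq e; rewrite he expr1n /dotp in he2.
have he' : enorm e' = 1 by rewrite /enorm /= sqrrN !expr2 addrC -he2 sqrtr1.
have c0 : dotp e' e = 0 by rewrite /dotp /e' /=; ring.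
apply: (@small_le0 _ 2) => t t0.
rewrite -(ler_pM2l (_ : 0 < 2 * t)) ?mulr_gt0//.
have hm : dmeas (fun u => ind R (dotp e u == 0)) by apply: bmeas_eq0; exact: dmeas_dotp.
pose v1 := (e.1 + t * e'.1, e.2 + t * e'.2).
pose v2 := (e.1 + - t * e'.1, e.2 + - t * e'.2).
have hv v : dmeas (fun u => `|dotp v u|) by apply: bmeas_norm; exact: dmeas_dotp.
apply: (@le_trans _ _ (Lam (fun u => `|dotp v1 u| + `|dotp v2 u| - 2 * `|dotp e u|))).
  rewrite -LamZ//; apply: le_Lam.
  - by dmeas_tac.
  - by dmeas_tac.
  move=> u hu; rewrite !dotp_affine /ind; case: eqP => [du0|_].
    rewrite du0 mulr1 normr0 mulr0 subr0 !add0r mulNr normrN.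
    have hy : `|dotp e' u| = 1.
      rewrite -sqrtr_sqr -sqrtr1; congr Num.sqrt.
      have hu2 := enorm_sq u; rewrite hu expr1n /dotp in hu2.
      transitivity (dotp e' u ^+ 2 + dotp e u ^+ 2); first by rewrite du0 expr0n addr0.
      rewrite /dotp /e' /=.
      transitivity ((e.1 * e.1 + e.2 * e.2) * (u.1 * u.1 + u.2 * u.2)); first by ring.
      by rewrite -he2 -hu2 mulr1.
    rewrite normrM hy (gtr0_norm t0); lra.
  rewrite mulr0; set x := dotp e u; set y := _ * _.
  have := ler_normD (x + y) (x + - t * dotp e' u).
  rewrite (_ : x + y + _ = 2 * x); last by rewrite /y; ring.
  by rewrite normrM (ger0_norm (ler0n _ 2)); lra.
rewrite LamB; [|by dmeas_tac|by dmeas_tac].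
rewrite LamD// LamZ// !Lam_abs_dotp he.
have h1 := enorm_affine_le t he' he; have h2 := enorm_affine_le (- t) he' he.
rewrite c0 in h1 h2; rewrite -/v1 in h1; rewrite -/v2 in h2.
lra.
Qed.

(** Directions orthogonal to one of finitely many edges may be ignored; for all
    others the edges of a polygon go strictly up or strictly down. *)
Lemma le_Lam_generic (s : seq (R * R)) f g :
  (forall e, e \in s -> enorm e = 1) -> dmeas f -> dmeas g ->
  (forall u, enorm u = 1 -> (forall e, e \in s -> dotp e u != 0) -> f u <= g u) ->
  Lam f <= Lam g.
Proof.
move=> hs hf hg fg; have [_ [Mf hMf]] := hf; have [_ [Mg hMg]] := hg.
pose M := Mf + Mg.
have hm e : dmeas (fun u => ind R (dotp e u == 0)) by dmeas_tac.
have hm' : dmeas (fun u => M * \sum_(e <- s) ind R (dotp e u == 0)).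
  by apply: bmeasM; [exact: bmeas_cst|apply: bmeas_sum => e _; exact: hm].
have L0 : Lam (fun u => M * \sum_(e <- s) ind R (dotp e u == 0)) = 0.
  rewrite LamZ; last by apply: bmeas_sum => e _; exact: hm.
  rewrite Lam_sum// big_seq big1 => [|e es]; first by rewrite mulr0.
  exact: (Lam_null_line (hs e es)).
rewrite -[Lam g]addr0 -L0 -LamD//.
apply: le_Int => //; first by dmeas_tac.
move=> w _; have := hMf w; have := hMg w; set u := (cos w, sin w) => gM fM.
have M0 : 0 <= M by rewrite addr_ge0// (le_trans _ fM, le_trans _ gM).
have [/allP hall|] := boolP (all (fun e => dotp e u != 0) s).
  apply: (le_trans (fg u (enorm_circle w) hall)).
  by rewrite lerDl mulr_ge0// sumr_ge0// => e _; exact: ind_ge0.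
move=> /allPn[e es /negPn/eqP e0].
have h1 : 1 <= \sum_(e <- s) ind R (dotp e u == 0).
  rewrite (big_rem e)//= {1}/ind e0 eqxx lerDl sumr_ge0// => x _.
  exact: ind_ge0.
rewrite -lerBlDl; apply: (@le_trans _ _ M); last by rewrite ler_peMr.
by move: fM gM; rewrite !ler_norml /M; lra.
Qed.

(** The derivative at [e'] in the direction [e] of Crofton's formula. Instead of
    differentiating under the integral, the proof compares the two sides of the
    subgradient inequality of the absolute value. *)
Lemma Lam_sg_dotp (e e' : R * R) : enorm e = 1 -> enorm e' = 1 ->
  Lam (fun u => Num.sg (dotp e' u) * dotp e u) = 4 * dotp e e'.
Proof.
move=> he he'.
have hs : dmeas (fun u => Num.sg (dotp e' u) * dotp e u).
  by dmeas_tac.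
have hv v : dmeas (fun u => `|dotp v u|) by dmeas_tac.
have key t : t * Lam (fun u => Num.sg (dotp e' u) * dotp e u) <=
    4 * (t * dotp e e' + t ^+ 2 / 2).
  have h := enorm_affine_le t he he'.
  pose v := (e'.1 + t * e.1, e'.2 + t * e.2).
  have : Lam (fun u => `|dotp e' u| + t * (Num.sg (dotp e' u) * dotp e u)) <=
      Lam (fun u => `|dotp v u|).
    apply: le_Lam.
    - by dmeas_tac.
    - by dmeas_tac.
    move=> u hu; rewrite dotp_affine; set y := dotp e' u; set x := dotp e u.
    case: (sgrP y) => [->|y0|y0].
    - by rewrite mul0r mulr0 addr0 normr_ge0.
    - by rewrite mul1r ler_norm.
    - by rewrite mulN1r mulrN -opprD -normrN ler_norm.
  rewrite LamD//; last by dmeas_tac.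
  rewrite LamZ// !Lam_abs_dotp he'.
  rewrite -/v in h; lra.
apply/le_anti/andP; split; rewrite -subr_le0; apply: (@small_le0 _ 2) => t t0.
  by rewrite -(ler_pM2l t0); have := key t; lra.
by rewrite -(ler_pM2l t0); have := key (- t); lra.
Qed.

(** Over the directions in which both [e] and [e'] go up, or both go down, [e]
    rises by [1 + cos] of their angle on average. The formula is symmetric in the
    two vectors, and this makes the averages over windows of edges computable
    from their end edges. *)
Lemma Lam_wedge (e e' : R * R) : enorm e = 1 -> enorm e' = 1 ->
  Lam (fun u => ind R (0 < dotp e u * dotp e' u) * `|dotp e u|) = 2 * (1 + dotp e e').
Proof.
move=> he he'.
have hs : dmeas (fun u => Num.sg (dotp e' u) * dotp e u).
  by dmeas_tac.
have ha : dmeas (fun u => `|dotp e u|) by dmeas_tac.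
have hi : dmeas (fun u => ind R (0 < dotp e u * dotp e' u) * `|dotp e u|).
  by dmeas_tac.
have hz u : enorm u = 1 -> dotp e' u != 0 ->
    2 * (ind R (0 < dotp e u * dotp e' u) * `|dotp e u|) =
    `|dotp e u| + Num.sg (dotp e' u) * dotp e u.
  move=> _; set x := dotp e u; set y := dotp e' u => y0; rewrite /ind.
  case: (ltrgt0P y) y0 => [yp _|yn _|_ //].
    rewrite gtr0_sg//.
    rewrite pmulr_lgt0//; case: ltP => x0; first by rewrite gtr0_norm//; ring.
    by rewrite ler0_norm//; ring.
  rewrite ltr0_sg// nmulr_lgt0//; case: ltP => x0; first by rewrite ltr0_norm//; ring.
  by rewrite ger0_norm//; ring.
suff : 2 * Lam (fun u => ind R (0 < dotp e u * dotp e' u) * `|dotp e u|) =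
    4 * enorm e + 4 * dotp e e'.
  by rewrite he => h; lra.
rewrite -Lam_abs_dotp -(Lam_sg_dotp he he') -LamZ// -LamD//.
have e'0 u : (forall x, x \in [:: e'] -> dotp x u != 0) -> dotp e' u != 0.
  by apply; rewrite inE.
apply/le_anti/andP; split; apply: (@le_Lam_generic [:: e']);
  try (by move=> x; rewrite inE => /eqP ->);
  try (by move=> u hu /e'0 h0; rewrite hz); by dmeas_tac.
Qed.

End direction_integrals.

(** * Weights of windows *)

Section window_weights.
Variable R : realType.
Implicit Types (f F : nat -> R) (n m a r q s : nat).

(** If P is the amount of a run of [a] rising edges below a level, the edge that
    crosses it counting for one half, then P (a - P) / a is [cumw s.+1 (a - s)]
    at the levels crossed by the edge [s]. Extended by zero, [cumw] is the
    cumulative sum of a nonnegative weight [winw]; hence this coefficient is the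
    total weight of the windows with marked edge [s] that fit into the run, and
    the length of the run only enters through the condition of fitting. *)
Definition cumw r q : R :=
  if (r == 0%N) || (q == 0%N) then 0
  else (r%:R - 2^-1) * (q%:R - 2^-1) / (r%:R + q%:R - 1).

Definition winw r q : R :=
  cumw r.+1 q.+1 - cumw r q.+1 - cumw r.+1 q + cumw r q.

Lemma cumw0r r : cumw 0 r = 0. Proof. by []. Qed.
Lemma cumwr0 r : cumw r 0 = 0. Proof. by rewrite /cumw eqxx orbT. Qed.

Lemma cumwSS r q : cumw r.+1 q.+1 =
  (r%:R + 2^-1) * (q%:R + 2^-1) / (r%:R + q%:R + 1).
Proof.
rewrite /cumw /= -(natr1 r) -(natr1 q); congr (_ * _ / _); lra.
Qed.

Lemma winwSS r q (x := r%:R : R) (y := q%:R : R) : winw r.+1 q.+1 =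
  (4 * (x + 1) * (y + 1) - 1) / (2 * ((x + y + 1) * (x + y + 2) * (x + y + 3))).
Proof.
rewrite /winw !cumwSS -(natr1 r) -(natr1 q) -/x -/y.
have hr : 0 <= x := ler0n R r; have hq : 0 <= y := ler0n R q.
field; do ! (apply/andP; split); apply: lt0r_neq0; lra.
Qed.

Lemma winw_ge0 r q : 0 <= winw r q.
Proof.
case: r => [|r]; case: q => [|q]; rewrite /winw ?cumw0r ?cumwr0 ?cumwSS.
- rewrite subr0 addr0 subr0; apply: divr_ge0; lra.
- rewrite subr0 addr0 -(natr1 q); have h := ler0n R q.
  rewrite subr_ge0 ler_pdivrMr; last lra.
  rewrite mulrAC ler_pdivlMr; last lra.
  nra.
- rewrite addr0 subr0 -(natr1 r); have h := ler0n R r.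
  rewrite subr_ge0 ler_pdivrMr; last lra.
  rewrite mulrAC ler_pdivlMr; last lra.
  nra.
have hr := ler0n R r; have hq := ler0n R q.
have := winwSS r q; rewrite /winw !cumwSS => ->.
apply: divr_ge0; first by have := mulr_ge0 hr hq; nra.
by rewrite !mulr_ge0//; lra.
Qed.

Lemma sum_winw m n :
  \sum_(0 <= r < m) \sum_(0 <= q < n) winw r q = cumw m n.
Proof.
have inner r : \sum_(0 <= q < n) winw r q = cumw r.+1 n - cumw r n.
  transitivity (\sum_(0 <= q < n) ((cumw r.+1 q.+1 - cumw r q.+1) -
    (cumw r.+1 q - cumw r q))).
    by apply: eq_bigr => q _; rewrite /winw; ring.
  by rewrite (telescope_sumr (fun q => cumw r.+1 q - cumw r q))// !cumwr0; ring.
under eq_bigr do rewrite inner.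
by rewrite (telescope_sumr (fun r => cumw r n))// cumw0r subr0.
Qed.

Lemma sum_ind_eq n k F :
  \sum_(0 <= i < n) ind R (i == k) * F i = ind R (k < n)%N * F k.
Proof.
elim: n => [|n ih]; first by rewrite big_geq// mul0r.
rewrite big_nat_recr//= ih ltnS; case: (ltngtP k n) => [kn|kn|->] /=.
- by rewrite /ind mul0r addr0.
- by rewrite /ind !mul0r addr0.
- by rewrite /ind mul0r add0r.
Qed.

Lemma sum_ind_lt n k F : (k <= n)%N ->
  \sum_(0 <= i < n) ind R (i < k)%N * F i = \sum_(0 <= i < k) F i.
Proof.
move=> kn; rewrite (big_cat_nat (n := k))//=.
rewrite [X in _ + X](_ : _ = 0) ?addr0.
  by apply: eq_big_nat => i /andP[_ ->]; rewrite /ind mul1r.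
by rewrite big_nat big1// => i /andP[ki _]; rewrite /ind ltnNge ki mul0r.
Qed.

(** A window [(i, r, q)] has first edge [i], marked edge [i + r] and last edge
    [i + r + q]. *)
Definition winsum a N (G : nat -> nat -> nat -> R) : R :=
  \sum_(0 <= i < a) \sum_(0 <= r < N) \sum_(0 <= q < N)
    ind R (i + r + q < a)%N * (winw r q * G i r q).

Lemma winsum_mid a N f : (a <= N)%N ->
  winsum a N (fun i r q => f (i + r)%N) =
  \sum_(0 <= s < a) f s * cumw s.+1 (a - s).
Proof.
move=> aN; rewrite /winsum.
have step i : \sum_(0 <= r < N) \sum_(0 <= q < N)
    ind R (i + r + q < a)%N * (winw r q * f (i + r)%N) =
  \sum_(0 <= s < a) \sum_(0 <= r < N) ind R (s == i + r)%N *
    (f s * \sum_(0 <= q < N) ind R (q < a - s)%N * winw r q).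
  rewrite [RHS]exchange_big_nat /=; apply: eq_bigr => r _.
  rewrite (sum_ind_eq a (i + r) (fun s => f s * \sum_(0 <= q < N)
    ind R (q < a - s)%N * winw r q)) !mulr_sumr; apply: eq_bigr => q _.
  rewrite ltn_subRL; case: (ltnP (i + r + q) a) => h /=.
    by rewrite (leq_ltn_trans _ h) ?leq_addr// /ind; ring.
  by rewrite /ind !mul0r !mulr0.
under eq_bigr do rewrite step.
rewrite exchange_big_nat /=; apply: eq_big_nat => s /andP[_ sa].
rewrite exchange_big_nat /= -sum_winw mulr_sumr.
rewrite -[RHS](@sum_ind_lt N); last by rewrite (leq_trans sa).
apply: eq_bigr => r _; rewrite sum_ind_lt; last by rewrite (leq_trans _ aN)// leq_subr.
transitivity (\sum_(0 <= i < a) ind R (i == s - r)%N * (ind R (r < s.+1)%N *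
    (f s * \sum_(0 <= q < a - s) winw r q))).
  apply: eq_big_nat => i /andP[_ ia]; rewrite [RHS]mulrA -ind_and; congr (ind _ _ * _).
  lia.
by rewrite (@sum_ind_eq a (s - r)%N (fun=> _)) (leq_ltn_trans (leq_subr _ _) sa) /ind mul1r.
Qed.

Definition wincum N n : R :=
  \sum_(0 <= r < N) \sum_(0 <= q < N) ind R (r + q < n)%N * winw r q.

Lemma winsum_first a N f :
  winsum a N (fun i r q => f i) = \sum_(0 <= i < a) f i * wincum N (a - i).
Proof.
apply: eq_bigr => i _; rewrite mulr_sumr; apply: eq_bigr => r _.
rewrite mulr_sumr; apply: eq_bigr => q _.
by rewrite ltn_subRL addnA; ring.
Qed.

Lemma winsum_last a N f :
  winsum a N (fun i r q => f (i + r + q)%N) =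
  \sum_(0 <= k < a) f k * wincum N k.+1.
Proof.
have step i : \sum_(0 <= r < N) \sum_(0 <= q < N)
    ind R (i + r + q < a)%N * (winw r q * f (i + r + q)%N) =
  \sum_(0 <= s < a) \sum_(0 <= r < N) \sum_(0 <= q < N)
    ind R (s == i + r + q)%N * (f s * winw r q).
  rewrite [RHS]exchange_big_nat /=; apply: eq_bigr => r _.
  rewrite [RHS]exchange_big_nat /=; apply: eq_bigr => q _.
  by rewrite (sum_ind_eq a (i + r + q) (fun s => f s * winw r q)); ring.
rewrite /winsum; under eq_bigr do rewrite step.
rewrite exchange_big_nat /=; apply: eq_big_nat => s /andP[_ sa].
rewrite exchange_big_nat /= mulr_sumr; apply: eq_bigr => r _.
rewrite exchange_big_nat /= mulr_sumr; apply: eq_bigr => q _.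
transitivity (\sum_(0 <= i < a) ind R (i == s - (r + q))%N *
    (ind R (r + q < s.+1)%N * (f s * winw r q))).
  apply: eq_big_nat => i /andP[_ ia]; rewrite [RHS]mulrA -ind_and; congr (ind _ _ * _).
  lia.
rewrite (@sum_ind_eq a (s - (r + q))%N (fun=> _)) (leq_ltn_trans (leq_subr _ _) sa).
by rewrite /ind; ring.
Qed.

Lemma sum_cumw a : (0 < a)%N ->
  \sum_(0 <= s < a) cumw s.+1 (a - s) = a%:R ^+ 2 / 6 + 12^-1.
Proof.
move=> a0; have A0 : 0 < a%:R :> R by rewrite ltr0n.
transitivity (a%:R^-1 * \sum_(0 <= s < a) ((s%:R + 2^-1) * (a%:R - s%:R - 2^-1)) : R).
  rewrite mulr_sumr; apply: eq_big_nat => s /andP[_ sa].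
  rewrite -[(a - s)%N]prednK ?subn_gt0// cumwSS -subn1 natrB ?subn_gt0// natrB; last exact: ltnW.
  have -> : s%:R + (a%:R - s%:R - 1) + 1 = a%:R :> R by ring.
  by rewrite [RHS]mulrC; congr (_ * _ / _); lra.
have aux (A : R) n : \sum_(0 <= s < n) ((s%:R + 2^-1) * (A - s%:R - 2^-1)) =
   A * n%:R ^+ 2 / 2 - n%:R ^+ 3 / 3 + n%:R / 12.
  elim: n => [|n ih]; first by rewrite big_geq//; ring.
  by rewrite big_nat_recr//= ih -(natr1 n); field.
by rewrite aux; field; rewrite gt_eqF.
Qed.

Lemma wincum_ge a N : (0 < a)%N -> (a <= N)%N ->
  (2 * a%:R - 1) / 6 <= wincum N a.
Proof.
move=> a0 aN.
have S n : (0 < n)%N -> (n <= N)%N ->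
    \sum_(0 <= i < n) wincum N i.+1 = n%:R ^+ 2 / 6 + 12^-1.
  move=> n0 nN; rewrite -sum_cumw//.
  transitivity (\sum_(0 <= i < n) (1 : R) * wincum N i.+1).
    by apply: eq_bigr => i _; rewrite mul1r.
  rewrite -(winsum_last n N (fun=> 1)) (winsum_mid (fun=> 1))//.
  by apply: eq_bigr => i _; rewrite mul1r.
case: a a0 aN => // -[|a] _ aN.
  by have := S 1%N isT aN; rewrite big_nat1 => ->; lra.
have := S a.+2 isT aN; rewrite big_nat_recr//= S//; last exact: ltnW.
by rewrite -(natr1 a.+1); lra.
Qed.

(** If the marked edge of every window is replaced by the average of its end
    edges, then every edge of the run gets the weight a / 6 at least. The first
    edges get more than the last ones from the left ends, and conversely for the
    right ends; the sum is almost constant along the run. *)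
Lemma winsum_ends_ge a N f : (a <= N)%N -> (forall i, (i < a)%N -> 0 <= f i) ->
  a%:R / 6 * \sum_(0 <= i < a) f i <=
  winsum a N (fun i r q => (f i + f (i + r + q)%N) / 2).
Proof.
move=> aN f0.
have -> : winsum a N (fun i r q => (f i + f (i + r + q)%N) / 2) =
    (winsum a N (fun i r q => f i) + winsum a N (fun i r q => f (i + r + q)%N)) / 2.
  rewrite /winsum -big_split /= mulr_suml; apply: eq_bigr => i _.
  rewrite -big_split /= mulr_suml; apply: eq_bigr => r _.
  by rewrite -big_split /= mulr_suml; apply: eq_bigr => q _; ring.
rewrite winsum_first winsum_last -big_split /= mulr_suml mulr_sumr.
rewrite big_nat [leRHS]big_nat; apply: ler_sum => i /andP[_ ia].
have h1 : (2 * (a - i)%:R - 1) / 6 <= wincum N (a - i).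
  by apply: wincum_ge; rewrite ?subn_gt0// (leq_trans (leq_subr _ _)).
have h2 : (2 * i.+1%:R - 1) / 6 <= wincum N i.+1.
  by apply: wincum_ge => //; exact: leq_trans aN.
rewrite -(natr1 i) in h2; rewrite natrB in h1; last exact: ltnW.
have := f0 i ia; nra.
Qed.

End window_weights.

(** * The mean distance of a sequence that rises and then falls *)

Section levels.
Variable R : realType.
Implicit Types (h : nat -> R) (B : nat -> bool) (n a b s : nat) (x y c C t : R).
Local Notation ind := (ind R).

Lemma cumwC (r q : nat) : cumw R r q = cumw R q r.
Proof.
by rewrite /cumw orbC; case: ifP => // _; congr (_ / _); ring.
Qed.

Lemma bmeas_ge x : bmeas (fun t => ind (x <= t)).
Proof. exact: bmeas_id_ge. Qed.

Lemma Int_step c C x : c <= x <= C -> Int c C (fun t => ind (x <= t)) = C - x.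
Proof.
move=> /andP[cx xC].
have -> : (fun t => ind (x <= t)) = \1_(`[x, +oo[%classic : set R).
  apply/funext => t; rewrite indicE /ind.
  by case: (boolP (x <= t)) => h; [rewrite mem_set|rewrite memNset] => //=;
     rewrite in_itv /= andbT //; apply/negP.
rewrite /Int /Rintegral integral_indic//.
have -> : `[x, +oo[%classic `&` `[c, C]%classic = `[x, C]%classic :> set R.
  apply/seteqP; split => t /=; rewrite !in_itv /= ?andbT.
    by move=> [-> /andP[_ ->]].
  by move=> /andP[h1 h2]; rewrite h1 h2 (le_trans cx h1).
rewrite /= lebesgue_measure_itv /= lte_fin; case: ltP => //= h.
by rewrite (@le_anti _ _ x C) ?subrr// xC.
Qed.

Lemma Int_abs c C x y : c <= x <= C -> c <= y <= C ->
  `|x - y| = Int c C (fun t => ind (x <= t) + ind (y <= t) -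
    2 * (ind (x <= t) * ind (y <= t))).
Proof.
wlog xy : x y / x <= y => [H|].
  move=> hx hy; have [xy|yx] := leP x y; first exact: H.
  rewrite distrC (H y x (ltW yx) hy hx); congr Int; apply/funext => t; ring.
move=> hx hy.
transitivity (Int c C (fun t => ind (x <= t) - ind (y <= t))).
  rewrite IntB ?Int_step//; try exact: bmeas_ge.
  by rewrite distrC ger0_norm ?subr_ge0//; ring.
congr Int; apply/funext => t; rewrite /ind.
case: (boolP (y <= t)) => yt; last by case: (x <= t); ring.
by rewrite (le_trans xy yt); ring.
Qed.

(** The amount of a run below a level, when the edge that crosses the level
    counts for one half. *)
Definition below B n : R := \sum_(0 <= j < n) (ind (B j) + ind (B j.+1)) / 2.

Lemma sum_step1 B n :
  \sum_(0 <= s < n) (ind (B s) - ind (B s.+1)) * (s%:R + 2^-1) =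
  below B n - n%:R * ind (B n).
Proof.
elim: n => [|n ih]; first by rewrite /below !big_geq// mul0r subr0.
by rewrite /below !big_nat_recr//= ih -(natr1 n) /below; field.
Qed.

Lemma below_le B n : (forall j, (j < n)%N -> B j.+1 -> B j) ->
  below B n * ind (B n) = n%:R * ind (B n).
Proof.
elim: n => [|n ih] hB; first by rewrite /below big_geq// !mul0r.
rewrite /below big_nat_recr//= -/(below B n) -(natr1 n).
case Bn : (B n.+1); last by rewrite /ind !mulr0.
have Bn' := hB n (ltnSn n) Bn.
have := ih (fun j hj => hB j (ltnW hj)); rewrite Bn' /ind !mulr1 => ->; lra.
Qed.

Lemma sum_step2 B n : (forall j, (j < n)%N -> B j.+1 -> B j) ->
  \sum_(0 <= s < n) (ind (B s) - ind (B s.+1)) * (s%:R + 2^-1) ^+ 2 =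
  below B n ^+ 2 - n%:R ^+ 2 * ind (B n).
Proof.
elim: n => [|n ih] hB.
  by rewrite /below !big_geq// expr0n /= mul0r subr0.
have hB' j : (j < n)%N -> B j.+1 -> B j by move=> hj; apply: hB; exact: ltnW.
rewrite big_nat_recr//= ih// [in RHS]/below big_nat_recr//= -/(below B n) -(natr1 n).
have := below_le hB'; have := hB n (ltnSn n).
case: (B n); case: (B n.+1) => /=; rewrite /ind ?mulr1 ?mulr0.
- by move=> _ ->; field.
- by move=> _ ->; field.
- by move=> /(_ isT).
- by move=> _ _; field.
Qed.

(** At a fixed level a monotone run is cut once, so that only one summand does
    not vanish and [cumw] is evaluated at the cut. *)
Lemma below_chain B n : (0 < n)%N -> (forall j, (j < n)%N -> B j.+1 -> B j) ->
  \sum_(0 <= s < n) (ind (B s) - ind (B s.+1)) * cumw R s.+1 (n - s) =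
  below B n * (n%:R - below B n) / n%:R.
Proof.
move=> n0 hB; have N0 : 0 < n%:R :> R by rewrite ltr0n.
transitivity (\sum_(0 <= s < n) ((ind (B s) - ind (B s.+1)) * (s%:R + 2^-1) -
    (ind (B s) - ind (B s.+1)) * (s%:R + 2^-1) ^+ 2 / n%:R)).
  apply: eq_big_nat => s /andP[_ sn].
  rewrite -[(n - s)%N]prednK ?subn_gt0// cumwSS -subn1 natrB ?subn_gt0// natrB; last exact: ltnW.
  have -> : s%:R + (n%:R - s%:R - 1) + 1 = n%:R :> R by ring.
  by field; rewrite gt_eqF.
rewrite sumrB -mulr_suml sum_step1 sum_step2//.
by field; rewrite gt_eqF.
Qed.

(** An energy distance identity. If P and Q are the amounts of the rising run of
    length [a] and of the falling run of length [b] below a level, then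
    [(P + Q) (a + b - P - Q) = (a + b) (P (a - P) / a + Q (b - Q) / b)
     + (b P - a Q) ^ 2 / (a b)],
    and integrating over the levels turns the left-hand side into all pairwise
    distances and the first two terms on the right into those within the two
    runs. The square measures how much the two runs differ. *)
Lemma updown_energy a b h c C : (0 < a)%N -> (0 < b)%N ->
  h (a + b)%N = h 0%N ->
  (forall i, (i < a)%N -> h i <= h i.+1) ->
  (forall i, (a <= i < a + b)%N -> h i.+1 <= h i) ->
  (forall i, (i <= a + b)%N -> c <= h i <= C) ->
  \sum_(0 <= i < a + b) \sum_(0 <= k < a + b) `|h i - h k| =
  2 * (a + b)%:R * (\sum_(0 <= s < a) (h s.+1 - h s) * cumw R s.+1 (a - s) +
    \sum_(0 <= s < b) (h (a + s)%N - h (a + s).+1) * cumw R s.+1 (b - s)) +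
  2 / (a%:R * b%:R) * Int c C (fun t =>
     (b%:R * below (fun j => h j <= t) a -
      a%:R * below (fun j => h (a + j)%N <= t) b) ^+ 2).
Proof.
move=> a0 b0 hN hup hdn hb.
have A0 : 0 < a%:R :> R by rewrite ltr0n.
have B0 : 0 < b%:R :> R by rewrite ltr0n.
pose P t := below (fun j => h j <= t) a.
pose Q t := below (fun j => h (a + j)%N <= t) b.
have mP : bmeas P.
  by apply: bmeas_sum => j _; apply: bmeasM; [apply: bmeasD; exact: bmeas_ge|exact: bmeas_cst].
have mQ : bmeas Q.
  by apply: bmeas_sum => j _; apply: bmeasM; [apply: bmeasD; exact: bmeas_ge|exact: bmeas_cst].
pose N : R := a%:R + b%:R.
(* every edge gives one half to each of its end points, and the sequence is
   cyclic, so that all points are counted once *)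
have count t : \sum_(0 <= i < a + b) ind (h i <= t) = P t + Q t.
  have sh n (F : nat -> R) : \sum_(0 <= j < n) (F j + F j.+1) / 2 =
      \sum_(0 <= j < n) F j + (F n - F 0%N) / 2.
    elim: n => [|n ih]; first by rewrite !big_geq//; ring.
    by rewrite !big_nat_recr//= ih; field.
  have -> : P t = _ := sh a (fun j => ind (h j <= t)).
  have -> : Q t = _ := sh b (fun j => ind (h (a + j)%N <= t)).
  rewrite hN addn0.
  rewrite (big_cat_nat (n := a))//= ?leq_addr//.
  have -> : \sum_(a <= i < a + b) ind (h i <= t) =
      \sum_(0 <= i < b) ind (h (a + i)%N <= t).
    rewrite -{1}[a]add0n big_addn addKn.
    by apply: eq_bigr => i _; rewrite addnC.
  ring.
have lhs : \sum_(0 <= i < a + b) \sum_(0 <= k < a + b) `|h i - h k| =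
    Int c C (fun t => 2 * ((P t + Q t) * (N - (P t + Q t)))).
  transitivity (\sum_(0 <= i < a + b) \sum_(0 <= k < a + b)
     Int c C (fun t => ind (h i <= t) + ind (h k <= t) -
    2 * (ind (h i <= t) * ind (h k <= t)))).
    apply: eq_big_nat => i /andP[_ hi]; apply: eq_big_nat => k /andP[_ hk].
    by apply: Int_abs; apply: hb; exact: ltnW.
  have mI i k : bmeas (fun t => ind (h i <= t) + ind (h k <= t) -
    2 * (ind (h i <= t) * ind (h k <= t))).
    apply: bmeasB; first by apply: bmeasD; exact: bmeas_ge.
    by apply: bmeasM; [exact: bmeas_cst|apply: bmeasM; exact: bmeas_ge].
  under eq_bigr do rewrite -Int_sum//.
  rewrite -Int_sum; last by move=> i _; exact: bmeas_sum.
  congr Int; apply/funext => t; rewrite -count.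
  have NE x : x *+ (a + b) = N * x by rewrite -mulr_natl natrD.
  set S := \sum_(0 <= i < a + b) ind (h i <= t).
  transitivity (\sum_(0 <= i < a + b) (N * ind (h i <= t) + S - 2 * ind (h i <= t) * S)).
    apply: eq_bigr => i _; rewrite sumrB big_split /= sumr_const_nat subn0.
    rewrite -mulr_sumr -mulr_sumr -/S NE; ring.
  rewrite sumrB big_split /= sumr_const_nat subn0 -mulr_sumr -mulr_suml -mulr_sumr -/S.
  rewrite NE; ring.
have up : \sum_(0 <= s < a) (h s.+1 - h s) * cumw R s.+1 (a - s) =
    Int c C (fun t => P t * (a%:R - P t) / a%:R).
  transitivity (\sum_(0 <= s < a) Int c C (fun t => cumw R s.+1 (a - s) *
     (ind (h s <= t) - ind (h s.+1 <= t)))).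
    apply: eq_big_nat => s /andP[_ sa]; rewrite IntZ; last by apply: bmeasB; exact: bmeas_ge.
    rewrite IntB ?Int_step; try exact: bmeas_ge; try apply: hb; try lia.
    ring.
  rewrite -Int_sum; last first.
    by move=> s _; apply: bmeasM; [exact: bmeas_cst|apply: bmeasB; exact: bmeas_ge].
  congr Int; apply/funext => t; rewrite -below_chain//; last first.
    by move=> j ja hj; apply: le_trans hj; exact: hup.
  by apply: eq_bigr => s _; rewrite mulrC.
have dn : \sum_(0 <= s < b) (h (a + s)%N - h (a + s).+1) * cumw R s.+1 (b - s) =
    Int c C (fun t => Q t * (b%:R - Q t) / b%:R).
  transitivity (\sum_(0 <= s < b) Int c C (fun t => cumw R s.+1 (b - s) *
     (ind (h (a + (b - s))%N <= t) - ind (h (a + (b - s.+1))%N <= t)))).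
    rewrite big_nat_rev /= add0n; apply: eq_big_nat => s /andP[_ sb].
    rewrite IntZ; last by apply: bmeasB; exact: bmeas_ge.
    rewrite IntB ?Int_step; try exact: bmeas_ge; try apply: hb; try lia.
    rewrite -[in LHS]addnS [(b - s.+1).+1](_ : _ = b - s)%N; last by lia.
    rewrite [(b - (b - s.+1))%N](_ : _ = s.+1); last by lia.
    rewrite mulrC; congr (_ * _); last by ring.
    exact: cumwC.
  rewrite -Int_sum; last first.
    by move=> s _; apply: bmeasM; [exact: bmeas_cst|apply: bmeasB; exact: bmeas_ge].
  congr Int; apply/funext => t.
  have -> : Q t = below (fun j => h (a + (b - j))%N <= t) b.
    rewrite /Q /below [RHS]big_nat_rev /= add0n; apply: eq_big_nat => s /andP[_ sb].
    rewrite [(b - (b - s.+1))%N](_ : _ = s.+1); last by lia.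
    rewrite [(b - (b - s.+1).+1)%N](_ : _ = s); last by lia.
    by rewrite addrC.
  rewrite -below_chain//; last first.
    move=> j jb hj; apply: le_trans hj.
    rewrite [(b - j)%N](_ : _ = (b - j.+1).+1); last by lia.
    rewrite addnS; apply: hdn; lia.
  by apply: eq_bigr => s _; rewrite mulrC.
rewrite lhs up dn natrD -/N -/P -/Q.
have m1 : bmeas (fun t => P t * (a%:R - P t) / a%:R).
  by apply: bmeasM; [apply: bmeasM => //; apply: bmeasB => //|]; exact: bmeas_cst.
have m2 : bmeas (fun t => Q t * (b%:R - Q t) / b%:R).
  by apply: bmeasM; [apply: bmeasM => //; apply: bmeasB => //|]; exact: bmeas_cst.
have m3 : bmeas (fun t => b%:R * P t - a%:R * Q t).
  by apply: bmeasB; apply: bmeasM => //; exact: bmeas_cst.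
have m4 : bmeas (fun t => (b%:R * P t - a%:R * Q t) ^+ 2).
  by under eq_fun do rewrite expr2; exact: bmeasM.
rewrite -IntD// -IntZ; last exact: bmeasD.
rewrite -IntZ// -IntD; last 2 first.
- by apply: bmeasM; [exact: bmeas_cst|exact: bmeasD].
- by apply: bmeasM; [exact: bmeas_cst|exact: m4].
congr Int; apply/funext => t; rewrite /N -/(P t) -/(Q t).
move: (P t) (Q t) => p q; field.
by rewrite !gt_eqF.
Qed.

End levels.

(** * Windows of edges that go the same way *)

Section polygon.
Variable R : realType.
Local Notation ind := (ind R).

Section runs.
Variables (N : nat).
Implicit Types (d : nat -> R) (i j n r q a b : nat).

(** Whether a window is coherent only depends on the direction of projection
    through the signs of its edges, so that the integral over the directions can
    be taken window by window. *)
Definition coherent d i n : bool :=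
  all (fun j => 0 < d i * d (i + j)%N) (iota 0 n.+1).

Lemma coherentP d i n :
  reflect (forall j, (j <= n)%N -> 0 < d i * d (i + j)%N) (coherent d i n).
Proof.
apply: (iffP allP) => h j; last by rewrite mem_iota add0n ltnS => /h.
by move=> jn; apply: h; rewrite mem_iota add0n ltnS.
Qed.

Definition updown d a b : Prop :=
  [/\ (0 < a)%N, (0 < b)%N, (a + b = N)%N,
      forall j, (j < a)%N -> 0 < d j &
      forall j, (a <= j < N)%N -> d j < 0].

Definition allwin d (G : nat -> nat -> nat -> R) : R :=
  \sum_(0 <= i < N) \sum_(0 <= r < N) \sum_(0 <= q < N)
    ind (coherent d i (r + q)) * (winw R r q * G i r q).

(** For a unimodal sequence the coherent windows are those inside one of the two
    runs, because a window around a turning point contains edges of both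
    signs. *)
Lemma allwin_updown d a b G : (forall j, d (j + N)%N = d j) -> updown d a b ->
  allwin d G = winsum a N G + winsum b N (fun i r q => G (a + i)%N r q).
Proof.
move=> dN [a0 b0 abN up dn].
rewrite /allwin (big_cat_nat (n := a))//=; last by rewrite -abN leq_addr.
congr (_ + _).
  apply: eq_big_nat => i /andP[_ ia].
  apply: eq_bigr => r _; apply: eq_bigr => q _; congr (ind _ * _).
  apply/coherentP/idP => [h|h j jrq]; last first.
    by rewrite mulr_gt0 ?up//; lia.
  rewrite ltnNge; apply/negP => hle.
  have := h (a - i)%N ltac:(lia); rewrite subnKC; last exact: ltnW.
  have h1 := up i ia; have h2 : d a < 0 by apply: dn; lia.
  by rewrite pmulr_rgt0// ltNge (ltW h2).
rewrite -{1}[a]add0n big_addn (_ : N - a = b)%N; last by lia.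
apply: eq_big_nat => i /andP[_ ib].
apply: eq_bigr => r _; apply: eq_bigr => q _; rewrite [(i + a)%N]addnC; congr (ind _ * _).
apply/coherentP/idP => [h|h j jrq]; last first.
  by rewrite nmulr_rgt0 ?dn//; lia.
rewrite ltnNge; apply/negP => hle.
have := h (b - i)%N ltac:(lia); rewrite (_ : a + i + (b - i) = 0 + N)%N; last by lia.
rewrite dN; have h1 : d (a + i)%N < 0 by apply: dn; lia.
by rewrite nmulr_rgt0// ltNge ltW// up.
Qed.

Lemma sum_period_shift (F : nat -> R) k : (forall j, F (j + N)%N = F j) ->
  \sum_(0 <= i < N) F (k + i)%N = \sum_(0 <= i < N) F i.
Proof.
move=> FN; elim: k => [|k ih]; first by [].
rewrite -ih; case: N FN => [|M] FN; first by rewrite !big_geq.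
rewrite big_nat_recr//= [RHS]big_nat_recl//= addrC addn0; congr (_ + _).
  by rewrite -[RHS]FN; congr F; lia.
by apply: eq_bigr => i _; congr F; lia.
Qed.

Lemma coherent_shift d k i n :
  coherent (fun j => d (k + j)%N) i n = coherent d (k + i) n.
Proof. by apply: eq_all => j; rewrite addnA. Qed.

Lemma allwin_shift d k (G : nat -> nat -> nat -> R) :
  (forall j, d (j + N)%N = d j) -> (forall i r q, G (i + N)%N r q = G i r q) ->
  allwin d G = allwin (fun j => d (k + j)%N) (fun i r q => G (k + i)%N r q).
Proof.
move=> dN GN; rewrite /allwin.
rewrite -(@sum_period_shift _ k) => [|i].
  apply: eq_bigr => i _; apply: eq_bigr => r _; apply: eq_bigr => q _.
  by rewrite coherent_shift.
apply: eq_bigr => r _; apply: eq_bigr => q _; rewrite GN; congr (ind _ * _).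
by apply: eq_all => j; rewrite addnAC !dN.
Qed.

End runs.

End polygon.

(** * The mean distance between the vertices of a convex polygon *)

Section polygon_inequality.
Variables (R : realType) (N : nat) (V : nat -> R * R) (delta : R).
Local Notation ind := (ind R).
Implicit Types (i j n r q k a b : nat) (u : R * R) (c C : R).

Definition edge j : R * R := V j.+1 - V j.
Definition unit_edge j : R * R :=
  ((edge j).1 / enorm (edge j), (edge j).2 / enorm (edge j)).
Definition rise u j : R := dotp (edge j) u.
Definition perim : R := \sum_(0 <= j < N) enorm (edge j).

(** The square in [updown_energy], read from the lowest vertex [k]. *)
Definition energy_gap u k a b c C : R :=
  2 / (a%:R * b%:R) * Int c C (fun t =>
     (b%:R * below R (fun j => dotp (V (k + j)%N) u <= t) a -
      a%:R * below R (fun j => dotp (V (k + (a + j))%N) u <= t) b) ^+ 2).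

(** By the symmetry of [Lam_wedge] the first and the last edge of the window
    yield the same value, see [window_mass_last]. *)
Definition window_mass i n : R :=
  Lam (fun u => ind (coherent (rise u) i n) * `|dotp (unit_edge i) u|).

Hypothesis N_gt0 : (0 < N)%N.
Hypothesis V_period : forall j, V (j + N)%N = V j.
Hypothesis edge_gt0 : forall j, 0 < enorm (edge j).
Hypothesis edge_le : forall j, enorm (edge j) <= delta.
(** The edges of a window that goes the same way everywhere turn in one sense by
    less than a half turn. *)
Hypothesis cone : forall i n r u, (r <= n)%N ->
  (forall j, (j <= n)%N -> 0 < dotp (edge (i + j)) u) ->
  exists al be : R, [/\ 0 <= al, 0 <= be,
    (edge (i + r)).1 = al * (edge i).1 + be * (edge (i + n)).1 &
    (edge (i + r)).2 = al * (edge i).2 + be * (edge (i + n)).2].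
Hypothesis unimodal : forall u, (forall j, rise u j != 0) ->
  exists k a b, updown N (fun j => rise u (k + j)%N) a b.

Let delta_gt0 : 0 < delta.
Proof. exact: lt_le_trans (edge_gt0 0) (edge_le 0). Qed.

Lemma edge_period j : edge (j + N) = edge j.
Proof. by rewrite /edge -addSn !V_period. Qed.

Lemma rise_period u j : rise u (j + N)%N = rise u j.
Proof. by rewrite /rise edge_period. Qed.

Lemma rise_unit u j : rise u j = enorm (edge j) * dotp (unit_edge j) u.
Proof.
by rewrite /rise /dotp /unit_edge /=; field; rewrite gt_eqF.
Qed.

Lemma enorm_unit_edge j : enorm (unit_edge j) = 1.
Proof.
have h := edge_gt0 j; apply/eqP; rewrite -(@eqrXn2 _ 2)// ?enorm_ge0//.
rewrite enorm_sq expr1n; apply/eqP.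
transitivity (dotp (edge j) (edge j) / enorm (edge j) ^+ 2).
  by rewrite /dotp /unit_edge /=; field; rewrite gt_eqF.
by rewrite -enorm_sq divff// expf_eq0 gt_eqF.
Qed.

Lemma dmeas_coherent i n : dmeas (fun u => ind (coherent (rise u) i n)).
Proof.
apply: (@bmeas_all_gt0 R nat (iota 0 n.+1)
  (fun j w => rise (cos w, sin w) i * rise (cos w, sin w) (i + j)%N)) => j.
by apply: bmeasM; exact: dmeas_dotp.
Qed.

Definition total_window u : R :=
  allwin N (rise u) (fun i r q => `|rise u (i + r)%N|).

Definition spread u : R :=
  \sum_(0 <= i < N) \sum_(0 <= k < N) `|dotp (V i) u - dotp (V k) u|.

(** By [updown_energy] in each direction: the pairwise distances of the heights
    are the rises of the marked edges of all coherent windows, up to the gap. *)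
Lemma spread_windows u k a b c C :
  updown N (fun j => rise u (k + j)%N) a b ->
  (forall i, c <= dotp (V i) u <= C) ->
  spread u = 2 * N%:R * total_window u + energy_gap u k a b c C.
Proof.
move=> ud hcC; have [a0 b0 abN up dn] := ud.
pose h j := dotp (V (k + j)%N) u.
have hS j : h j.+1 - h j = rise u (k + j)%N.
  by rewrite /h /rise /edge dotpBl addnS.
have -> : spread u = \sum_(0 <= i < a + b) \sum_(0 <= l < a + b) `|h i - h l|.
  rewrite abN /spread /h.
  rewrite -(@sum_period_shift R N _ k); last first.
    by move=> j; apply: eq_bigr => l _; rewrite V_period.
  apply: eq_bigr => i _.
  by rewrite -(@sum_period_shift R N _ k)// => j; rewrite V_period.
rewrite (@updown_energy R a b h c C)//; first last.
- by move=> i _; exact: hcC.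
- by move=> i hi; rewrite -subr_le0 hS ltW// dn// -abN.
- by move=> i hi; rewrite -subr_ge0 hS ltW// up.
- by rewrite /h abN V_period addn0.
rewrite abN; congr (_ * _ + _).
rewrite /total_window (@allwin_shift R N (rise u) k); first last.
- by move=> i r q; rewrite addnAC rise_period.
- exact: rise_period.
rewrite (@allwin_updown R N _ a b)//; last by move=> j; rewrite addnA rise_period.
rewrite (_ : winsum a N _ = winsum a N (fun i r q => `|rise u (k + (i + r))%N|)); last first.
  by apply: eq_bigr => i _; apply: eq_bigr => r _; apply: eq_bigr => q _; rewrite addnA.
rewrite (winsum_mid (fun s => `|rise u (k + s)%N|)); last by rewrite -abN leq_addr.
rewrite (_ : winsum b N _ = winsum b N (fun i r q => `|rise u (k + (a + (i + r)))%N|)); last first.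
  by apply: eq_bigr => i _; apply: eq_bigr => r _; apply: eq_bigr => q _; rewrite !addnA.
rewrite (winsum_mid (fun s => `|rise u (k + (a + s))%N|)); last by rewrite -abN leq_addl.
congr (_ + _).
  by apply: eq_big_nat => s /andP[_ hs]; rewrite hS gtr0_norm ?up.
apply: eq_big_nat => s /andP[_ hs]; rewrite -opprB hS ltr0_norm// dn; lia.
Qed.

(** The edges are rescaled to length one here, because the comparison of the
    marked edge with the end edges is one between unit vectors. *)
Definition end_window u : R := allwin N (rise u) (fun i r q =>
  (`|dotp (unit_edge i) u| + `|dotp (unit_edge (i + r + q)) u|) / 2).

Lemma unit_edge_period j : unit_edge (j + N) = unit_edge j.
Proof. by rewrite /unit_edge edge_period. Qed.

(** The two runs of lengths [a] and [b] have the same height, half of the total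
    variation. By [winsum_ends_ge] they contribute a / 6 and b / 6 times this
    height, and [a + b = N] makes the sum independent of the direction. *)
Lemma end_window_ge u : (forall j, rise u j != 0) ->
  N%:R / (12 * delta) * \sum_(0 <= j < N) `|rise u j| <= end_window u.
Proof.
move=> /unimodal[k [a [b ud]]]; have [a0 b0 abN up dn] := ud.
rewrite /end_window (@allwin_shift R N (rise u) k); first last.
- move=> i r q; rewrite (_ : i + N + r + q = (i + r + q) + N)%N; last by lia.
  by rewrite !unit_edge_period.
- exact: rise_period.
rewrite (@allwin_updown R N _ a b)//; last by move=> j; rewrite addnA rise_period.
pose y j := `|dotp (unit_edge (k + j)) u|.
have y_ge j : `|rise u (k + j)%N| / delta <= y j.
  rewrite rise_unit normrM (gtr0_norm (edge_gt0 _)) ler_pdivrMr// mulrC.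
  exact: ler_wpM2l.
have := @winsum_ends_ge R a N y ltac:(lia) (fun _ _ => normr_ge0 _).
have := @winsum_ends_ge R b N (fun j => y (a + j)%N) ltac:(lia) (fun _ _ => normr_ge0 _).
set w1 := winsum _ _ _; set w2 := winsum _ _ _ => h1 h2.
rewrite [X in _ <= X + _](_ : _ = w2); last first.
  apply: eq_bigr => i _; apply: eq_bigr => r _; apply: eq_bigr => q _.
  by rewrite /y !addnA.
rewrite [X in _ <= _ + X](_ : _ = w1); last first.
  apply: eq_bigr => i _; apply: eq_bigr => r _; apply: eq_bigr => q _.
  by rewrite /y !addnA.
pose d j := rise u (k + j)%N.
have tot : \sum_(0 <= j < N) d j = 0.
  rewrite (@sum_period_shift R N (rise u) k (rise_period u)).
  transitivity (\sum_(0 <= j < N) (dotp (V j.+1) u - dotp (V j) u)).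
    by apply: eq_bigr => j _; rewrite /rise /edge dotpBl.
  by rewrite telescope_sumr// -[N]add0n V_period subrr.
have split (F : nat -> R) : \sum_(0 <= j < N) F j =
    \sum_(0 <= j < a) F j + \sum_(0 <= j < b) F (a + j)%N.
  rewrite (big_cat_nat (n := a))//=; last by lia.
  rewrite -{2}[a]add0n big_addn (_ : N - a = b)%N; last by lia.
  by congr (_ + _); apply: eq_bigr => i _; rewrite addnC.
have eu : \sum_(0 <= j < a) `|d j| = \sum_(0 <= j < a) d j.
  by apply: eq_big_nat => j /andP[_ ja]; rewrite gtr0_norm ?up.
have ed : \sum_(0 <= j < b) `|d (a + j)%N| = - \sum_(0 <= j < b) d (a + j)%N.
  by rewrite -sumrN; apply: eq_big_nat => j /andP[_ jb]; rewrite ltr0_norm// dn; lia.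
have W : \sum_(0 <= j < N) `|rise u j| = 2 * \sum_(0 <= j < a) d j.
  rewrite -(@sum_period_shift R N (fun j => `|rise u j|) k); last by move=> j; rewrite rise_period.
  by rewrite (split (fun j => `|d j|)) eu ed; move: tot; rewrite split => ?; lra.
have s1 : (\sum_(0 <= j < a) d j) / delta <= \sum_(0 <= j < a) y j.
  by rewrite -eu mulr_suml; apply: ler_sum => j _; exact: y_ge.
have s2 : (\sum_(0 <= j < a) d j) / delta <= \sum_(0 <= j < b) y (a + j)%N.
  have -> : \sum_(0 <= j < a) d j = \sum_(0 <= j < b) `|d (a + j)%N|.
    by rewrite ed; move: tot; rewrite split; lra.
  by rewrite mulr_suml; apply: ler_sum => j _; exact: y_ge.
rewrite W -abN natrD.
have A0 : 0 < a%:R :> R by rewrite ltr0n.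
have B0 : 0 < b%:R :> R by rewrite ltr0n.
set S := \sum_(0 <= j < a) d j in s1 s2 *.
have -> : (a%:R + b%:R) / (12 * delta) * (2 * S) =
    a%:R / 6 * (S / delta) + b%:R / 6 * (S / delta).
  by field; rewrite gt_eqF.
apply: lerD.
  by apply: le_trans h2; rewrite ler_wpM2l// divr_ge0// ltW.
by apply: le_trans h1; rewrite ler_wpM2l// divr_ge0// ltW.
Qed.

Lemma edge_gt0M i j : 0 < enorm (edge i) * enorm (edge j).
Proof. by rewrite mulr_gt0. Qed.

Lemma unit_edge1 j : (unit_edge j).1 = (edge j).1 / enorm (edge j).
Proof. by []. Qed.

Lemma unit_edge2 j : (unit_edge j).2 = (edge j).2 / enorm (edge j).
Proof. by []. Qed.

Lemma cone_coherent i n r u : (r <= n)%N -> coherent (rise u) i n ->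
  exists al be : R, [/\ 0 <= al, 0 <= be,
    (unit_edge (i + r)).1 = al * (unit_edge i).1 + be * (unit_edge (i + n)).1 &
    (unit_edge (i + r)).2 = al * (unit_edge i).2 + be * (unit_edge (i + n)).2].
Proof.
move=> rn /coherentP coh.
have [v hv] : exists v, forall j, (j <= n)%N -> 0 < dotp (edge (i + j)) v.
  have := coh 0%N (leq0n n); rewrite addn0 => h0.
  have [di|di] := ltP 0 (rise u i).
    by exists u => j /coh; rewrite pmulr_rgt0.
  have di' : rise u i < 0.
    by rewrite lt_neqAle di andbT; apply: contraTneq h0 => ->; rewrite mul0r ltxx.
  exists (- u) => j /coh; rewrite nmulr_rgt0// /rise /dotp !pairE !mulrN -opprD.
  by rewrite oppr_gt0.
have [al [be [al0 be0 e1 e2]]] := cone rn hv.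
have hi := edge_gt0 i; have hn := edge_gt0 (i + n); have hr := edge_gt0 (i + r).
exists (al * enorm (edge i) / enorm (edge (i + r))).
exists (be * enorm (edge (i + n)) / enorm (edge (i + r))); split.
- by rewrite divr_ge0 ?mulr_ge0// ltW.
- by rewrite divr_ge0 ?mulr_ge0// ltW.
- by rewrite !unit_edge1 e1; field; rewrite !gt_eqF.
- by rewrite !unit_edge2 e2; field; rewrite !gt_eqF.
Qed.

Lemma coherent_ends i n u1 u : coherent (rise u1) i n ->
  coherent (rise u) i n = (0 < rise u i * rise u (i + n)%N).
Proof.
move=> coh1; apply/coherentP/idP => [h|h j jn]; first exact: h.
have [al [be [al0 be0 e1 e2]]] := cone_coherent jn coh1.
have eu v : dotp (unit_edge (i + j)) v =
    al * dotp (unit_edge i) v + be * dotp (unit_edge (i + n)) v.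
  by rewrite /dotp e1 e2; ring.
move: h; rewrite !rise_unit eu => h.
have hi := edge_gt0 i; have hn := edge_gt0 (i + n); have hj := edge_gt0 (i + j).
set x := dotp (unit_edge i) u in h *; set y := dotp (unit_edge (i + n)) u in h *.
have xy : 0 < x * y.
  by move: h; rewrite mulrACA (pmulr_rgt0 _ (edge_gt0M _ _)).
rewrite mulrACA (pmulr_rgt0 _ (edge_gt0M _ _)) mulrDr.
have x2 : 0 < x * x.
  rewrite -expr2 exprn_even_gt0//=; apply: contraTneq xy => ->.
  by rewrite mul0r ltxx.
have : 0 < al \/ 0 < be.
  have [al1|al1] := ltP 0 al; first by left.
  have [be1|be1] := ltP 0 be; first by right.
  have al00 : al = 0 by apply/le_anti; rewrite al1.
  have be00 : be = 0 by apply/le_anti; rewrite be1.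
  have := enorm_unit_edge (i + j); have : unit_edge (i + j) = 0.
    rewrite [LHS]surjective_pairing e1 e2 al00 be00 !mul0r addr0 //.
  by move=> ->; rewrite enorm0 => /esym/eqP; rewrite oner_eq0.
have a1 : 0 <= al * (x * x) by rewrite mulr_ge0// ltW.
have b1 : 0 <= be * (x * y) by rewrite mulr_ge0// ltW.
rewrite [x * (al * x)]mulrCA [x * (be * y)]mulrCA.
by case=> h1; [apply: ltr_pwDl|apply: ltr_pwDr] => //; rewrite mulr_gt0.
Qed.

(** A window that goes up in one direction turns by less than a half turn, and
    then it goes up in every direction in which its end edges do. *)
Lemma window_mass_coherent i n u1 : coherent (rise u1) i n ->
  window_mass i n = 2 * (1 + dotp (unit_edge i) (unit_edge (i + n))).
Proof.
move=> coh1; rewrite -Lam_wedge ?enorm_unit_edge//.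
apply: eq_Lam => u hu; rewrite (coherent_ends u coh1) !rise_unit mulrACA.
by rewrite (pmulr_rgt0 _ (edge_gt0M _ _)).
Qed.

Lemma window_mass_last i n :
  Lam (fun u => ind (coherent (rise u) i n) * `|dotp (unit_edge (i + n)) u|) =
  window_mass i n.
Proof.
have [[u1 coh1]|none] := pselect (exists u1, coherent (rise u1) i n).
  rewrite (window_mass_coherent coh1).
  transitivity (2 * (1 + dotp (unit_edge (i + n)) (unit_edge i))); last first.
    by rewrite /dotp; ring.
  rewrite -Lam_wedge ?enorm_unit_edge//.
  apply: eq_Lam => u hu; rewrite (coherent_ends u coh1) !rise_unit mulrACA.
  by rewrite (pmulr_rgt0 _ (edge_gt0M _ _)) mulrC [X in ind (_ < X)]mulrC mulrC.
apply: eq_Lam => u _; case: (boolP (coherent _ _ _)) => [h|_].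
  by case: none; exists u.
by rewrite /ind !mul0r.
Qed.

Lemma window_mass_bounds i n : 0 <= window_mass i n <= 4.
Proof.
have [[u1 coh1]|none] := pselect (exists u1, coherent (rise u1) i n).
  rewrite (window_mass_coherent coh1).
  have := normr_dotp_le (unit_edge i) (unit_edge (i + n)).
  by rewrite !enorm_unit_edge mulr1 ler_norml => h; lra.
rewrite /window_mass (@eq_Lam _ _ (fun=> 0)) ?Lam_cst ?mul0r ?lexx ?ler0n//.
move=> u _; case: (boolP (coherent _ _ _)) => [h|_].
  by case: none; exists u.
by rewrite /ind !mul0r.
Qed.

(** A unit vector [e = al e1 + be e2] in the cone of two unit vectors satisfies
    [1 <= al + be]. A lower bound for the slack is called [gain]; it can be positive
    only for windows that turn properly. *)
Variable gain : nat -> nat -> nat -> R.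
Hypothesis gain01 : forall i r q, 0 <= gain i r q <= 1.
Hypothesis gain_le : forall i r q u, coherent (rise u) i (r + q) ->
  forall al be : R, 0 <= al -> 0 <= be ->
    (unit_edge (i + r)).1 = al * (unit_edge i).1 + be * (unit_edge (i + (r + q))).1 ->
    (unit_edge (i + r)).2 = al * (unit_edge i).2 + be * (unit_edge (i + (r + q))).2 ->
  1 + gain i r q <= al + be.

(** The marked edge is a combination of the end edges with coefficients of sum at
    least [1 + gain], and both end edges rise by [window_mass]. *)
Lemma window_mass_mid i r q :
  enorm (edge (i + r)) * (1 + gain i r q) * window_mass i (r + q) <=
  Lam (fun u => ind (coherent (rise u) i (r + q)) * `|rise u (i + r)%N|).
Proof.
have /andP[k0 _] := window_mass_bounds i (r + q).
have [[u1 coh1]|none] := pselect (exists u1, coherent (rise u1) i (r + q)); last first.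
  rewrite (_ : window_mass _ _ = 0) ?mulr0.
    by apply: Int_ge0 => w; rewrite mulr_ge0 ?ind_ge0.
  rewrite /window_mass (@eq_Lam _ _ (fun=> 0)) ?Lam_cst ?mul0r//.
  move=> u _; case: (boolP (coherent _ _ _)) => [h|_].
    by case: none; exists u.
  by rewrite /ind mul0r.
have [al [be [al0 be0 e1 e2]]] := cone_coherent (leq_addr q r) coh1.
have g := gain_le coh1 al0 be0 e1 e2.
have hr := edge_gt0 (i + r).
have eu v : dotp (unit_edge (i + r)) v =
    al * dotp (unit_edge i) v + be * dotp (unit_edge (i + (r + q))) v.
  by rewrite /dotp e1 e2; ring.
pose I u := ind (coherent (rise u) i (r + q)).
have mI : dmeas I := dmeas_coherent i (r + q).
have m1 j : dmeas (fun u => I u * `|dotp (unit_edge j) u|).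
  by apply: bmeasM => //; apply: bmeas_norm; exact: dmeas_dotp.
have -> : Lam (fun u => I u * `|rise u (i + r)%N|) =
    enorm (edge (i + r)) * (al * window_mass i (r + q) + be * window_mass i (r + q)).
  rewrite -{2}window_mass_last /window_mass -!LamZ// -LamD; last 2 first.
  - by apply: bmeasM; [exact: bmeas_cst|exact: m1].
  - by apply: bmeasM; [exact: bmeas_cst|exact: m1].
  rewrite -LamZ; last first.
    by apply: bmeasD; apply: bmeasM; (exact: bmeas_cst || exact: m1).
  apply: eq_Lam => u hu; rewrite /I.
  case: (boolP (coherent _ _ _)) => [|_]; last by rewrite /ind; ring.
  rewrite (coherent_ends u coh1) !rise_unit eu mulrACA (pmulr_rgt0 _ (edge_gt0M _ _)).
  rewrite /ind !mul1r normrM (gtr0_norm hr); set x := dotp _ _; set y := dotp _ _ => xy.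
  congr (_ * _).
  have [x0|x0] := ltP 0 x.
    have y0 : 0 < y by move: xy; rewrite pmulr_rgt0.
    rewrite (gtr0_norm x0) (gtr0_norm y0) ger0_norm//.
    by rewrite addr_ge0 ?mulr_ge0// ltW.
  have x0' : x < 0.
    by rewrite lt_neqAle x0 andbT; apply: contraTneq xy => ->; rewrite mul0r ltxx.
  have y0 : y < 0 by move: xy; rewrite nmulr_rgt0.
  have hx : al * x <= 0 by rewrite mulr_ge0_le0.
  have hy : be * y <= 0 by rewrite mulr_ge0_le0// ltW.
  rewrite (ltr0_norm x0') (ltr0_norm y0) ler0_norm; first by ring.
  by rewrite -[leRHS]addr0 lerD.
rewrite -mulrDl mulrA; apply: ler_wpM2r => //.
by rewrite ler_pM2l.
Qed.

Lemma perim_le : perim <= N%:R * delta.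
Proof.
rewrite /perim; apply: (@le_trans _ _ (\sum_(0 <= j < N) delta)).
  by apply: ler_sum => j _; exact: edge_le.
by rewrite sumr_const_nat subn0 -[delta *+ N]mulr_natl.
Qed.

Definition wsum (G : nat -> nat -> nat -> R) : R :=
  \sum_(0 <= i < N) \sum_(0 <= r < N) \sum_(0 <= q < N) winw R r q * G i r q.

Lemma le_wsum G G' : (forall i r q, G i r q <= G' i r q) -> wsum G <= wsum G'.
Proof.
move=> h; do 3 (apply: ler_sum => ? _); apply: ler_wpM2l => //; exact: winw_ge0.
Qed.

Lemma wsumD G G' : wsum (fun i r q => G i r q + G' i r q) = wsum G + wsum G'.
Proof.
rewrite /wsum -big_split; apply: eq_bigr => i _.
rewrite -big_split; apply: eq_bigr => r _.
by rewrite -big_split; apply: eq_bigr => q _; rewrite mulrDr.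
Qed.

Lemma wsumZ (z : R) G : wsum (fun i r q => z * G i r q) = z * wsum G.
Proof.
rewrite /wsum mulr_sumr; apply: eq_bigr => i _.
rewrite mulr_sumr; apply: eq_bigr => r _.
by rewrite mulr_sumr; apply: eq_bigr => q _; rewrite mulrCA.
Qed.

Lemma Lam_allwin (G : R * R -> nat -> nat -> nat -> R) :
  (forall i r q, dmeas (fun u => G u i r q)) ->
  Lam (fun u => allwin N (rise u) (G u)) =
  wsum (fun i r q => Lam (fun u => ind (coherent (rise u) i (r + q)) * G u i r q)).
Proof.
move=> mG.
have m0 i r q : dmeas (fun u => ind (coherent (rise u) i (r + q)) * G u i r q).
  by apply: bmeasM; [exact: dmeas_coherent|exact: mG].
have m1 i r q : dmeas (fun u => ind (coherent (rise u) i (r + q)) * (winw R r q * G u i r q)).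
  apply: bmeasM; first exact: dmeas_coherent.
  by apply: bmeasM; [exact: bmeas_cst|exact: mG].
have m2 i r : dmeas (fun u => \sum_(0 <= q < N)
    ind (coherent (rise u) i (r + q)) * (winw R r q * G u i r q)).
  by apply: bmeas_sum => q _; exact: m1.
have m3 i : dmeas (fun u => \sum_(0 <= r < N) \sum_(0 <= q < N)
    ind (coherent (rise u) i (r + q)) * (winw R r q * G u i r q)).
  by apply: bmeas_sum => r _; exact: m2.
rewrite /allwin Lam_sum => [|i _]; last exact: m3.
apply: eq_bigr => i _; rewrite Lam_sum => [|r _]; last exact: m2.
apply: eq_bigr => r _; rewrite Lam_sum => [|q _]; last exact: m1.
apply: eq_bigr => q _; rewrite -LamZ//.
by apply: eq_Lam => u _; rewrite mulrCA.
Qed.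

Lemma dmeas_allwin (G : R * R -> nat -> nat -> nat -> R) :
  (forall i r q, dmeas (fun u => G u i r q)) ->
  dmeas (fun u => allwin N (rise u) (G u)).
Proof.
move=> mG; apply: bmeas_sum => i _; apply: bmeas_sum => r _; apply: bmeas_sum => q _.
apply: bmeasM; first exact: dmeas_coherent.
by apply: bmeasM; [exact: bmeas_cst|exact: mG].
Qed.

Let dirs := [seq unit_edge j | j <- iota 0 N].

Let dirs_unit e : e \in dirs -> enorm e = 1.
Proof. by move=> /mapP[j _ ->]; exact: enorm_unit_edge. Qed.

Let dirs_generic u : (forall e, e \in dirs -> dotp e u != 0) -> forall j, rise u j != 0.
Proof.
move=> h j; have hm k : rise u (k %% N + k %/ N * N)%N = rise u (k %% N).
  elim: (k %/ N)%N => [|n ih]; first by rewrite addn0.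
  by rewrite mulSn addnCA addnC rise_period.
rewrite [j](divn_eq j N) addnC hm rise_unit; apply: mulf_neq0.
  by rewrite gt_eqF.
by apply: h; apply: map_f; rewrite mem_iota add0n ltn_mod N_gt0.
Qed.

(** Exchange the integral over the directions with the sum over the windows,
    replace the marked edges by the end edges inside each window, and exchange
    back: then [end_window_ge] and Crofton's formula give the main term. Edges
    shorter than [delta] cost at most 8 times the difference per window. *)
Lemma Lam_total_window_ge :
  N%:R / 3 * perim - 4 * N%:R * (N%:R * delta - perim) +
  delta * wsum (fun i r q => gain i r q * window_mass i (r + q)) <=
  Lam total_window.
Proof.
have mt : forall i r q : nat, dmeas (fun u => `|rise u (i + r)%N|).
  by move=> i r q; apply: bmeas_norm; exact: dmeas_dotp.
have me : forall i r q : nat, dmeas (fun u =>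
    (`|dotp (unit_edge i) u| + `|dotp (unit_edge (i + r + q)) u|) / 2).
  move=> i r q; apply: bmeasM; last exact: bmeas_cst.
  by apply: bmeasD; apply: bmeas_norm; exact: dmeas_dotp.
rewrite /total_window (Lam_allwin mt).
pose K i r q := window_mass i (r + q).
apply: (@le_trans _ _ (wsum (fun i r q => delta * K i r q +
    (delta * (gain i r q * K i r q) + (- 8) * (delta - enorm (edge (i + r))))))); last first.
  apply: le_wsum => i r q; apply: le_trans (window_mass_mid i r q).
  rewrite -/(K i r q); have /andP[k0 k4] := window_mass_bounds i (r + q).
  rewrite -/(K i r q) in k0 k4; have /andP[g0 g1] := gain01 i r q.
  have hm := edge_le (i + r).
  set g := gain i r q in g0 g1 *; set k := K i r q in k0 k4 *.
  set m := enorm _ in hm *.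
  have h8 : (1 + g) * k <= 8.
    have : (1 + g) * k <= 2 * 4 by apply: ler_pM; lra.
    lra.
  have : (delta - m) * ((1 + g) * k) <= (delta - m) * 8.
    by apply: ler_wpM2l => //; lra.
  lra.
rewrite !wsumD !wsumZ.
have D : wsum (fun i r _ => delta - enorm (edge (i + r))) =
    cumw R N N * (N%:R * delta - perim).
  have S r : \sum_(0 <= i < N) (delta - enorm (edge (i + r))) = N%:R * delta - perim.
    rewrite sumrB sumr_const_nat subn0 -[delta *+ N]mulr_natl; congr (_ - _).
    have := @sum_period_shift R N (fun i => enorm (edge i)) r
      (fun j => congr1 (@enorm R) (edge_period j)).
    by rewrite /perim => <-; apply: eq_bigr => i _; rewrite addnC.
  rewrite /wsum exchange_big_nat /= -sum_winw mulr_suml; apply: eq_bigr => r _.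
  rewrite exchange_big_nat /= mulr_suml; apply: eq_bigr => q _.
  by rewrite -mulr_sumr S.
rewrite D.
have E : N%:R / 3 * perim <= delta * wsum K.
  have -> : wsum K = Lam end_window.
    rewrite /end_window (Lam_allwin me).
    apply: eq_bigr => i _; apply: eq_bigr => r _; apply: eq_bigr => q _; congr (_ * _).
    rewrite /K -[LHS](_ : 2^-1 * (window_mass i (r + q) + window_mass i (r + q)) = _); last by field.
    rewrite -{2}window_mass_last /window_mass -LamD; last 2 first.
    - apply: bmeasM; first exact: dmeas_coherent.
      by apply: bmeas_norm; exact: dmeas_dotp.
    - apply: bmeasM; first exact: dmeas_coherent.
      by apply: bmeas_norm; exact: dmeas_dotp.
    rewrite -LamZ; last first.
      apply: bmeasD; (apply: bmeasM; first exact: dmeas_coherent);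
      by apply: bmeas_norm; exact: dmeas_dotp.
    by apply: eq_Lam => u _; rewrite addnA; field.
  have mr j : dmeas (fun u => `|rise u j|) by apply: bmeas_norm; exact: dmeas_dotp.
  have mS : dmeas (fun u => \sum_(0 <= j < N) `|rise u j|) by apply: bmeas_sum => j _; exact: mr.
  have : Lam (fun u => N%:R / (12 * delta) * \sum_(0 <= j < N) `|rise u j|) <= Lam end_window.
    apply: (@le_Lam_generic _ dirs) => //.
    - by apply: bmeasM => //; exact: bmeas_cst.
    - exact: dmeas_allwin.
    - by move=> u _ /dirs_generic; exact: end_window_ge.
  rewrite LamZ// Lam_sum//.
  under eq_bigr do rewrite Lam_abs_dotp.
  rewrite -mulr_sumr -/perim => h.
  rewrite -ler_pdivrMl//; apply: le_trans h.
  by rewrite le_eqVlt; apply/orP; left; apply/eqP; field; rewrite gt_eqF.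
have hp := perim_le.
(* the weights of all windows at a given first edge add up to cumw N N, which is
   about N / 2 *)
have cN : cumw R N N <= N%:R / 2.
  case: N N_gt0 => // M _; rewrite cumwSS -(natr1 M); have := ler0n R M.
  set x := M%:R => x0; rewrite ler_pdivrMr; last by lra.
  nra.
have h9 : cumw R N N * (N%:R * delta - perim) <= N%:R / 2 * (N%:R * delta - perim).
  by apply: ler_wpM2r => //; rewrite subr_ge0.
set W := wsum _ in E *; set G := wsum _; lra.
Qed.

Variable gp : R * R -> R.
Hypothesis dmeas_gp : dmeas gp.
Hypothesis gp_le : forall u k a b c C, enorm u = 1 ->
  updown N (fun j => rise u (k + j)%N) a b ->
  (forall i, c <= dotp (V i) u <= C) -> gp u <= energy_gap u k a b c C.

Lemma dotp_bounds u : exists c C, forall i, c <= dotp (V i) u <= C.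
Proof.
pose S := \sum_(0 <= j < N) `|dotp (V j) u|.
have h i : `|dotp (V i) u| <= S.
  have -> : V i = V (i %% N).
    rewrite {1}(divn_eq i N) addnC; elim: (i %/ N)%N => [|n ih]; first by rewrite addn0.
    by rewrite mulSn addnCA addnC V_period.
  rewrite /S big_mkord (bigD1 (Ordinal (ltn_pmod i N_gt0)))//= lerDl.
  exact: sumr_ge0.
by exists (- S), S => i; rewrite -ler_norml.
Qed.

(** Crofton's formula applied to [spread_windows]. The last two summands on the
    left are the gains that make the inequality strict: the first comes from
    windows that turn, the second from runs that differ. *)
Theorem polygon_mean_distance :
  N%:R ^+ 2 / 6 * perim - 2 * N%:R ^+ 2 * (N%:R * delta - perim) +
  N%:R / 2 * delta * wsum (fun i r q => gain i r q * window_mass i (r + q)) +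
  Lam gp / 4 <=
  \sum_(0 <= i < N) \sum_(0 <= k < N) enorm (V i - V k).
Proof.
have mt : dmeas total_window.
  by apply: dmeas_allwin => i r q; apply: bmeas_norm; exact: dmeas_dotp.
have md i k : dmeas (fun u => `|dotp (V i - V k) u|) by dmeas_tac.
have ms : dmeas spread.
  apply: bmeas_sum => i _; apply: bmeas_sum => k _.
  by apply: bmeas_norm; apply: bmeasB; exact: dmeas_dotp.
have A : Lam spread = 4 * \sum_(0 <= i < N) \sum_(0 <= k < N) enorm (V i - V k).
  rewrite (@eq_Lam _ _ (fun u => \sum_(0 <= i < N) \sum_(0 <= k < N) `|dotp (V i - V k) u|)).
    rewrite Lam_sum => [|i _]; last by apply: bmeas_sum => k _; exact: md.
    rewrite mulr_sumr; apply: eq_bigr => i _; rewrite Lam_sum// mulr_sumr.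
    by apply: eq_bigr => k _; exact: Lam_abs_dotp.
  by move=> u _; apply: eq_bigr => i _; apply: eq_bigr => k _; rewrite dotpBl.
have mt' : dmeas (fun u => 2 * N%:R * total_window u).
  by apply: bmeasM => //; exact: bmeas_cst.
have : 2 * N%:R * Lam total_window + Lam gp <= Lam spread.
  rewrite -LamZ// -LamD//.
  apply: (@le_Lam_generic _ dirs) => //; first exact: bmeasD.
  move=> u hu /dirs_generic /unimodal[k [a [b ud]]].
  have [c [C hcC]] := dotp_bounds u.
  by rewrite (spread_windows ud hcC) lerD2l; apply: gp_le.
have := Lam_total_window_ge; have n0 : 0 < N%:R :> R by rewrite ltr0n.
move=> /(ler_wpM2l (ltW n0)); rewrite A; lra.
Qed.

End polygon_inequality.

(** * Closed convex curves *)

Section plane_order.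
Variable R : realType.
Implicit Types (p q r u w x y z : R * R).

(** The plane has dimension two: Cramer's relation between three vectors. *)
Lemma crossp_mid_dotp p q r u :
  crossp p r * dotp q u = crossp p q * dotp r u + crossp q r * dotp p u.
Proof. rewrite /crossp /dotp; ring. Qed.

Lemma crossp_trans p q r u : 0 < dotp p u -> 0 < dotp q u -> 0 < dotp r u ->
  0 <= crossp p q -> 0 <= crossp q r -> 0 <= crossp p r.
Proof.
move=> pu qu ru pq qr; rewrite -(pmulr_lge0 _ qu) crossp_mid_dotp.
by rewrite addr_ge0// mulr_ge0// ltW.
Qed.

Lemma mid_in_cone p q r u : 0 < dotp p u -> 0 < dotp q u -> 0 < dotp r u ->
  0 <= crossp p q -> 0 <= crossp q r ->
  exists al be : R, [/\ 0 <= al, 0 <= be,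
    q.1 = al * p.1 + be * r.1 & q.2 = al * p.2 + be * r.2].
Proof.
move=> pu qu ru pq qr; have pr := crossp_trans pu qu ru pq qr.
have [pr0|pr0] := ltP 0 (crossp p r).
  exists (crossp q r / crossp p r), (crossp p q / crossp p r).
  rewrite !divr_ge0//; split=> //.
  - apply: (mulIf (lt0r_neq0 pr0)); rewrite mulrDl mulrAC divfK ?gt_eqF//.
    by rewrite [X in _ = _ + X]mulrAC divfK ?gt_eqF// /crossp; ring.
  - apply: (mulIf (lt0r_neq0 pr0)); rewrite mulrDl mulrAC divfK ?gt_eqF//.
    by rewrite [X in _ = _ + X]mulrAC divfK ?gt_eqF// /crossp; ring.
have pr00 : crossp p r = 0 by apply/le_anti; rewrite pr0.
have pq0 : crossp p q = 0.
  have := crossp_mid_dotp p q r u; rewrite pr00 mul0r => /esym/eqP.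
  rewrite paddr_eq0 ?mulr_ge0 ?(ltW ru) ?(ltW pu)// => /andP[].
  by rewrite mulf_eq0 (gt_eqF ru) orbF => /eqP.
exists (dotp q u / dotp p u), 0; rewrite lexx divr_ge0 ?ltW// !mul0r !addr0; split => //.
- apply: (mulIf (lt0r_neq0 pu)); rewrite mulrAC divfK ?gt_eqF//; apply: subr0_eq.
  transitivity (- u.2 * crossp p q); last by rewrite pq0 mulr0.
  by rewrite /dotp /crossp; ring.
- apply: (mulIf (lt0r_neq0 pu)); rewrite mulrAC divfK ?gt_eqF//; apply: subr0_eq.
  transitivity (u.1 * crossp p q); last by rewrite pq0 mulr0.
  by rewrite /dotp /crossp; ring.
Qed.

Lemma orient_cycle x y z : orient x y z = orient y z x.
Proof. rewrite /orient /crossp !pairE; ring. Qed.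

(** Both sides are the value of [u] at the common point of the two diagonals of a
    quadrilateral, up to the common factor of [orient_sum]. *)
Lemma diagonals x y z w u :
  orient y z w * dotp x u + orient w x y * dotp z u =
  orient z w x * dotp y u + orient x y z * dotp w u.
Proof. rewrite /orient /crossp /dotp !pairE; ring. Qed.

Lemma orient_sum x y z w :
  orient y z w + orient w x y = orient z w x + orient x y z.
Proof. rewrite /orient /crossp !pairE; ring. Qed.

End plane_order.

(** The boundary of a convex body, traversed counterclockwise and extended
    periodically. Convexity is expressed by the orientation of triples; degenerate loops, such
    as a segment covered twice, are excluded by the last two fields. *)
Record convex_loop (R : realType) (l : R) (G : R -> R * R) : Prop := ConvexLoop {
  loop_gt0 : 0 < l;
  loop_period : forall s, G (s + l) = G s;
  loop_lip : forall s t, enorm (G s - G t) <= `|s - t|;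
  loop_orient : forall s t v, s <= t -> t <= v -> v <= s + l ->
    0 <= orient (G s) (G t) (G v);
  loop_off_line : forall s (n : R * R) c, n <> 0 ->
    exists2 t, s <= t <= s + l & dotp (G t) n != c;
  loop_inj : forall s t, s < t -> t < s + l -> G s <> G t
}.

Section loops.
Variables (R : realType) (l : R) (G : R -> R * R).
Hypothesis LG : convex_loop l G.
Implicit Types (u : R * R) (s t : R).

(** The heights along a convex loop cannot go up and down twice: the diagonals of
    the quadrilateral formed by two peaks and two valleys meet in a point, which
    would be both higher and lower. *)
Lemma loop_no_alternation s1 s2 s3 s4 u (h := fun s => dotp (G s) u) :
  s1 < s2 -> s2 < s3 -> s3 < s4 -> s4 < s1 + l ->
  h s1 < h s2 -> h s3 < h s2 -> h s1 < h s4 -> h s3 < h s4 -> False.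
Proof.
move=> s12 s23 s34 s41 h12 h32 h14 h34.
have := diagonals (G s1) (G s2) (G s3) (G s4) u.
have := orient_sum (G s1) (G s2) (G s3) (G s4).
have a0 : 0 <= orient (G s2) (G s3) (G s4) by apply: (loop_orient LG); lra.
have b0 : 0 <= orient (G s4) (G s1) (G s2).
  by rewrite orient_cycle; apply: (loop_orient LG); lra.
have c0 : 0 <= orient (G s3) (G s4) (G s1).
  by rewrite -orient_cycle; apply: (loop_orient LG); lra.
have d0 : 0 <= orient (G s1) (G s2) (G s3) by apply: (loop_orient LG); lra.
rewrite -/(h s1) -/(h s2) -/(h s3) -/(h s4) => sumE diagE.
have hmid : exists m, [/\ h s1 < m, h s3 < m, m < h s2 & m < h s4].
  pose lo := Num.max (h s1) (h s3); pose hi := Num.min (h s2) (h s4).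
  have lohi : lo < hi by rewrite lt_min !gt_max h12 h32 h14 h34.
  exists ((lo + hi) / 2).
  have l1 : h s1 <= lo by rewrite le_max lexx.
  have l3 : h s3 <= lo by rewrite le_max lexx orbT.
  have l2 : hi <= h s2 by rewrite ge_min lexx.
  have l4 : hi <= h s4 by rewrite ge_min lexx orbT.
  by split; lra.
have [m [m1 m3 m2 m4]] := hmid.
have [a ea] : exists a, orient (G s2) (G s3) (G s4) = a by eexists.
have [b eb] : exists b, orient (G s4) (G s1) (G s2) = b by eexists.
have [c ec] : exists c, orient (G s3) (G s4) (G s1) = c by eexists.
have [d ed] : exists d, orient (G s1) (G s2) (G s3) = d by eexists.
rewrite ea eb ec ed in a0 b0 c0 d0 sumE diagE.
have za : a * (m - h s1) + b * (m - h s3) + c * (h s2 - m) + d * (h s4 - m) = 0.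
  transitivity ((a + b - (c + d)) * m - (a * h s1 + b * h s3 - (c * h s2 + d * h s4))).
    by ring.
  by rewrite sumE diagE; ring.
have p1 : 0 <= a * (m - h s1) by rewrite mulr_ge0// subr_ge0 ltW.
have p2 : 0 <= b * (m - h s3) by rewrite mulr_ge0// subr_ge0 ltW.
have p3 : 0 <= c * (h s2 - m) by rewrite mulr_ge0// subr_ge0 ltW.
have p4 : 0 <= d * (h s4 - m) by rewrite mulr_ge0// subr_ge0 ltW.
have d00 : d = 0.
  have /eqP : d * (h s4 - m) = 0 by lra.
  by rewrite mulf_eq0 subr_eq0 (gt_eqF m4) orbF => /eqP.
have b00 : b = 0.
  have /eqP : b * (m - h s3) = 0 by lra.
  by rewrite mulf_eq0 subr_eq0 (gt_eqF m3) orbF => /eqP.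
(* the four points are collinear; compare with a point off their line *)
pose n : R * R := (- (G s2 - G s1).2, (G s2 - G s1).1).
have n0 : n <> 0.
  move=> n0; have e1 : (G s2 - G s1).1 = 0 by rewrite -[RHS]/((0 : R * R).2) -n0.
  have e2 : (G s2 - G s1).2 = 0.
    by apply: oppr_inj; rewrite -[LHS]/(n.1) n0 oppr0.
  have : h s2 - h s1 = 0 by rewrite /h -dotpBl /dotp e1 e2 !mul0r addr0.
  lra.
have [w /andP[w1 w2] wn] := loop_off_line LG s1 (dotp (G s1) n) n0.
have Kn x : dotp x n - dotp (G s1) n = orient x (G s1) (G s2).
  by rewrite /dotp /orient /crossp /n !pairE /=; ring.
have K0 : orient (G w) (G s1) (G s2) != 0 by rewrite -Kn subr_eq0.
set K := orient (G w) (G s1) (G s2) in K0.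
have c3 : orient (G s3) (G s1) (G s2) = 0 by rewrite orient_cycle ed.
have c4 : orient (G s4) (G s1) (G s2) = 0 by rewrite orient_cycle -b00 -eb -orient_cycle orient_cycle.
have c1 : orient (G s1) (G s1) (G s2) = 0 by rewrite /orient /crossp !pairE; ring.
have c2 : orient (G s2) (G s1) (G s2) = 0 by rewrite /orient /crossp !pairE; ring.
have KE x y : orient x (G s1) (G s2) = 0 -> orient y (G s1) (G s2) = 0 ->
    (h s2 - h s1) * orient (G w) x y = K * (dotp y u - dotp x u).
  move=> hx hy; apply/eqP; rewrite -subr_eq0; apply/eqP.
  transitivity (orient x (G s1) (G s2) * (dotp (G w) u - dotp y u) -
     orient y (G s1) (G s2) * (dotp (G w) u - dotp x u)); last by rewrite hx hy; ring.
  by rewrite /K /h /orient /crossp /dotp !pairE; ring.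
have P x y : orient x (G s1) (G s2) = 0 -> orient y (G s1) (G s2) = 0 ->
    0 <= orient (G w) x y -> 0 <= K * (dotp y u - dotp x u).
  by move=> hx hy o; rewrite -KE// mulr_ge0// subr_ge0 ltW.
have Kpos x y : 0 <= K * (y - x) -> x < y -> 0 < K.
  move=> h0 xy; rewrite lt_neqAle eq_sym K0 /=.
  by move: h0; rewrite pmulr_lge0// subr_gt0.
have Kneg x y : 0 <= K * (y - x) -> y < x -> K < 0.
  move=> h0 xy; rewrite lt_neqAle K0 /=.
  by move: h0; rewrite nmulr_lge0// subr_lt0.
have G1l : G (s1 + l) = G s1 := loop_period LG s1.
have O12 : s4 <= w -> 0 <= orient (G w) (G s1) (G s2).
  by move=> ?; rewrite orient_cycle; rewrite orient_cycle -(loop_period LG s1) -(loop_period LG s2) -orient_cycle -orient_cycle; apply: (loop_orient LG); lra.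
have O23 : w <= s2 \/ s4 <= w -> 0 <= orient (G w) (G s2) (G s3).
  case=> ?; first by apply: (loop_orient LG); lra.
  by rewrite orient_cycle; apply: (loop_orient LG); lra.
have O34 : w <= s3 -> 0 <= orient (G w) (G s3) (G s4).
  by move=> ?; apply: (loop_orient LG); lra.
have O41 : w <= s4 -> 0 <= orient (G w) (G s4) (G s1).
  by move=> ?; rewrite -G1l; apply: (loop_orient LG); lra.
have O12' : s2 <= w -> 0 <= orient (G w) (G s1) (G s2).
  by move=> ?; rewrite orient_cycle; apply: (loop_orient LG); lra.
have [x1|x1] := leP w s2.
  have k1 := Kneg _ _ (P _ _ c2 c3 (O23 (or_introl x1))) h32.
  have k2 := Kpos _ _ (P _ _ c3 c4 (O34 ltac:(lra))) h34; lra.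
have [x2|x2] := leP w s3.
  have k2 := Kpos _ _ (P _ _ c3 c4 (O34 ltac:(lra))) h34.
  have k1 := Kneg _ _ (P _ _ c4 c1 (O41 ltac:(lra))) h14; lra.
have k1 := Kpos _ _ (P _ _ c1 c2 (O12' ltac:(lra))) h12.
have [x3|x3] := leP w s4.
  have k2 := Kneg _ _ (P _ _ c4 c1 (O41 ltac:(lra))) h14; lra.
have k2 := Kneg _ _ (P _ _ c2 c3 (O23 (or_intror (ltW x3)))) h32; lra.
Qed.

Section grid.
Variable N : nat.
Hypothesis N_gt1 : (1 < N)%N.
Let delta := l / N%:R.

Definition grid (i : nat) : R * R := G (i%:R * (l / N%:R)).

Lemma natN_gt0 : 0 < N%:R :> R. Proof. by rewrite ltr0n ltnW. Qed.

Lemma grid_step_gt0 : 0 < delta.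
Proof. by rewrite divr_gt0 ?natN_gt0// (loop_gt0 LG). Qed.

Lemma grid_stepN : N%:R * delta = l.
Proof. by rewrite /delta mulrC divfK// gt_eqF// natN_gt0. Qed.

Lemma grid_period j : grid (j + N) = grid j.
Proof. by rewrite /grid natrD mulrDl -/delta grid_stepN (loop_period LG). Qed.

Lemma grid_le (i j : nat) : (i <= j)%N -> i%:R * delta <= j%:R * delta.
Proof. by move=> ij; rewrite ler_pM2r ?grid_step_gt0// ler_nat. Qed.

Lemma grid_lt (i j : nat) : (i < j)%N -> i%:R * delta < j%:R * delta.
Proof. by move=> ij; rewrite ltr_pM2r ?grid_step_gt0// ltr_nat. Qed.

Lemma grid_wrap (i : nat) : i%:R * delta + l = (i + N)%:R * delta.
Proof. by rewrite natrD mulrDl grid_stepN. Qed.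

Lemma grid_orient (i j k : nat) : (i <= j)%N -> (j <= k)%N -> (k <= i + N)%N ->
  0 <= orient (grid i) (grid j) (grid k).
Proof.
move=> ij jk ki; apply: (loop_orient LG); rewrite -/delta ?grid_wrap; exact: grid_le.
Qed.

Lemma grid_edge_gt0 j : 0 < enorm (edge grid j).
Proof.
apply: enorm_gt0 => h.
apply: (@loop_inj _ _ _ LG (j%:R * delta) (j.+1%:R * delta)).
- exact: grid_lt.
- by rewrite grid_wrap; apply: grid_lt; lia.
- by apply/eqP; rewrite eq_sym -subr_eq0; apply/eqP.
Qed.

Lemma grid_edge_le j : enorm (edge grid j) <= delta.
Proof.
apply: le_trans (loop_lip LG _ _) _.
by rewrite -/delta -mulrBl -(natr1 j) [_ + 1]addrC addrK mul1r gtr0_norm// grid_step_gt0.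
Qed.

Lemma grid_turn j : 0 <= crossp (edge grid j) (edge grid j.+1).
Proof.
have := @grid_orient j j.+1 j.+2 (leqnSn _) (leqnSn _) ltac:(lia).
by rewrite /orient /edge /crossp !pairE => h; apply: le_trans h _; rewrite le_eqVlt; apply/orP; left; apply/eqP; ring.
Qed.

(** Consecutive edges turn left; as long as they stay in a half-plane, the
    relation is transitive and the middle edge lies in the cone of the outer
    ones. *)
Lemma grid_cone (i n r : nat) u : (r <= n)%N ->
  (forall j, (j <= n)%N -> 0 < dotp (edge grid (i + j)) u) ->
  exists al be : R, [/\ 0 <= al, 0 <= be,
    (edge grid (i + r)).1 = al * (edge grid i).1 + be * (edge grid (i + n)).1 &
    (edge grid (i + r)).2 = al * (edge grid i).2 + be * (edge grid (i + n)).2].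
Proof.
move=> rn pos.
have turn j k : (j <= k)%N -> (k <= n)%N ->
    0 <= crossp (edge grid (i + j)) (edge grid (i + k)).
  move=> jk; have := subnK jk; move: (k - j)%N => m <-.
  elim: m => [|m ih] kn; first by rewrite add0n /crossp mulrC subrr.
  rewrite addSn in kn *; have := ih (ltnW kn) => h.
  apply: crossp_trans h _; last by rewrite addnS; exact: grid_turn.
  - by apply: pos; lia.
  - by apply: pos; lia.
  - by apply: pos; lia.
have := turn 0%N r (leq0n r) rn; rewrite addn0 => h0.
have hr := turn r n rn (leqnn n).
have := pos 0%N (leq0n n); rewrite addn0 => p0.
exact: mid_in_cone p0 (pos r rn) (pos n (leqnn n)) h0 hr.
Qed.

(** Two rising and two falling edges in alternation would contradict
    [loop_no_alternation]. *)
Lemma grid_unimodal u : (forall j, rise grid u j != 0) ->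
  exists k a b, updown N (fun j => rise grid u (k + j)%N) a b.
Proof.
move=> gen; pose h j := dotp (grid j) u.
have hS j : h j.+1 - h j = rise grid u j by rewrite /h /rise /edge dotpBl.
have hN j : h (j + N)%N = h j by rewrite /h grid_period.
have N0 : (0 < N)%N by exact: ltnW.
have hmod j : h (j %% N)%N = h j.
  rewrite {2}(divn_eq j N) addnC; elim: (j %/ N)%N => [|n ih]; first by rewrite addn0.
  by rewrite mulSn addnCA addnC hN.
pose i0 := Ordinal N0.
case: (@arg_minP _ _ _ i0 xpredT (fun i : 'I_N => h i) isT) => k _ kmin.
case: (@arg_maxP _ _ _ i0 xpredT (fun i : 'I_N => h (k + i)%N) isT) => a _ amax.
have hmin j : h k <= h j by rewrite -(hmod j); exact: (kmin (Ordinal (ltn_pmod j N0))).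
have hmax j : h (k + j)%N <= h (k + a)%N.
  have := amax (Ordinal (ltn_pmod j N0)) isT; rewrite /= -(hmod (k + j %% N)%N) modnDmr hmod.
  by [].
have aN := ltn_ord a.
have alt (x y z w : nat) : (x < y)%N -> (y < z)%N -> (z < w)%N -> (w < x + N)%N ->
    h x < h y -> h z < h y -> h x < h w -> h z < h w -> False.
  move=> xy yz zw wx.
  apply: (@loop_no_alternation (x%:R * delta) (y%:R * delta) (z%:R * delta) (w%:R * delta) u);
    rewrite ?grid_wrap; exact: grid_lt.
have gt_or j : 0 < rise grid u j \/ rise grid u j < 0.
  by have := gen j; case: ltrgt0P => // ? _; [left|right].
have up1 : h k < h k.+1.
  by rewrite lt_neqAle hmin andbT eq_sym -subr_eq0 hS.
have a0 : (0 < a)%N.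
  rewrite lt0n; apply/negP => /eqP a0; have := hmax 1%N; rewrite a0 addn0 addn1; lra.
exists k, a, (N - a)%N; split => //.
- by rewrite subn_gt0.
- by rewrite subnKC// ltnW.
- move=> j ja; case: (gt_or (k + j)%N) => // dneg; exfalso.
  have d1 : h (k + j).+1 < h (k + j)%N by rewrite -subr_lt0 hS.
  have m1 := hmin (k + j).+1; have M1 := hmax j.
  have j0 : (0 < j)%N.
    by rewrite lt0n; apply/negP => /eqP j0; move: d1; rewrite j0 addn0; lra.
  have ja1 : (j.+1 < a)%N.
    rewrite ltn_neqAle ja andbT; apply/negP => /eqP ja1.
    by move: d1; rewrite -addnS ja1; lra.
  apply: (@alt k (k + j)%N (k + j).+1 (k + a)%N); try lia; lra.
- move=> j /andP[aj jN]; case: (gt_or (k + j)%N) => // dpos; exfalso.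
  have d1 : h (k + j)%N < h (k + j).+1 by rewrite -subr_gt0 hS.
  have m1 := hmin (k + j)%N; have M1 := hmax j.+1; rewrite addnS in M1.
  have aj1 : (a < j)%N.
    rewrite ltn_neqAle aj andbT; apply/negP => /eqP aj1.
    by move: d1; rewrite -aj1 -addnS; have := hmax a.+1; lra.
  have jN1 : (j.+1 < N)%N.
    rewrite ltn_neqAle jN andbT; apply/negP => /eqP jN1.
    by move: d1; rewrite -addnS jN1 hN; lra.
  apply: (@alt k (k + a)%N (k + j)%N (k + j).+1); try lia; lra.
Qed.

End grid.

End loops.

(** * Slopes of edges in a half-plane *)

Section slopes.
Variables (R : realType) (u : R * R).
Hypothesis u1 : enorm u = 1.
Implicit Types (v w e : R * R).

(** Projecting the directions of an open half-plane to a line turns the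
    cross product of edges into a difference of slopes, so that lower bounds for
    the turning of a window can be obtained by adding up differences. *)
Definition slope v : R := crossp u v / dotp v u.

Lemma unit_sq : u.1 ^+ 2 + u.2 ^+ 2 = 1.
Proof. by have := enorm_sq u; rewrite u1 expr1n /dotp -!expr2. Qed.

Lemma crossp_slope v w : 0 < dotp v u -> 0 < dotp w u ->
  crossp v w = dotp v u * dotp w u * (slope w - slope v).
Proof.
move=> v0 w0; transitivity ((u.1 ^+ 2 + u.2 ^+ 2) * crossp v w).
  by rewrite unit_sq mul1r.
transitivity (dotp v u * crossp u w - crossp u v * dotp w u).
  by rewrite /crossp /dotp; ring.
by rewrite /slope; field; rewrite !gt_eqF.
Qed.

Lemma slope_le v w : 0 < dotp v u -> 0 < dotp w u ->
  (slope v <= slope w) = (0 <= crossp v w).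
Proof.
by move=> v0 w0; rewrite crossp_slope// pmulr_rge0 ?mulr_gt0// subr_ge0.
Qed.

Lemma slope_lt v w : 0 < dotp v u -> 0 < dotp w u ->
  (slope v < slope w) = (0 < crossp v w).
Proof.
by move=> v0 w0; rewrite crossp_slope// pmulr_rgt0 ?mulr_gt0// subr_gt0.
Qed.

Lemma dotp_ge_slope e M : enorm e = 1 -> 0 < dotp e u -> `|slope e| <= M ->
  (1 + M)^-1 <= dotp e u.
Proof.
move=> e1 eu sM; have M0 : 0 <= M := le_trans (normr_ge0 _) sM.
have xy : dotp e u ^+ 2 + crossp u e ^+ 2 = 1.
  transitivity ((u.1 ^+ 2 + u.2 ^+ 2) * dotp e e); first by rewrite /dotp /crossp; ring.
  by rewrite unit_sq mul1r -enorm_sq e1 expr1n.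
have yE : crossp u e = slope e * dotp e u by rewrite /slope divfK// gt_eqF.
have s2 : slope e ^+ 2 <= M ^+ 2 by rewrite -(real_normK (num_real (slope e))) lerXn2r ?nnegrE.
rewrite -[(1 + M)^-1]mul1r ler_pdivrMr; last by lra.
rewrite -(@ler_pXn2r _ 2)// ?nnegrE ?mulr_ge0 ?(ltW eu)//; last by lra.
rewrite expr1n exprMn -{1}xy yE exprMn.
have x2 : 0 <= dotp e u ^+ 2 by exact: sqr_ge0.
have := ler_wpM2r x2 s2; nra.
Qed.

(** The defect of [al + be] from one is the distance of the middle unit vector
    from the chord of the outer two, up to a factor; it is bounded below in terms
    of the two differences of slopes. *)
Lemma spread_gain e1 e2 e3 M s12 s23 al be :
  enorm e1 = 1 -> enorm e2 = 1 -> enorm e3 = 1 ->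
  0 < dotp e1 u -> 0 < dotp e2 u -> 0 < dotp e3 u ->
  `|slope e1| <= M -> `|slope e2| <= M -> `|slope e3| <= M ->
  0 <= s12 -> s12 <= slope e2 - slope e1 ->
  0 <= s23 -> s23 <= slope e3 - slope e2 ->
  0 <= al -> 0 <= be ->
  e2.1 = al * e1.1 + be * e3.1 -> e2.2 = al * e1.2 + be * e3.2 ->
  1 + Num.min 1 (s12 * s23 / (1 + M) ^+ 4) / 3 <= al + be.
Proof.
move=> n1 n2 n3 p1 p2 p3 b1 b2 b3 s120 h12 s230 h23 al0 be0 e21 e22.
have M0 : 0 <= M := le_trans (normr_ge0 _) b1.
have x1 := dotp_ge_slope n1 p1 b1; have x2 := dotp_ge_slope n2 p2 b2.
have x3 := dotp_ge_slope n3 p3 b3.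
set k := (1 + M)^-1 in x1 x2 x3.
have k0 : 0 <= k by rewrite invr_ge0; lra.
have c12 : k * k * s12 <= crossp e1 e2.
  by rewrite crossp_slope// ler_pM ?mulr_ge0// ler_pM.
have c23 : k * k * s23 <= crossp e2 e3.
  by rewrite crossp_slope// ler_pM ?mulr_ge0// ler_pM.
set X := s12 * s23 / _.
have XE : X = (k * k * s12) * (k * k * s23).
  by rewrite /X /k; field; rewrite gt_eqF//; lra.
have X0 : 0 <= X by rewrite XE !mulr_ge0.
have chi : X <= crossp e1 e2 * crossp e2 e3 by rewrite XE ler_pM ?mulr_ge0.
have E1 : dotp e1 e1 = 1 by rewrite -enorm_sq n1 expr1n.
have E2 : dotp e2 e2 = 1 by rewrite -enorm_sq n2 expr1n.
have E3 : dotp e3 e3 = 1 by rewrite -enorm_sq n3 expr1n.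
set c := dotp e1 e3.
have sq : (al + be) ^+ 2 = 1 + 2 * (al * be) * (1 - c).
  rewrite -[X in _ = X + _]E2.
  transitivity (dotp e2 e2 + 2 * (al * be) * (1 - c) +
     (al ^+ 2 * (1 - dotp e1 e1) + be ^+ 2 * (1 - dotp e3 e3))).
    by rewrite /c /dotp e21 e22; ring.
  by rewrite E1 E3 subrr !mulr0 !addr0.
have cr : crossp e1 e2 * crossp e2 e3 = al * be * (1 - c) * (1 + c).
  transitivity (al * be * (dotp e1 e1 * dotp e3 e3 - c ^+ 2)).
    by rewrite /c /dotp /crossp e21 e22; ring.
  by rewrite E1 E3; ring.
have /andP[cm cM] : - 1 <= c <= 1.
  by rewrite -ler_norml; have := normr_dotp_le e1 e3; rewrite n1 n3 mulr1.
have ab0 : 0 <= al * be * (1 - c) by rewrite !mulr_ge0// subr_ge0.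
have big : 1 + X <= (al + be) ^+ 2 by rewrite sq; rewrite cr in chi; nra.
set m := Num.min 1 X.
have m0 : 0 <= m by rewrite le_min ler01 X0.
have m1 : m <= 1 by rewrite ge_min lexx.
have mX : m <= X by rewrite ge_min lexx orbT.
rewrite -(@ler_pXn2r _ 2)// ?nnegrE ?addr_ge0//; last by rewrite divr_ge0.
apply: le_trans big; nra.
Qed.

Lemma wedge_ge e1 e3 M : enorm e1 = 1 -> enorm e3 = 1 ->
  0 < dotp e1 u -> 0 < dotp e3 u -> `|slope e1| <= M -> `|slope e3| <= M ->
  4 / (1 + M) ^+ 2 <= 2 * (1 + dotp e1 e3).
Proof.
move=> n1 n3 p1 p3 b1 b3.
have M0 : 0 <= M := le_trans (normr_ge0 _) b1.
have x1 := dotp_ge_slope n1 p1 b1; have x3 := dotp_ge_slope n3 p3 b3.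
have -> : 4 / (1 + M) ^+ 2 = ((1 + M)^-1 + (1 + M)^-1) ^+ 2.
  by field; rewrite gt_eqF//; lra.
set k := (1 + M)^-1 in x1 x3 *.
have k0 : 0 <= k by rewrite invr_ge0; lra.
have E1 : dotp e1 e1 = 1 by rewrite -enorm_sq n1 expr1n.
have E3 : dotp e3 e3 = 1 by rewrite -enorm_sq n3 expr1n.
have -> : 2 * (1 + dotp e1 e3) = dotp (e1 + e3) (e1 + e3).
  have -> : 2 * (1 + dotp e1 e3) = dotp e1 e1 + dotp e3 e3 + 2 * dotp e1 e3.
    by rewrite E1 E3; ring.
  by rewrite /dotp !pairE; ring.
rewrite -enorm_sq lerXn2r ?nnegrE ?addr_ge0 ?enorm_ge0//.
apply: (@le_trans _ _ (dotp (e1 + e3) u)).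
  by rewrite /dotp !pairE mulrDl mulrDl addrACA lerD.
by apply: (le_trans (dotp_le _ _)); rewrite u1 mulr1.
Qed.

End slopes.

(** * Heights along a convex loop *)

Section loop_heights.
Variables (R : realType) (l : R) (G : R -> R * R).
Hypothesis LG : convex_loop l G.
Implicit Types (u : R * R) (s t : R).

Lemma loop_reduce s0 s : exists2 t, s0 <= t < s0 + l & G t = G s.
Proof.
have l0 := loop_gt0 LG.
have Gn (n : nat) t : G (t + n%:R * l) = G t.
  elim: n => [|n ih]; first by rewrite mul0r addr0.
  by rewrite -(natr1 n) mulrDl mul1r addrA (loop_period LG).
have Gz (k : int) t : G (t + k%:~R * l) = G t.
  case: k => n; first exact: Gn.
  rewrite NegzE mulrNz mulNr -[in RHS](subrK (n.+1%:R * l) t) Gn; congr G.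
pose k := Num.floor ((s - s0) / l).
exists (s + (- k)%:~R * l); last exact: Gz.
have /andP[f1 f2] := floor_itv ((s - s0) / l).
rewrite -/k in f1 f2; rewrite ler_pdivlMr// in f1; rewrite ltr_pdivrMr// in f2.
rewrite intrD mulrDl mul1r in f2.
rewrite mulrNz mulNr; lra.
Qed.

Lemma loop_continuous u : continuous (fun s => dotp (G s) u).
Proof.
move=> s; apply/cvgrPdist_le => e e0; near=> t.
rewrite -dotpBl; apply: le_trans (normr_dotp_le _ _) _.
apply: (@le_trans _ _ (`|s - t| * (enorm u + 1))).
  by rewrite ler_pM ?enorm_ge0// ?(loop_lip LG)// lerDl.
rewrite -ler_pdivlMr; last by rewrite ltr_wpDl ?enorm_ge0.
near: t; apply: cvgr_dist_le => //.
by rewrite divr_gt0// ltr_wpDl ?enorm_ge0.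
Unshelve. all: by end_near. Qed.

Lemma loop_shift x : convex_loop l (fun s => G (s + x)).
Proof.
split.
- exact: loop_gt0 LG.
- by move=> s; rewrite addrAC (loop_period LG).
- move=> s t; apply: (le_trans (loop_lip LG _ _)).
  by rewrite opprD addrACA subrr addr0.
- move=> s t v st tv vs; apply: (loop_orient LG); lra.
- move=> s n c n0; have [t ht tn] := loop_off_line LG (s + x) c n0.
  by exists (t - x); [lra|rewrite subrK].
- move=> s t st ts; apply: (loop_inj LG); lra.
Qed.

(** Start at a lowest point. By [loop_no_alternation] the height increases up to
    a highest point and decreases afterwards; the two heights differ because no
    line contains a full period. *)
Lemma loop_updown u : u <> 0 ->
  exists A B, [/\ 0 <= A, A < B < A + l /\ dotp (G A) u < dotp (G B) u,
    forall s, dotp (G A) u <= dotp (G s) u <= dotp (G B) u,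
    forall s t, A <= s -> s <= t -> t <= B -> dotp (G s) u <= dotp (G t) u &
    forall s t, B <= s -> s <= t -> t <= A + l -> dotp (G t) u <= dotp (G s) u].
Proof.
move=> u0; have l0 := loop_gt0 LG; pose h s := dotp (G s) u.
have ch a b : {within `[a, b], continuous h}.
  exact/continuous_subspaceT/loop_continuous.
have [A A0 hA] := EVT_min (ltW l0) (ch 0 l).
have AAl : A <= A + l by rewrite lerDl ltW.
have [B' B'i hB'] := EVT_max AAl (ch A (A + l)).
have gA s : h A <= h s.
  have [t ht e] := loop_reduce 0 s; rewrite /h -e; apply: hA; rewrite in_itv /=; lra.
have gB s : h s <= h B'.
  have [t ht e] := loop_reduce A s; rewrite {1}/h -e; apply: hB'; rewrite in_itv /=; lra.
have AB' : h A < h B'.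
  rewrite lt_neqAle gA andbT; apply/eqP => e.
  have [t _ ht] := loop_off_line LG 0 (h A) u0.
  by move/eqP: ht; apply; apply/le_anti; rewrite gA andbT e gB.
have [B Bi GB] := loop_reduce A B'.
have hB : h B = h B' by rewrite /h GB.
have AB : A < B.
  rewrite lt_neqAle; case/andP: Bi => -> _; rewrite andbT; apply/eqP => e.
  by move: AB'; rewrite -hB e ltxx.
have hAl : h (A + l) = h A by rewrite /h (loop_period LG).
exists A, B; split.
- by move: A0; rewrite in_itv /= => /andP[].
- by split; [rewrite AB; case/andP: Bi|rewrite -/(h A) -/(h B) hB].
- by move=> s; rewrite -/(h A) -/(h B) -/(h s) gA hB gB.
- move=> s t As st tB; rewrite -/(h s) -/(h t) leNgt; apply/negP => hts.
  have sA : A < s.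
    by rewrite lt_neqAle As andbT; apply/eqP => e; move: hts; rewrite -e; have := gA t; lra.
  have tB' : t < B.
    by rewrite lt_neqAle tB andbT; apply/eqP => e; move: hts; rewrite e hB; have := gB s; lra.
  have st' : s < t.
    by rewrite lt_neqAle st andbT; apply/eqP => e; move: hts; rewrite e ltxx.
  case/andP: Bi => _ BA.
  have := gA t; have := gB s; rewrite -hB => ? ?.
  apply: (@loop_no_alternation _ _ _ LG A s t B u) => //; rewrite -/(h _) -/(h _); lra.
- move=> s t Bs st tA; rewrite -/(h s) -/(h t) leNgt; apply/negP => hts.
  have sB : B < s.
    by rewrite lt_neqAle Bs andbT; apply/eqP => e; move: hts; rewrite -e hB; have := gB t; lra.
  have tA' : t < A + l.
    by rewrite lt_neqAle tA andbT; apply/eqP => e; move: hts; rewrite e hAl; have := gA s; lra.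
  have st' : s < t.
    by rewrite lt_neqAle st andbT; apply/eqP => e; move: hts; rewrite e ltxx.
  have := gA s; have := gB t; rewrite -hB => ? ?.
  apply: (@loop_no_alternation _ _ _ LG A B s t u) => //; rewrite -/(h _) -/(h _); lra.
Qed.

End loop_heights.

(** Without three collinear points, the chords of a rising arc turn left, and
    consecutive ones strictly. *)
Section strictly_convex.
Variables (R : realType) (l : R) (G : R -> R * R).
Hypothesis LG : convex_loop l G.
Hypothesis strict : forall s t v, s < t -> t < v -> v < s + l ->
  0 < orient (G s) (G t) (G v).

Lemma strict_monotone u A B : u <> 0 -> A < B < A + l ->
  (forall s t, A <= s -> s <= t -> t <= B -> dotp (G s) u <= dotp (G t) u) ->
  forall s t, A <= s -> s < t -> t <= B -> 0 < dotp (G t - G s) u.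
Proof.
move=> u0 AB mono s t As st tB; rewrite dotpBl subr_gt0.
rewrite lt_neqAle mono ?(ltW st)// andbT; apply/eqP => e.
have m1 := mono s ((s + t) / 2) As ltac:(lra) ltac:(lra).
have m2 := mono ((s + t) / 2) t ltac:(lra) ltac:(lra) tB.
have e2 : dotp (G ((s + t) / 2)) u = dotp (G s) u by apply/le_anti; rewrite m1 e m2.
have := @strict s ((s + t) / 2) t ltac:(lra) ltac:(lra) ltac:(lra).
rewrite /orient; set p := _ - _; set q := _ - _ => pq.
have pu : dotp p u = 0 by rewrite /p dotpBl e2 subrr.
have qu : dotp q u = 0 by rewrite /q dotpBl -e subrr.
have z1 : u.1 * crossp p q = 0.
  transitivity (q.2 * dotp p u - p.2 * dotp q u); last by rewrite pu qu !mulr0 subrr.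
  by rewrite /crossp /dotp; ring.
have z2 : u.2 * crossp p q = 0.
  transitivity (p.1 * dotp q u - q.1 * dotp p u); last by rewrite pu qu !mulr0 subrr.
  by rewrite /crossp /dotp; ring.
apply: u0; rewrite [u]surjective_pairing.
have /eqP := z1; rewrite mulf_eq0 (gt_eqF pq) orbF => /eqP ->.
by have /eqP := z2; rewrite mulf_eq0 (gt_eqF pq) orbF => /eqP ->.
Qed.

Lemma chord_turn u A B : A < B < A + l ->
  (forall s t, A <= s -> s < t -> t <= B -> 0 < dotp (G t - G s) u) ->
  forall s t s' t', A <= s -> s < t -> t <= s' -> s' < t' -> t' <= B ->
  0 <= crossp (G t - G s) (G t' - G s').
Proof.
move=> AB pos s t s' t' As st ts' st' tB.
have adj x y z : A <= x -> x < y -> y < z -> z <= B ->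
    0 <= crossp (G y - G x) (G z - G y).
  move=> *; have : 0 <= orient (G x) (G y) (G z) by apply: (loop_orient LG); lra.
  congr (_ <= _); rewrite /orient /crossp !pairE; ring.
move: ts'; rewrite le_eqVlt => /predU1P[e|ts'].
  by rewrite -e; apply: adj => //; rewrite e.
apply: (@crossp_trans _ _ (G s' - G t) _ u).
- by apply: pos; lra.
- by apply: pos; lra.
- by apply: pos; lra.
- by apply: adj; lra.
- by apply: adj; lra.
Qed.

Lemma chord_turn_strict s t v : s < t -> t < v -> v < s + l ->
  0 < crossp (G t - G s) (G v - G t).
Proof.
move=> st tv vs; have := strict st tv vs.
by congr (_ < _); rewrite /orient /crossp !pairE; ring.
Qed.

End strictly_convex.

(** * The gain of a strictly convex loop *)

Lemma nat_above (R : realType) (x : R) : exists n : nat, x < n%:R.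
Proof. by exists (Num.truncn x).+1; exact: truncnS_gt. Qed.

Lemma nat_floor (R : realType) (x : R) : 0 <= x ->
  exists n : nat, n%:R <= x < n.+1%:R.
Proof. by move=> x0; exists (Num.truncn x); exact: truncn_itv. Qed.

Section grid_bound.
Variables (R : realType) (l : R) (G : R -> R * R).
Hypothesis LG : convex_loop l G.
Variables (N : nat).
Hypothesis N_gt1 : (1 < N)%N.

(** The inequality does not depend on where the enumeration of a closed polygon
    starts, and the arcs that yield a gain are easier to locate near the start. *)
Definition rgrid (k : nat) : nat -> R * R :=
  grid l (fun s => G (s + k%:R * (l / N%:R))) N.

Lemma rgridE k i : rgrid k i = grid l G N (k + i).
Proof. by rewrite /rgrid /grid natrD mulrDl addrC. Qed.

Lemma rgrid_edge k i : edge (rgrid k) i = edge (grid l G N) (k + i).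
Proof. by rewrite /edge !rgridE addnS. Qed.

Definition valid_gain (V : nat -> R * R) (gain : nat -> nat -> nat -> R) :=
  (forall i r q, 0 <= gain i r q <= 1) /\
  (forall i r q u, coherent (rise V u) i (r + q) ->
    forall al be : R, 0 <= al -> 0 <= be ->
    (unit_edge V (i + r)).1 = al * (unit_edge V i).1 + be * (unit_edge V (i + (r + q))).1 ->
    (unit_edge V (i + r)).2 = al * (unit_edge V i).2 + be * (unit_edge V (i + (r + q))).2 ->
    1 + gain i r q <= al + be).

Definition valid_gap (V : nat -> R * R) (gp : R * R -> R) :=
  dmeas gp /\ forall u k a b c C, enorm u = 1 ->
  updown N (fun j => rise V u (k + j)%N) a b ->
  (forall i, c <= dotp (V i) u <= C) -> gp u <= energy_gap V u k a b c C.

Lemma valid_gap0 V : valid_gap V (fun=> 0).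
Proof.
split; first exact: bmeas_cst.
move=> u k a b c C _ [a0 b0 _ _ _] _; apply: mulr_ge0; first by rewrite divr_ge0.
by apply: Int_ge0 => t; exact: sqr_ge0.
Qed.

Lemma unit_edge_sum_ge1 (e e1 e2 : R * R) (al be : R) :
  enorm e = 1 -> enorm e1 = 1 -> enorm e2 = 1 -> 0 <= al -> 0 <= be ->
  e.1 = al * e1.1 + be * e2.1 -> e.2 = al * e1.2 + be * e2.2 -> 1 <= al + be.
Proof.
move=> n n1 n2 al0 be0 h1 h2.
have : dotp e e = 1 by rewrite -enorm_sq n expr1n.
have -> : dotp e e = al * dotp e1 e + be * dotp e2 e.
  transitivity ((al * e1.1 + be * e2.1) * e.1 + (al * e1.2 + be * e2.2) * e.2).
    by rewrite -h1 -h2.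
  by rewrite /dotp; ring.
move=> <-.
have := dotp_le e1 e; have := dotp_le e2 e; rewrite n n1 n2 mulr1 => d2 d1.
by apply: lerD; rewrite -[leRHS]mulr1 ler_wpM2l.
Qed.

Lemma valid_gain0 k : valid_gain (rgrid k) (fun _ _ _ => 0).
Proof.
split=> [i r q|i r q u _ al be al0 be0 h1 h2]; first by rewrite lexx ler01.
have LG' := loop_shift LG (k%:R * (l / N%:R)).
have un j : enorm (unit_edge (rgrid k) j) = 1.
  exact: (enorm_unit_edge (grid_edge_gt0 LG' N_gt1)).
rewrite addr0; exact: (unit_edge_sum_ge1 (un _) (un _) (un _) al0 be0 h1 h2).
Qed.

(** [polygon_mean_distance] for the polygon inscribed at equally spaced
    parameters. *)
Lemma grid_mean_distance k gain gp :
  valid_gain (rgrid k) gain -> valid_gap (rgrid k) gp ->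
  N%:R ^+ 2 / 6 * perim N (grid l G N) -
    2 * N%:R ^+ 2 * (l - perim N (grid l G N)) +
  l / 2 * wsum N (fun i r q => gain i r q * window_mass (rgrid k) i (r + q)) +
  Lam gp / 4 <=
  \sum_(0 <= i < N) \sum_(0 <= j < N) enorm (grid l G N i - grid l G N j).
Proof.
move=> [g01 gle] [mgp gple].
have LG' := loop_shift LG (k%:R * (l / N%:R)).
have := @polygon_mean_distance R N (rgrid k) (l / N%:R) (ltnW N_gt1)
  (grid_period LG' N_gt1) (grid_edge_gt0 LG' N_gt1) (grid_edge_le LG' N_gt1)
  (grid_cone LG' N_gt1) (grid_unimodal LG' N_gt1) gain g01 gle gp mgp gple.
rewrite (grid_stepN _ N_gt1).
have -> : N%:R / 2 * (l / N%:R) = l / 2 by field; rewrite gt_eqF// natN_gt0.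
have per j : grid l G N (j + N) = grid l G N j by exact: grid_period.
have -> : perim N (rgrid k) = perim N (grid l G N).
  rewrite /perim -(@sum_period_shift R N (fun j => enorm (edge (grid l G N) j)) k).
    by apply: eq_bigr => j _; rewrite rgrid_edge.
  by move=> j; rewrite /edge -addSn !per.
suff -> : \sum_(0 <= i < N) \sum_(0 <= j < N) enorm (rgrid k i - rgrid k j) =
  \sum_(0 <= i < N) \sum_(0 <= j < N) enorm (grid l G N i - grid l G N j) by [].
rewrite -[RHS](@sum_period_shift R N _ k) => [|j]; last first.
  by apply: eq_bigr => ? _; rewrite per.
apply: eq_bigr => i _.
rewrite -[RHS](@sum_period_shift R N _ k) => [|j]; last by rewrite per.
by apply: eq_bigr => j _; rewrite !rgridE.
Qed.

End grid_bound.

Lemma gt1_of_ge (m n : nat) : (m.+2 <= n)%N -> (1 < n)%N.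
Proof. lia. Qed.

Lemma natr_le_of_ge2 (R : realType) (m n : nat) : (m.+2 <= n)%N -> m%:R <= n%:R :> R.
Proof. rewrite ler_nat; lia. Qed.

Section strict_gain.
Variable R : realType.

Lemma slope_unit_edge (u : R * R) V j : 0 < enorm (edge V j) -> 
  slope u (unit_edge V j) = slope u (edge V j).
Proof.
move=> h; rewrite /slope.
have -> : crossp u (unit_edge V j) = crossp u (edge V j) / enorm (edge V j).
  by rewrite /crossp /unit_edge /=; field; rewrite gt_eqF.
have -> : dotp (unit_edge V j) u = dotp (edge V j) u / enorm (edge V j).
  by rewrite /dotp /unit_edge /=; field; rewrite gt_eqF.
by rewrite invf_div mulrA divfK ?gt_eqF.
Qed.

(** The weight of a window of order [n] edges is of order 1 / n, so that [n ^ 3]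
    such windows have a weight of order [n ^ 2], the order of the main term. *)
Lemma winw_block (n r q : nat) : (0 < n)%N ->
  (10 * n <= r < 11 * n)%N -> (10 * n <= q < 11 * n)%N ->
  (60 * n%:R)^-1 <= winw R r q.
Proof.
move=> n0 /andP[r1 r2] /andP[q1 q2].
have r0 : (0 < r)%N by lia.
have q0 : (0 < q)%N by lia.
rewrite -(prednK r0) -(prednK q0) winwSS.
set x : R := r.-1%:R; set y : R := q.-1%:R.
have xE : x + 1 = r%:R by rewrite /x natr1 prednK.
have yE : y + 1 = q%:R by rewrite /y natr1 prednK.
have A : 10 * n%:R <= x + 1 by rewrite xE -natrM ler_nat.
have B : x + 1 <= 11 * n%:R by rewrite xE -natrM ler_nat ltnW.
have C : 10 * n%:R <= y + 1 by rewrite yE -natrM ler_nat.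
have D : y + 1 <= 11 * n%:R by rewrite yE -natrM ler_nat ltnW.
have n1 : 1 <= n%:R :> R by rewrite ler1n.
set m : R := n%:R in A B C D n1 *.
have m0 : 0 < 60 * m by lra.
rewrite -[_^-1]mul1r ler_pdivrMr// mulrAC ler_pdivlMr; last first.
  by rewrite !mulr_gt0//; lra.
have P : (x + y + 1) * (x + y + 2) * (x + y + 3) <= (22 * m) * (22 * m) * (23 * m).
  by apply: ler_pM; rewrite ?mulr_ge0//; try lra; apply: ler_pM; lra.
have Q : 10 * m * (10 * m) <= (x + 1) * (y + 1) by apply: ler_pM; lra.
have mm : 1 <= m * m by nra.
have : (400 * (m * m) - 1) * (60 * m) <= (4 * (x + 1) * (y + 1) - 1) * (60 * m).
  by rewrite ler_pM2r//; lra.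
have : m <= m * m * m by nra.
lra.
Qed.

Lemma sum_ind_block (N m n : nat) : (m + n <= N)%N ->
  \sum_(0 <= i < N) ind R (m <= i < m + n)%N = n%:R.
Proof.
move=> mnN; transitivity (\sum_(0 <= i < N) (ind R (i < m + n)%N * 1 - ind R (i < m)%N * 1)).
  apply: eq_bigr => i _; rewrite !mulr1 /ind leqNgt andbC.
  by case: (ltnP i m) => h; [rewrite (ltn_addr n h) subrr|rewrite andbT subr0].
rewrite sumrB !(sum_ind_lt (fun=> 1)) ?(leq_trans (leq_addr n m))//.
by rewrite !sumr_const_nat !subn0 natrD addrAC subrr add0r.
Qed.

End strict_gain.

(** On a rising arc fix three separated pieces. The slopes of the edges in
    different pieces differ by amounts that do not depend on the mesh, because
    they are separated by the slopes of fixed chords. Therefore all windows with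
    first, marked and last edge in the three pieces have the gain [g0], and they
    carry a fixed proportion of the total weight. *)
Lemma strict_gain_exists (R : realType) (l : R) (G : R -> R * R) :
  convex_loop l G ->
  (forall s t v, s < t -> t < v -> v < s + l -> 0 < orient (G s) (G t) (G v)) ->
  exists2 c : R, 0 < c & exists N1, forall N, (N1 <= N)%N ->
  exists k gain, valid_gain (rgrid l G N k) gain /\
    c * N%:R ^+ 2 <= l / 2 * wsum N (fun i r q =>
      gain i r q * window_mass (rgrid l G N k) i (r + q)).
Proof.
move=> LG strict; have l0 := loop_gt0 LG.
pose u : R * R := (1, 0).
have u1 : enorm u = 1 by rewrite /enorm /= expr0n addr0 expr1n sqrtr1.
have u0 : u <> 0 by move=> h; have := u1; rewrite h enorm0 => /esym/eqP; rewrite oner_eq0.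
have [A [B [A0 [/andP[AB BA] _] _ mono _]]] := loop_updown LG u0.
have ABl : A < B < A + l by rewrite AB.
have pos := strict_monotone strict u0 ABl mono.
have [D DE] : exists x : R, x = B - A by eexists.
have D0 : 0 < D by rewrite DE subr_gt0.
have Dl : D < l by lra.
have BE : B = A + D by lra.
have turn s t s' t' : A <= s -> s < t -> t <= s' -> s' < t' -> t' <= B ->
    slope u (G t - G s) <= slope u (G t' - G s').
  move=> As st ts st' tB; rewrite slope_le//; try (apply: pos; lra).
  exact: (chord_turn LG ABl pos).
have sturn s t v : A <= s -> s < t -> t < v -> v <= B ->
    slope u (G t - G s) < slope u (G v - G t).
  move=> As st tv vB; rewrite slope_lt//; try (apply: pos; lra).
  have vs : v < s + l by lra.
  exact: (chord_turn_strict strict st tv vs).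
pose p x := A + D * x.
pose sl x y := slope u (G (p y) - G (p x)).
(* sl x y is the slope of a chord, in relative positions along the rising arc;
   chords to the left of the first piece and to the right of the last one bound
   all the slopes that occur *)
have [M ME] : exists x : R, x = `|sl 0 (8 / 100)| + `|sl (7 / 10) (8 / 10)| by eexists.
have M0 : 0 <= M by rewrite ME addr_ge0.
have b1 : - M <= sl 0 (8 / 100).
  by rewrite ME; have := ler_norm (- sl 0 (8 / 100)); rewrite normrN;
     have := normr_ge0 (sl (7 / 10) (8 / 10)); lra.
have b2 : sl (7 / 10) (8 / 10) <= M.
  by rewrite ME; have := ler_norm (sl (7 / 10) (8 / 10));
     have := normr_ge0 (sl 0 (8 / 100)); lra.
(* fixed chords between the pieces, which strict convexity turns properly *)
have [s12 s12E] : exists x : R, x = sl (2 / 10) (3 / 10) - sl (13 / 100) (2 / 10) by eexists.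
have [s23 s23E] : exists x : R, x = sl (46 / 100) (5 / 10) - sl (42 / 100) (46 / 100) by eexists.
have s12_gt0 : 0 < s12 by rewrite s12E subr_gt0; apply: sturn; rewrite /p; lra.
have s23_gt0 : 0 < s23 by rewrite s23E subr_gt0; apply: sturn; rewrite /p; lra.
have M1 : 0 < 1 + M by lra.
have [g0 g0E] : exists x : R, x = Num.min 1 (s12 * s23 / (1 + M) ^+ 4) / 3 by eexists.
have g00 : 0 < g0.
  rewrite g0E; apply: divr_gt0 => //; rewrite lt_min ltr01 /=.
  by apply: divr_gt0; [exact: mulr_gt0|exact: exprn_gt0].
have g01 : g0 <= 1.
  have : Num.min 1 (s12 * s23 / (1 + M) ^+ 4) <= 1 by rewrite ge_min lexx.
  by rewrite g0E; lra.
have [K0 K0E] : exists x : R, x = 4 / (1 + M) ^+ 2 by eexists.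
have K00 : 0 < K0 by rewrite K0E; apply: divr_gt0 => //; exact: exprn_gt0.
have [c0 c0E] : exists x : R, x = D / (80 * l) by eexists.
have c00 : 0 < c0 by rewrite c0E divr_gt0// mulr_gt0.
exists (l / 2 * (c0 ^+ 2 * (g0 * K0 / 60))).
  apply: mulr_gt0; first exact: divr_gt0.
  apply: mulr_gt0; first exact: exprn_gt0.
  by apply: divr_gt0 => //; exact: mulr_gt0.
have [N1 hN1] := nat_above (400 * l / D).
exists N1.+2 => N hN.
have N_gt1 : (1 < N)%N := gt1_of_ge hN.
have N0 : (0 < N)%N := ltnW N_gt1.
have n0 : 0 < N%:R :> R by rewrite ltr0n.
have big : 400 * l / D < N%:R.
  exact: lt_le_trans hN1 (natr_le_of_ge2 R hN).
have [d dE] : exists x : R, x = l / N%:R by eexists.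
have d0 : 0 < d by rewrite dE divr_gt0.
have dD : 400 * d < D.
  by rewrite dE mulrA ltr_pdivrMr// [ltRHS]mulrC -ltr_pdivrMr.
have dN : N%:R * d = l by rewrite dE mulrC divfK// gt_eqF.
have D40 : 0 <= D / (40 * d) by apply: divr_ge0; [exact: ltW|rewrite mulr_ge0 ?ltW].
have [n /andP[n1 n2]] := nat_floor D40.
rewrite ler_pdivlMr ?mulr_gt0// in n1; rewrite ltr_pdivrMr ?mulr_gt0// -(natr1 n) in n2.
have Ad0 : 0 <= A / d by apply: divr_ge0 => //; exact: ltW.
have [k /andP[k1 k2]] := nat_floor Ad0.
rewrite ler_pdivlMr// in k1; rewrite ltr_pdivrMr// -(natr1 k) in k2.
have n_gt0 : (0 < n)%N.
  rewrite lt0n; apply/negP => /eqP n00; rewrite n00 in n2; lra.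
have nN : (40 * n <= N)%N.
  rewrite -(@ler_nat R) natrM -(ler_pM2r d0) dN; lra.
pose V := rgrid l G N k.
pose T (i : nat) : R := (k + i)%:R * d.
have TE i : T i = k%:R * d + i%:R * d by rewrite /T natrD mulrDl.
have VE i : edge V i = G (T i.+1) - G (T i).
  by rewrite /V rgrid_edge /edge /grid /T dE addnS.
have TS i : T i < T i.+1 by rewrite !TE -(natr1 i); lra.
have Tlo (m i : nat) : (m * n <= i)%N -> A - d + m%:R * (n%:R * d) <= T i.
  move=> mi; rewrite TE; have : (m * n)%:R * d <= i%:R * d by rewrite ler_pM2r// ler_nat.
  by rewrite natrM -mulrA; move: k1 k2; clear; lra.
have Thi (m i : nat) : (i < m * n)%N -> T i.+1 <= A + m%:R * (n%:R * d).
  move=> mi; rewrite TE; have : i.+1%:R * d <= (m * n)%:R * d by rewrite ler_pM2r// ler_nat.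
  by rewrite natrM -mulrA; move: k1 k2; clear; lra.
have LG' := loop_shift LG (k%:R * (l / N%:R)).
have eg j : 0 < enorm (edge V j) := grid_edge_gt0 LG' N_gt1 j.
have un j : enorm (unit_edge V j) = 1 := enorm_unit_edge eg j.
(* the rising arc has about 40 n edges; taking i near 4 n, r and q near 10 n puts
   the three edges near 4 n, 14 n and 24 n *)
pose blk m i := (m * n <= i < m.+1 * n)%N.
pose gain i r q := if [&& blk 4 i, blk 10 r & blk 10 q] then g0 else 0.
have su j : slope u (unit_edge V j) = slope u (edge V j) by exact: slope_unit_edge.
have du j : A <= T j -> T j.+1 <= B -> 0 < dotp (unit_edge V j) u.
  move=> h1 h2; rewrite -(pmulr_rgt0 _ (eg j)) -rise_unit// /rise VE.
  exact: pos.
have pA x : 0 <= x -> A <= p x by move=> x0; rewrite /p lerDl mulr_ge0 ?(ltW D0).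
have pB x : x <= 1 -> p x <= B by move=> x1; rewrite /p BE lerD2l -[leRHS]mulr1 ler_pM2l.
have pM x y : x < y -> p x < p y by move=> xy; rewrite /p ltrD2l ltr_pM2l.
have loc i r q : blk 4%N i -> blk 10%N r -> blk 10%N q ->
    [/\ p (8 / 100) <= T i, T i.+1 <= p (13 / 100),
     p (3 / 10) <= T (i + r)%N /\ T (i + r).+1 <= p (42 / 100),
     p (5 / 10) <= T (i + r + q)%N & T (i + r + q).+1 <= p (7 / 10)].
  move=> /andP[i1 i2] /andP[r1 r2] /andP[q1 q2].
  have t1 := Tlo 4%N i i1; have t2 := Thi 5%N i i2.
  have t3 := Tlo 14%N (i + r)%N ltac:(clear -i1 r1; lia).
  have t4 := Thi 16%N (i + r)%N ltac:(clear -i2 r2; lia).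
  have t5 := Tlo 24%N (i + r + q)%N ltac:(clear -i1 r1 q1; lia).
  have t6 := Thi 27%N (i + r + q)%N ltac:(clear -i2 r2 q2; lia).
  rewrite /p; move: (T _) (T _) (T _) (T _) (T _) (T _) n1 n2 dD d0 t1 t2 t3 t4 t5 t6.
  clear => x1 x2 x3 x4 x5 x6 n1 n2 dD d0 t1 t2 t3 t4 t5 t6.
  by split; [| |split| |]; lra.
have sl_below x y i : 0 <= x -> x < y -> y <= 1 -> p y <= T i -> T i.+1 <= B ->
    sl x y <= slope u (unit_edge V i).
  move=> x0 xy y1 h1 h2; rewrite su VE; apply: turn => //; [exact: pA|exact: pM].
have sl_above x y i : x < y -> y <= 1 -> A <= T i -> T i.+1 <= p x ->
    slope u (unit_edge V i) <= sl x y.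
  move=> xy y1 h1 h2; rewrite su VE; apply: turn => //; [exact: pM|exact: pB].
have inB i x : T i.+1 <= p x -> x <= 1 -> T i.+1 <= B by move=> h /pB; exact: le_trans.
have inA i x : p x <= T i -> 0 <= x -> A <= T i by move=> h /pA h'; exact: le_trans h.
have slb i r q : blk 4%N i -> blk 10%N r -> blk 10%N q ->
    [/\ sl 0 (8 / 100) <= slope u (unit_edge V i) <= sl (13 / 100) (2 / 10),
     sl (2 / 10) (3 / 10) <= slope u (unit_edge V (i + r)) <= sl (42 / 100) (46 / 100) &
     sl (46 / 100) (5 / 10) <= slope u (unit_edge V (i + r + q)) <= sl (7 / 10) (8 / 10)].
  move=> hi hr hq; have [t1 t2 [t3 t4] t5 t6] := loc i r q hi hr hq.
  have b1' : T i.+1 <= B by apply: inB t2 _; clear; lra.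
  have b2' : T (i + r).+1 <= B by apply: inB t4 _; clear; lra.
  have b3' : T (i + r + q).+1 <= B by apply: inB t6 _; clear; lra.
  have a1' : A <= T i by apply: inA t1 _; clear; lra.
  have a2' : A <= T (i + r)%N by apply: inA t3 _; clear; lra.
  have a3' : A <= T (i + r + q)%N by apply: inA t5 _; clear; lra.
  by split; apply/andP; split; [apply: sl_below|apply: sl_above|apply: sl_below
   |apply: sl_above|apply: sl_below|apply: sl_above] => //; clear; lra.
have slm : sl (2 / 10) (3 / 10) <= sl (42 / 100) (46 / 100).
  apply: turn; [apply: pA|apply: pM|apply: ltW; apply: pM|apply: pM|apply: pB]; clear; lra.
have inb i r q : blk 4%N i -> blk 10%N r -> blk 10%N q ->
   [/\ 0 < dotp (unit_edge V i) u, 0 < dotp (unit_edge V (i + r)) u,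
     0 < dotp (unit_edge V (i + r + q)) u &
     [/\ `|slope u (unit_edge V i)| <= M, `|slope u (unit_edge V (i + r))| <= M &
     `|slope u (unit_edge V (i + r + q))| <= M]].
  move=> hi hr hq; have [t1 t2 [t3 t4] t5 t6] := loc i r q hi hr hq.
  have [/andP[e1 e2] /andP[e3 e4] /andP[e5 e6]] := slb i r q hi hr hq.
  have s12' := s12_gt0; have s23' := s23_gt0; rewrite s12E in s12'; rewrite s23E in s23'.
  split; [apply: du|apply: du|apply: du|].
  - by apply: inA t1 _; clear; lra.
  - by apply: inB t2 _; clear; lra.
  - by apply: inA t3 _; clear; lra.
  - by apply: inB t4 _; clear; lra.
  - by apply: inA t5 _; clear; lra.
  - by apply: inB t6 _; clear; lra.
  move: slm s12' s23' e1 e2 e3 e4 e5 e6 b1 b2.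
  move: (slope u (unit_edge V i)) (slope u (unit_edge V (i + r)))
    (slope u (unit_edge V (i + r + q))) (sl 0 _) (sl (13 / 100) _) (sl (2 / 10) _)
    (sl (42 / 100) _) (sl (46 / 100) _) (sl (7 / 10) _).
  clear => x1 x2 x3 y1 y2 y3 y4 y5 y6 slm s12' s23' e1 e2 e3 e4 e5 e6 b1 b2.
  by rewrite !ler_norml; split; apply/andP; split; lra.
exists k, gain; split.
  split=> [i r q|i r q v _ al be al0 be0].
    by rewrite /gain; case: ifP; rewrite ?lexx ?ler01 ?g01 ?(ltW g00).
  rewrite addnA => h1 h2; rewrite /gain; case: ifP => [/and3P[hi hr hq]|_]; last first.
    by rewrite addr0; exact: (unit_edge_sum_ge1 (un _) (un _) (un _) al0 be0 h1 h2).
  have [/andP[e1 e2] /andP[e3 e4] /andP[e5 e6]] := slb i r q hi hr hq.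
  have [p1 p2 p3 [m1 m2 m3]] := inb i r q hi hr hq.
  rewrite g0E; apply: (spread_gain u1 (un _) (un _) (un _) p1 p2 p3 m1 m2 m3 _ _ _ _ al0 be0 h1 h2).
  - exact: ltW.
  - by rewrite s12E; move: e2 e3; clear; lra.
  - exact: ltW.
  - by rewrite s23E; move: e4 e5; clear; lra.
have kap i r q : blk 4%N i -> blk 10%N r -> blk 10%N q ->
    K0 <= window_mass V i (r + q).
  move=> hi hr hq; have [t1 t2 [t3 t4] t5 t6] := loc i r q hi hr hq.
  have [p1 p2 p3 [m1 m2 m3]] := inb i r q hi hr hq.
  have coh : coherent (rise V u) i (r + q).
    have a1' : A <= T i by apply: inA t1 _; clear; lra.
    have b1' : T i.+1 <= B by apply: inB t2 _; clear; lra.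
    have b3' : T (i + r + q).+1 <= B by apply: inB t6 _; clear; lra.
    apply/coherentP => j jn; apply: mulr_gt0.
      by rewrite /rise VE; apply: pos.
    rewrite /rise VE; apply: pos; [|exact: TS|].
      by apply: le_trans (_ : T i <= _); [exact: a1'|rewrite /T ler_pM2r// ler_nat leq_add2l leq_addr].
    by apply: le_trans (_ : T (i + r + q).+1 <= _); [rewrite /T ler_pM2r// ler_nat leq_add2l ltnS -addnA leq_add2l|exact: b3'].
  rewrite (window_mass_coherent eg (grid_cone LG' N_gt1) coh) addnA K0E.
  exact: (wedge_ge u1 (un _) (un _) p1 p3 m1 m3).
have sumlb : n%:R ^+ 2 * (g0 * K0 / 60) <= wsum N (fun i r q =>
      gain i r q * window_mass V i (r + q)).
  pose z := (60 * n%:R)^-1 * (g0 * K0).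
  have nR0 : 0 < n%:R :> R by rewrite ltr0n.
  apply: (@le_trans _ _ (\sum_(0 <= i < N) \sum_(0 <= r < N) \sum_(0 <= q < N)
     ind R (blk 4%N i) * (ind R (blk 10%N r) * (ind R (blk 10%N q) * z)))).
    under eq_bigr do under eq_bigr do rewrite -mulr_sumr -mulr_sumr -mulr_suml.
    under eq_bigr do rewrite -mulr_sumr -mulr_suml.
    rewrite -mulr_suml.
    have b10 : \sum_(0 <= i < N) ind R (blk 10%N i) = n%:R.
      rewrite -(@sum_ind_block R N (10 * n)%N n); last by clear -nN; lia.
      by apply: eq_bigr => i _; rewrite /blk [(_ + n)%N]addnC -mulSn.
    have b4 : \sum_(0 <= i < N) ind R (blk 4%N i) = n%:R.
      rewrite -(@sum_ind_block R N (4 * n)%N n); last by clear -nN; lia.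
      by apply: eq_bigr => i _; rewrite /blk [(_ + n)%N]addnC -mulSn.
    rewrite !b10 b4 /z le_eqVlt; apply/orP; left; apply/eqP; field.
    by rewrite gt_eqF.
  apply: ler_sum => i _; apply: ler_sum => r _; apply: ler_sum => q _.
  rewrite /gain; case hi : (blk 4%N i); rewrite /= /ind ?mul0r ?mulr0//.
  case hr : (blk 10%N r); rewrite /= ?mul0r ?mulr0//.
  case hq : (blk 10%N q); rewrite /= ?mul0r ?mulr0//.
  rewrite !mul1r /z; apply: ler_pM; rewrite ?invr_ge0 ?mulr_ge0 ?(ltW g00) ?(ltW K00) ?(ltW nR0)//.
    exact: winw_block.
  by apply: ler_pM; rewrite ?(ltW g00) ?(ltW K00)//; exact: kap.
rewrite -[leLHS]mulrA ler_pM2l ?divr_gt0//; apply: le_trans sumlb.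
rewrite mulrAC ler_pM2r ?divr_gt0 ?mulr_gt0// -exprMn.
rewrite lerXn2r ?nnegrE ?mulr_ge0 ?(ltW c00)//.
rewrite -(ler_pM2r d0) -mulrA dN c0E.
have -> : D / (80 * l) * l = D / 80 by field; rewrite gt_eqF.
by move: n1 n2 dD d0; clear; lra.
Qed.

(** * Counting edges below a level *)

Section level_counts.
Variables (R : realType) (N : nat) (V : nat -> R * R).
Local Notation ind := (ind R).
Hypothesis V_period : forall j, V (j + N)%N = V j.
Implicit Types (u : R * R) (m k a b : nat) (lam c C d : R).

Definition half_below u lam m : R :=
  (ind (dotp (V m) u <= lam) + ind (dotp (V m.+1) u <= lam)) / 2.

(** The sums [below] for the two runs, written without reference to the position
    of the runs, which depends on the direction in an uncontrolled way. *)
Definition up_below u lam : R :=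
  \sum_(0 <= m < N) ind (0 < rise V u m) * half_below u lam m.

Definition down_below u lam : R :=
  \sum_(0 <= m < N) ind (rise V u m < 0) * half_below u lam m.

Lemma half_below_ge0 u lam m : 0 <= half_below u lam m.
Proof. by rewrite /half_below divr_ge0 ?addr_ge0 ?ind_ge0. Qed.

Let risep u m : rise V u (m + N)%N = rise V u m.
Proof. by rewrite /rise /edge -addSn !V_period. Qed.

Lemma sum_updown u k a b (F : nat -> R) : (forall m, F (m + N)%N = F m) ->
  updown N (fun j => rise V u (k + j)%N) a b ->
  \sum_(0 <= m < N) ind (0 < rise V u m) * F m = \sum_(0 <= j < a) F (k + j)%N /\
  \sum_(0 <= m < N) ind (rise V u m < 0) * F m = \sum_(0 <= j < b) F (k + (a + j))%N.
Proof.
move=> FN [a0 b0 abN up dn].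
have S (B : bool -> bool -> bool) :
   \sum_(0 <= m < N) ind (B (0 < rise V u m) (rise V u m < 0)) * F m =
   \sum_(0 <= j < a) ind (B true false) * F (k + j)%N +
   \sum_(0 <= j < b) ind (B false true) * F (k + (a + j))%N.
  rewrite -(@sum_period_shift R N _ k); last by move=> j; rewrite risep FN.
  rewrite (big_cat_nat (n := a))//=; last by rewrite -abN leq_addr.
  congr (_ + _).
    apply: eq_big_nat => j /andP[_ ja]; have h := up j ja.
    by rewrite h ltNge (ltW h).
  rewrite -{1}[a]add0n big_addn (_ : N - a = b)%N; last by rewrite -abN addKn.
  apply: eq_big_nat => j /andP[_ jb]; rewrite [(j + a)%N]addnC.
  have h : rise V u (k + (a + j)) < 0 by apply: dn; rewrite leq_addr -abN ltn_add2l.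
  by rewrite h ltNge (ltW h).
split.
  rewrite (S (fun x _ => x)) /ind [X in _ + X]big1 ?addr0 => [|j _]; last by rewrite mul0r.
  by apply: eq_bigr => j _; rewrite mul1r.
rewrite (S (fun _ y => y)) /ind [X in X + _]big1 ?add0r => [|j _]; last by rewrite mul0r.
by apply: eq_bigr => j _; rewrite mul1r.
Qed.

(** A uniform difference of the proportions of the two runs below all levels of
    an interval bounds the energy gap from below. *)
Lemma gap_ge u k a b c C lam0 lam1 d :
  updown N (fun j => rise V u (k + j)%N) a b ->
  c <= lam0 -> lam0 <= lam1 -> lam1 <= C -> 0 <= d ->
  (forall lam, lam0 <= lam <= lam1 ->
     d * (a%:R * b%:R) <= b%:R * up_below u lam - a%:R * down_below u lam) ->
  2 * (a%:R * b%:R) * d ^+ 2 * (lam1 - lam0) <= energy_gap V u k a b c C.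
Proof.
move=> ud c0 l01 l1C d0 hd; have [a0 b0 _ _ _] := ud.
have A0 : 0 < a%:R :> R by rewrite ltr0n.
have B0 : 0 < b%:R :> R by rewrite ltr0n.
have hF lam m : half_below u lam (m + N)%N = half_below u lam m.
  by rewrite /half_below -addSn !V_period.
pose P t := below R (fun j => dotp (V (k + j)%N) u <= t) a.
pose Q t := below R (fun j => dotp (V (k + (a + j))%N) u <= t) b.
have PE lam : up_below u lam = P lam.
  rewrite /up_below; have [-> _] := sum_updown (hF lam) ud.
  by apply: eq_bigr => j _; rewrite /half_below addnS.
have QE lam : down_below u lam = Q lam.
  rewrite /down_below; have [_ ->] := sum_updown (hF lam) ud.
  by apply: eq_bigr => j _; rewrite /half_below !addnS.
have mP : bmeas P.
  by apply: bmeas_sum => j _; apply: bmeasM; [apply: bmeasD; exact: bmeas_id_ge|exact: bmeas_cst].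
have mQ : bmeas Q.
  by apply: bmeas_sum => j _; apply: bmeasM; [apply: bmeasD; exact: bmeas_id_ge|exact: bmeas_cst].
have m3 : bmeas (fun t => b%:R * P t - a%:R * Q t).
  by apply: bmeasB; apply: bmeasM => //; exact: bmeas_cst.
pose f t := (b%:R * P t - a%:R * Q t) ^+ 2.
have mf : bmeas f.
  by rewrite /f; under eq_fun do rewrite expr2; exact: bmeasM.
have f0 t : 0 <= f t by exact: sqr_ge0.
have I1 : (d * (a%:R * b%:R)) ^+ 2 * (lam1 - lam0) <= Int c C f.
  rewrite (Int_split mf c0 (le_trans l01 l1C)) (Int_split mf l01 l1C).
  have i1 : 0 <= Int c lam0 f by exact: Int_ge0.
  have i3 : 0 <= Int lam1 C f by exact: Int_ge0.
  suff : (d * (a%:R * b%:R)) ^+ 2 * (lam1 - lam0) <= Int lam0 lam1 f by lra.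
  rewrite -Int_cst//; apply: le_Int => //; first exact: bmeas_cst.
  move=> t /hd; rewrite PE QE => h; rewrite /f lerXn2r ?nnegrE//.
    by rewrite !mulr_ge0// ltW.
  by apply: le_trans h; rewrite !mulr_ge0// ltW.
have -> : energy_gap V u k a b c C = 2 / (a%:R * b%:R) * Int c C f by [].
rewrite [leRHS]mulrAC ler_pdivlMr ?mulr_gt0//.
have := ler_wpM2l (ler0n R 2) I1; congr (_ <= _); ring.
Qed.

Lemma count_runs u k a b : updown N (fun j => rise V u (k + j)%N) a b ->
  a%:R = \sum_(0 <= m < N) ind (0 < rise V u m) /\
  b%:R = \sum_(0 <= m < N) ind (rise V u m < 0).
Proof.
move=> ud; have [e1 e2] := @sum_updown u k a b (fun=> 1) (fun=> erefl) ud.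
rewrite sumr_const_nat subn0 in e1; rewrite sumr_const_nat subn0 in e2.
by split; [rewrite -e1|rewrite -e2]; apply: eq_bigr => m _; rewrite mulr1.
Qed.

(** Each edge rises by at most [d], and both runs cover the whole height. *)
Lemma runs_long u k a b d i j : enorm u = 1 -> (forall m, enorm (edge V m) <= d) ->
  updown N (fun j => rise V u (k + j)%N) a b -> (i <= j)%N -> (j <= N)%N ->
  dotp (V j) u - dotp (V i) u <= a%:R * d /\ dotp (V j) u - dotp (V i) u <= b%:R * d.
Proof.
move=> u1 hd ud ij jN; have [ea eb] := count_runs ud.
have rd m : `|rise V u m| <= d.
  by apply: (le_trans (normr_dotp_le _ _)); rewrite u1 mulr1.
have pos m : rise V u m <= ind (0 < rise V u m) * d.
  rewrite /ind; case: ltP => h; last by rewrite mul0r.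
  by rewrite mul1r; apply: le_trans (rd m); exact: ler_norm.
have neg m : - rise V u m <= ind (rise V u m < 0) * d.
  rewrite /ind; case: ltP => h; last by rewrite mul0r oppr_le0.
  by rewrite mul1r; apply: le_trans (rd m); rewrite -normrN; exact: ler_norm.
have d0 : 0 <= d := le_trans (normr_ge0 _) (rd 0%N).
have tel i' j' : (i' <= j')%N -> dotp (V j') u - dotp (V i') u = \sum_(i' <= m < j') rise V u m.
  move=> h; rewrite -(telescope_sumr (fun m => dotp (V m) u))//.
  by apply: eq_bigr => m _; rewrite /rise /edge dotpBl.
split.
  rewrite ea mulr_suml (tel i j ij).
  apply: (@le_trans _ _ (\sum_(i <= m < j) ind (0 < rise V u m) * d)).
    by apply: ler_sum => m _; exact: pos.
  rewrite (big_cat_nat (n := i) _ (leq_trans ij jN))//= (big_cat_nat (n := j) _ jN)//=.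
  by rewrite addrCA lerDl addr_ge0// sumr_ge0// => m _; rewrite mulr_ge0// ind_ge0.
have e0 : dotp (V N) u = dotp (V 0%N) u by rewrite -[N]add0n V_period.
have -> : dotp (V j) u - dotp (V i) u =
   - (dotp (V i) u - dotp (V 0%N) u) - (dotp (V N) u - dotp (V j) u).
  by rewrite e0; ring.
rewrite (tel 0%N i (leq0n i)) (tel j N jN) eb mulr_suml.
apply: (@le_trans _ _ (\sum_(0 <= m < i) ind (rise V u m < 0) * d +
   \sum_(j <= m < N) ind (rise V u m < 0) * d)).
  by rewrite -!sumrN; apply: lerD; apply: ler_sum => m _; exact: neg.
rewrite [leRHS](big_cat_nat (n := i) _ (leq_trans ij jN))//= lerD2l.
rewrite [leRHS](big_cat_nat (n := j) _ jN)//=.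
by rewrite lerDr sumr_ge0// => m _; rewrite mulr_ge0// ind_ge0.
Qed.

End level_counts.

Section counting.
Variable R : realType.
Local Notation ind := (ind R).

Lemma count_le (N : nat) (d z : R) : 0 < d -> 0 <= z ->
  \sum_(0 <= m < N) ind (m%:R * d < z) <= z / d + 1.
Proof.
move=> d0 z0; have [n /andP[n1 n2]] := nat_floor (divr_ge0 z0 (ltW d0)).
apply: (@le_trans _ _ (\sum_(0 <= m < N) ind (m < n.+1)%N)).
  apply: ler_sum => m _; rewrite /ind; case: ltP => h; last by case: (_ < _)%N.
  rewrite -(@ltr_nat R) (_ : _ < _ = true)//.
  by apply: le_lt_trans n2; rewrite ler_pdivlMr// ltW.
apply: (@le_trans _ _ n.+1%:R); last by rewrite -natr1 lerD2r.
have [nN|nN] := leqP n.+1 N.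
  have := @sum_ind_lt R N n.+1 (fun=> 1) nN; rewrite sumr_const_nat subn0 => <-.
  by apply: ler_sum => m _; rewrite mulr1.
apply: (@le_trans _ _ (\sum_(0 <= m < N) (1 : R))).
  by apply: ler_sum => m _; rewrite /ind; case: (_ < _)%N.
by rewrite sumr_const_nat subn0 ler_nat ltnW.
Qed.

Lemma count_ge (N : nat) (d z1 z2 : R) : 0 < d -> 0 <= z1 -> z1 <= z2 -> z2 <= N%:R * d ->
  (z2 - z1) / d - 2 <= \sum_(0 <= m < N) ind ((z1 <= m%:R * d) && (m.+1%:R * d <= z2)).
Proof.
move=> d0 z10 z12 z2N; have z20 := le_trans z10 z12.
have [n1 /andP[a1 a2]] := nat_floor (divr_ge0 z10 (ltW d0)).
have [n2 /andP[b1 b2]] := nat_floor (divr_ge0 z20 (ltW d0)).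
rewrite ler_pdivlMr// in b1; rewrite ltr_pdivrMr// in a2; rewrite mulrBl.
rewrite -(natr1 n2) in b2; rewrite ler_pdivlMr// in a1.
have n2N : (n2 <= N)%N by rewrite -(@ler_nat R) -(ler_pM2r d0) (le_trans b1).
have [n12|n12] := leqP n1.+1 n2; last first.
  apply: (@le_trans _ _ 0); last by apply: sumr_ge0 => m _; exact: ind_ge0.
  have : n2%:R <= n1%:R :> R by rewrite ler_nat -ltnS.
  have : n1%:R <= z1 / d by rewrite ler_pdivlMr.
  lra.
apply: (@le_trans _ _ (\sum_(0 <= m < N) ind (n1.+1 <= m < n1.+1 + (n2 - n1.+1))%N)).
  rewrite sum_ind_block ?subnKC// natrB// -(natr1 n1).
  have : n1%:R <= z1 / d by rewrite ler_pdivlMr.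
  lra.
rewrite subnKC//; apply: ler_sum => m _; rewrite /ind.
case: (boolP (n1 < m < n2)%N) => [/andP[h1 h2]|_]; last by case: ifP.
rewrite (_ : _ && _ = true)//; apply/andP; split.
  by apply: (le_trans (ltW a2)); rewrite ler_pM2r// ler_nat.
by apply: le_trans b1; rewrite ler_pM2r// ler_nat.
Qed.

End counting.

(** * Segments on a convex loop *)

Section flat.
Variables (R : realType) (l : R) (G : R -> R * R).
Hypothesis LG : convex_loop l G.
Implicit Types (tau u v x y z : R * R) (s t w c : R).

Definition normal tau : R * R := (- tau.2, tau.1).

Lemma dotp_normalN tau x : dotp x (normal (- tau)) = - dotp x (normal tau).
Proof. rewrite /dotp /normal /=; ring. Qed.

Lemma dotpNr x y : dotp x (- y) = - dotp x y.
Proof. rewrite /dotp !pairE; ring. Qed.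

Lemma frame tau v u : enorm tau = 1 ->
  dotp v u = dotp v tau * dotp u tau + dotp v (normal tau) * dotp u (normal tau).
Proof.
move=> h; rewrite -[LHS]mul1r -(unit_sq h) /dotp /normal /=; ring.
Qed.

Lemma orient_on_line tau x y z : enorm tau = 1 ->
  dotp x (normal tau) = dotp y (normal tau) ->
  orient x y z = (dotp y tau - dotp x tau) * (dotp z (normal tau) - dotp x (normal tau)).
Proof.
move=> h xy; rewrite -[LHS]mul1r -(unit_sq h).
transitivity ((dotp y tau - dotp x tau) * (dotp z (normal tau) - dotp x (normal tau)) -
  (dotp y (normal tau) - dotp x (normal tau)) * (dotp z tau - dotp x tau)).
  by rewrite /orient /crossp /dotp /normal !pairE /=; ring.
by rewrite xy subrr mul0r subr0.
Qed.

Lemma loop_period_nat (m : nat) s : G (s + m%:R * l) = G s.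
Proof.
elim: m => [|m ih]; first by rewrite mul0r addr0.
by rewrite -(natr1 m) mulrDl mul1r addrA (loop_period LG).
Qed.

(** A segment traversed in the direction [tau], with the loop on its left. *)
Definition flat_on tau c a b :=
  [/\ a < b < a + l, (forall w, c <= dotp (G w) (normal tau)),
      (forall w, a <= w <= b -> dotp (G w) (normal tau) = c) &
      0 < dotp (G b - G a) tau].

(** If a line contains three points of the loop, then the orientation of triples
    puts all other points on one side of it, and squeezes those between the outer
    two parameters onto the line. *)
Lemma flat_sorted tau c t1 t2 t3 : enorm tau = 1 ->
  t1 < t2 -> t2 < t3 -> t3 < t1 + l ->
  dotp (G t1) (normal tau) = c -> dotp (G t2) (normal tau) = c ->
  dotp (G t3) (normal tau) = c ->
  dotp (G t1) tau < dotp (G t2) tau -> dotp (G t2) tau < dotp (G t3) tau ->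
  flat_on tau c t1 t3.
Proof.
move=> h t12 t23 t31 e1 e2 e3 x12 x23.
have x13 := lt_trans x12 x23.
split.
- by rewrite (lt_trans t12 t23).
- move=> w; have [v /andP[v1 v2] <-] := loop_reduce LG t2 w.
  rewrite -subr_ge0; have [vl|vl] := leP v (t1 + l).
    have : 0 <= orient (G t1) (G t2) (G v) by apply: (loop_orient LG) => //; exact: ltW.
    by rewrite (orient_on_line _ h) ?e1// pmulr_rge0// subr_gt0.
  have : 0 <= orient (G t2) (G t3) (G v).
    by apply: (loop_orient LG); [exact: ltW|apply/ltW/(lt_trans t31 vl)|exact: ltW].
  by rewrite (orient_on_line _ h) ?e2// pmulr_rge0// subr_gt0.
- move=> w /andP[w1 w3].
  have lo : 0 <= orient (G t3) (G (t1 + l)) (G (w + l)).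
    by apply: (loop_orient LG); rewrite ?lerD2r// ltW.
  have hi (v : R) : c <= dotp (G v) (normal tau).
    have [v' /andP[v1 v2] <-] := loop_reduce LG t2 v.
    rewrite -subr_ge0; have [vl|vl] := leP v' (t1 + l).
      have : 0 <= orient (G t1) (G t2) (G v') by apply: (loop_orient LG) => //; exact: ltW.
      by rewrite (orient_on_line _ h) ?e1// pmulr_rge0// subr_gt0.
    have : 0 <= orient (G t2) (G t3) (G v').
      by apply: (loop_orient LG); [exact: ltW|apply/ltW/(lt_trans t31 vl)|exact: ltW].
    by rewrite (orient_on_line _ h) ?e2// pmulr_rge0// subr_gt0.
  apply/le_anti; rewrite hi andbT; move: lo.
  rewrite !(loop_period LG) (orient_on_line _ h) ?e3// nmulr_rge0 ?subr_lt0//.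
  by rewrite subr_le0.
- by rewrite dotpBl subr_gt0.
Qed.

Lemma flat_onS tau c a b : flat_on tau c a b -> flat_on tau c (a + l) (b + l).
Proof.
move=> [ab hc hw x]; split => //.
- by rewrite ltrD2r ltrD2r.
- move=> w hw'; rewrite -[w](subrK l) (loop_period LG); apply: hw; lra.
- by rewrite !(loop_period LG).
Qed.

Lemma flat_arc s1 s2 s3 : s1 < s2 -> s2 < s3 -> s3 < s1 + l ->
  orient (G s1) (G s2) (G s3) = 0 ->
  exists tau c a b, [/\ enorm tau = 1, l <= a & flat_on tau c a b].
Proof.
move=> s12 s23 s31 o0; have l0 := loop_gt0 LG.
suff [tau [c [a [b [h f]]]]] : exists tau c a b, enorm tau = 1 /\ flat_on tau c a b.
  have [m hm] := nat_above ((l - a) / l); rewrite ltr_pdivrMr// in hm.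
  exists tau, c, (a + m%:R * l), (b + m%:R * l); split => //; first by lra.
  elim: m {hm} => [|m ih]; first by rewrite mul0r !addr0.
  by rewrite -(natr1 m) mulrDl mul1r !addrA; exact: flat_onS.
have n12 : G s2 - G s1 <> 0.
  move=> e; apply: (loop_inj LG s12 (lt_trans s23 s31)).
  by apply/eqP; rewrite eq_sym -subr_eq0; apply/eqP.
have d0 := enorm_gt0 n12; set d := enorm _ in d0.
pose tau : R * R := ((G s2 - G s1).1 / d, (G s2 - G s1).2 / d).
have h : enorm tau = 1.
  apply/eqP; rewrite -(@eqrXn2 _ 2)// ?enorm_ge0//; apply/eqP.
  rewrite enorm_sq expr1n; transitivity (dotp (G s2 - G s1) (G s2 - G s1) / d ^+ 2).
    by rewrite /dotp /tau /=; field; rewrite gt_eqF.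
  by rewrite -enorm_sq divff// expf_eq0 gt_eqF.
pose c := dotp (G s1) (normal tau).
have e2 : dotp (G s2) (normal tau) = c.
  apply: subr0_eq; rewrite /c -dotpBl /dotp /normal /tau /=; field; rewrite gt_eqF//.
have e3 : dotp (G s3) (normal tau) = c.
  apply: subr0_eq; rewrite /c -dotpBl.
  transitivity (orient (G s1) (G s2) (G s3) / d); last by rewrite o0 mul0r.
  by rewrite /orient /crossp /dotp /normal /tau /=; field; rewrite gt_eqF.
have hN : enorm (- tau) = 1 by rewrite enormN.
have dist s t : dotp (G s) (normal tau) = c -> dotp (G t) (normal tau) = c ->
    s < t -> t < s + l -> dotp (G s) tau != dotp (G t) tau.
  move=> es et st ts; apply/eqP => e; apply: (loop_inj LG st ts).
  apply/eqP; rewrite -subr_eq0; apply/eqP/enorm_eq0/eqP.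
  rewrite -(@eqrXn2 _ 2)// ?enorm_ge0// enorm_sq expr0n /=.
  by rewrite (frame _ _ h) !dotpBl es et e !subrr !mulr0 addr0.
have d12 := dist _ _ (erefl : dotp (G s1) (normal tau) = c) e2 s12 (lt_trans s23 s31).
have d13 := dist _ _ (erefl : dotp (G s1) (normal tau) = c) e3 (lt_trans s12 s23) s31.
have s1l : s1 + l < s2 + l by rewrite ltrD2r.
have d23 := dist _ _ e2 e3 s23 (lt_trans s31 s1l).
have e1l : dotp (G (s1 + l)) (normal tau) = c by rewrite (loop_period LG).
have e2l : dotp (G (s2 + l)) (normal tau) = c by rewrite (loop_period LG).
have q1 : s2 < s3 := s23.
have ne s : dotp (G s) (normal tau) = c -> dotp (G s) (normal (- tau)) = - c.
  by move=> e; rewrite dotp_normalN e.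
have s2l : s2 + l < s3 + l by rewrite ltrD2r.
have tN s : dotp (G s) (- tau) = - dotp (G s) tau by rewrite dotpNr.
have P := loop_period LG.
have [x12|x12|/eqP] := ltgtP (dotp (G s1) tau) (dotp (G s2) tau); last by rewrite (negPf d12).
  have [x23|x23|/eqP] := ltgtP (dotp (G s2) tau) (dotp (G s3) tau); last by rewrite (negPf d23).
    by exists tau, c, s1, s3; split => //; apply: (@flat_sorted tau c s1 s2 s3).
  have [x13|x13|/eqP] := ltgtP (dotp (G s1) tau) (dotp (G s3) tau); last by rewrite (negPf d13).
    exists (- tau), (- c), s2, (s1 + l); split => //.
    apply: (@flat_sorted (- tau) (- c) s2 s3 (s1 + l)) => //; try exact: ne;
    by rewrite !tN ?P ltrN2.
  exists tau, c, s3, (s2 + l); split => //.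
  apply: (@flat_sorted tau c s3 (s1 + l) (s2 + l)) => //; by rewrite !P.
have [x23|x23|/eqP] := ltgtP (dotp (G s2) tau) (dotp (G s3) tau); last by rewrite (negPf d23).
  have [x13|x13|/eqP] := ltgtP (dotp (G s1) tau) (dotp (G s3) tau); last by rewrite (negPf d13).
    exists (- tau), (- c), s3, (s2 + l); split => //.
    apply: (@flat_sorted (- tau) (- c) s3 (s1 + l) (s2 + l)) => //; try exact: ne;
    by rewrite !tN ?P ltrN2.
  exists tau, c, s2, (s1 + l); split => //.
  apply: (@flat_sorted tau c s2 s3 (s1 + l)) => //; by rewrite !P.
exists (- tau), (- c), s1, s3; split => //.
apply: (@flat_sorted (- tau) (- c) s1 s2 s3) => //; try exact: ne;
by rewrite !tN ltrN2.
Qed.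

(** The beginning of the maximal segment: just before [q] the loop is off the
    line. *)
Lemma flat_start tau c a b eta : enorm tau = 1 -> flat_on tau c a b -> 0 < eta -> eta < l ->
  exists p q, [/\ q - eta <= p < q, q <= a, b < p + l, c < dotp (G p) (normal tau) &
    forall w, q <= w <= b -> dotp (G w) (normal tau) = c].
Proof.
move=> htau [/andP[ab bl] hc hw x] eta0 etal.
pose y s := dotp (G s) (normal tau).
have n0 : normal tau <> 0.
  move=> e; have := unit_sq htau; have e1 : tau.2 = 0.
    by apply: oppr_inj; rewrite -[LHS]/((normal tau).1) e oppr0.
  have e2 : tau.1 = 0 by rewrite -[LHS]/((normal tau).2) e.
  by rewrite e1 e2 expr0n /= addr0 => /esym/eqP; rewrite oner_eq0.
pose bad k := `[< exists v : R, a - k.+1%:R * eta <= v <= a - k%:R * eta /\ y v <> c >].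
have exbad : exists k, bad k.
  have [v /andP[v1 v2] vc] := loop_off_line LG (a - l) c n0.
  have av : 0 <= (a - v) / eta by rewrite divr_ge0 ?(ltW eta0)//; lra.
  have [k /andP[k1 k2]] := nat_floor av.
  rewrite ler_pdivlMr// in k1; rewrite ltr_pdivrMr// in k2.
  exists k; apply/asboolP; exists v; split; [lra|exact/eqP].
case: (ex_minnP exbad) => k /asboolP[p [/andP[p1 p2] pc]] kmin.
have zero w : a - k%:R * eta <= w <= b -> y w = c.
  move=> /andP[w1 w2]; have [aw|wa] := leP a w; first by apply: hw; rewrite aw.
  have aw0 : 0 <= (a - w) / eta by rewrite divr_ge0 ?(ltW eta0)//; lra.
  have [j /andP[j1 j2]] := nat_floor aw0.
  rewrite ler_pdivlMr// in j1; rewrite ltr_pdivrMr// in j2.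
  apply: contrapT => wc.
  have kj : (k <= j)%N by apply: kmin; apply/asboolP; exists w; split => //; lra.
  have kjR : k%:R * eta <= j%:R * eta by rewrite ler_pM2r// ler_nat.
  have wk : w = a - k%:R * eta by lra.
  case: k p1 p2 kmin w1 kj kjR wk => [|k] p1 p2 kmin w1 kj kjR wk.
    by apply: wc; apply: hw; rewrite wk; lra.
  have : (k.+1 <= k)%N.
    apply: kmin; apply/asboolP; exists w; split => //.
    by rewrite wk lexx /= lerD2l lerN2 ler_pM2r// ler_nat.
  by rewrite ltnn.
have k0 : 0 <= k%:R * eta by rewrite mulr_ge0// ltW.
rewrite -(natr1 k) in p1.
exists p, (a - k%:R * eta); split => //.
- apply/andP; split; first by lra.
  rewrite lt_neqAle p2 andbT; apply/eqP => e; apply: pc; apply: zero; lra.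
- lra.
- rewrite ltNge; apply/negP => h; apply: pc; rewrite /y -(loop_period LG); apply: zero; lra.
- by rewrite lt_neqAle hc andbT; apply/eqP => e; exact/pc.
Qed.

End flat.

(** * The energy gap above a segment *)

(** For directions [u] close to the normal of a segment, but tilted by [t], the
    segment lies on the rising side, immediately above the lowest point of the
    loop. So a positive proportion of the rising run lies below levels of order
    [t] above the lowest point, while the falling run reaches such levels within
    the short arc [eta] before the segment. The two runs have different
    distributions of heights, and the energy gap is positive. *)
Section flat_gap.
Variables (R : realType) (l : R) (G : R -> R * R).
Hypothesis LG : convex_loop l G.
Variables (tau : R * R) (c p q b : R).
Hypothesis htau : enorm tau = 1.
Hypotheses (pq : p < q) (qb : q < b) (bp : b < p + l).
Let x s := dotp (G s) tau.
Let y s := dotp (G s) (normal tau).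
Hypothesis yp : c < y p.
Hypothesis y_ge : forall w, c <= y w.
Hypothesis y_flat : forall w, q <= w <= b -> y w = c.
Local Notation ind := (ind R).

Let l_gt0 : 0 < l := loop_gt0 LG.

Lemma flat_mono s t : q <= s -> s < t -> t <= b -> x s < x t.
Proof.
move=> qs st tb.
have ys : y s = c by apply: y_flat; lra.
have yt : y t = c by apply: y_flat; lra.
rewrite lt_neqAle; apply/andP; split.
  apply/eqP => e; apply: (loop_inj LG st); first by move: bp pq; lra.
  apply/eqP; rewrite -subr_eq0; apply/eqP/enorm_eq0/eqP.
  rewrite -(@eqrXn2 _ 2)// ?enorm_ge0// enorm_sq expr0n /=.
  by rewrite (frame _ _ htau) !dotpBl -/(y s) -/(y t) ys yt -/(x s) -/(x t) e !subrr !mulr0 addr0.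
have : 0 <= orient (G s) (G t) (G (p + l)) by apply: (loop_orient LG); move: bp pq; lra.
rewrite (orient_on_line _ htau) -/(y s) -/(y t) ?ys ?yt// (loop_period LG) -/(y p).
by rewrite pmulr_lge0 ?subr_gt0// subr_ge0.
Qed.

Lemma loop_lip_dotp v s t : enorm v = 1 -> `|dotp (G s) v - dotp (G t) v| <= `|s - t|.
Proof.
move=> v1; rewrite -dotpBl; apply: le_trans (normr_dotp_le _ _) _.
by rewrite v1 mulr1; exact: (loop_lip LG).
Qed.

Variables (N : nat) (k0 : nat).
Hypothesis N_gt1 : (1 < N)%N.
Let d := l / N%:R.
Let x0 := k0%:R * d.
Let V := rgrid l G N k0.
Let T m : R := x0 + m%:R * d.
Hypotheses (k0p : x0 <= p) (k0p' : p < x0 + d).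

Variables (u : R * R) (L0 Y0 eta X : R).
Let t := dotp u tau.
Let nu := dotp u (normal tau).
Let H w := dotp (G w) u.
Hypothesis hu : enorm u = 1.
Hypothesis L0_gt0 : 0 < L0.
Hypothesis L0_le : L0 <= x b - x q.
Hypothesis t_gt0 : 0 < t.
Hypothesis nu_ge : 1 / 2 <= nu.
Hypothesis qp : q - p <= eta.
Hypothesis t_yp : 4 * l * t <= y p - c.
Hypothesis Xb : b <= X < p + l.
Hypothesis yX : Y0 <= y X - c.
Hypothesis t_Y0 : 4 * l * t <= Y0.
Hypothesis d_L0 : 32 * d <= L0.
Hypothesis d_Y0 : 32 * d <= Y0.
Hypothesis d_t : 2 * d <= t * L0.
Hypothesis etaE : 128 * l * eta = L0 * Y0.
Hypothesis d_LY : 256 * l * d <= L0 * Y0.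

Let d_gt0 : 0 < d.
Proof. by rewrite divr_gt0// natN_gt0. Qed.

Let Nd : N%:R * d = l.
Proof. by rewrite /d mulrC divfK// gt_eqF// natN_gt0. Qed.

Let VE m : V m = G (T m).
Proof. by rewrite /V rgridE /grid natrD mulrDl. Qed.

Let TS m : T m.+1 = T m + d.
Proof. by rewrite /T -(natr1 m) mulrDl mul1r addrA. Qed.

Let TN : T N = x0 + l.
Proof. by rewrite /T Nd. Qed.

Let HE w : H w = x w * t + y w * nu.
Proof. by rewrite /H (frame _ _ htau). Qed.

Let riseE m : rise V u m = H (T m.+1) - H (T m).
Proof. by rewrite /rise /edge dotpBl !VE. Qed.

Let Hq : H q = x q * t + c * nu.
Proof. by rewrite HE y_flat// lexx ltW. Qed.

Let H_flat w : q <= w <= b -> H w - H q = (x w - x q) * t.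
Proof. by move=> hw; rewrite Hq HE y_flat//; ring. Qed.

Let H_end w : q <= w <= b -> H w - H q <= t * (w - q).
Proof.
move=> hw; rewrite H_flat// mulrC ler_pM2l//.
apply: (le_trans (ler_norm _)); apply: (le_trans (loop_lip_dotp w q htau)).
by rewrite ger0_norm// subr_ge0; case/andP: hw.
Qed.

Let xq_lower w : x q - l <= x w.
Proof.
have [v /andP[v1 v2] e] := loop_reduce LG q w.
have := loop_lip_dotp v q htau; rewrite -/(x v) -/(x q).
rewrite {1}/x e -/(x w) [X in _ <= X]ger0_norm ?subr_ge0// ler_norml => /andP[h _].
by move: h v2; lra.
Qed.

Let H_lower w : c <= y w -> (y w - c) / 2 - l * t <= H w - H q.
Proof.
move=> yw; rewrite HE Hq.
have h1 : (y w - c) * (1 / 2) <= (y w - c) * nu by rewrite ler_wpM2l// subr_ge0.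
have h2 : - l * t <= (x w - x q) * t.
  by rewrite ler_pM2r//; have := xq_lower w; lra.
by move: h1 h2; lra.
Qed.

Let L := x b - x q.

Let Hb : H b - H q = L * t.
Proof. by rewrite H_flat// lexx andbT ltW. Qed.

Let L_le : L <= l.
Proof.
rewrite /L; apply: (le_trans (ler_norm _)); apply: (le_trans (loop_lip_dotp b q htau)).
rewrite ger0_norm; first by move: pq bp; lra.
by rewrite subr_ge0 ltW.
Qed.

Let Hp : L0 * t <= H p - H q.
Proof.
have := H_lower (ltW yp); have : L0 * t <= l * t by rewrite ler_pM2r// (le_trans L0_le).
move: t_yp; lra.
Qed.

Let H_right w : b <= w <= p + l -> L0 * t <= H w - H q.
Proof.
move=> /andP[w1 w2]; rewrite leNgt; apply/negP => hw.
have hb : L0 * t <= H b - H q by rewrite Hb ler_pM2r.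
have Hpl : H (p + l) = H p by rewrite /H (loop_period LG).
have Lt0 : 0 < L0 * t by rewrite mulr_gt0.
have wb : b < w.
  rewrite lt_neqAle w1 andbT; apply/eqP => e; move: hw hb; rewrite -e; lra.
have wp : w < p + l.
  rewrite lt_neqAle w2 andbT; apply/eqP => e; move: hw Hp; rewrite e Hpl; lra.
have g0 : p + l < q + l by rewrite ltrD2r.
have g1 : H q < H b by move: hb Lt0; lra.
have g2 : H w < H b by move: hb hw; lra.
have g3 : H q < H (p + l) by rewrite Hpl; move: Hp Lt0; lra.
have g4 : H w < H (p + l) by rewrite Hpl; move: Hp hw; lra.
exact: (@loop_no_alternation _ _ _ LG q b w (p + l) u qb wb wp g0 g1 g2 g3 g4).
Qed.

Let lam0 := H q + L0 * t / 2.
Let lam1 := H q + 3 * L0 * t / 4.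

(** The first half of the segment is below the level, edge by edge. *)
Lemma flat_up lam : lam0 <= lam -> L0 / (2 * d) - 2 <= up_below N V u lam.
Proof.
rewrite /lam0 => hlam.
have qb2 : q + L0 / 2 <= b.
  have : L0 <= b - q.
    apply: (le_trans L0_le); apply: (le_trans (ler_norm _)).
    apply: (le_trans (loop_lip_dotp b q htau)); rewrite ger0_norm//.
    by rewrite subr_ge0 ltW.
  by move: L0_gt0; lra.
have z10 : 0 <= q - x0 by move: pq k0p; lra.
have z12 : q - x0 <= q + L0 / 2 - x0 by move: L0_gt0; lra.
have z2N : q + L0 / 2 - x0 <= N%:R * d.
  rewrite Nd; have : L0 <= b - q.
    apply: (le_trans L0_le); apply: (le_trans (ler_norm _)).
    apply: (le_trans (loop_lip_dotp b q htau)); rewrite ger0_norm//.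
    by rewrite subr_ge0 ltW.
  by move: bp k0p' d_L0 L0_gt0; lra.
have := count_ge d_gt0 z10 z12 z2N.
have -> : (q + L0 / 2 - x0 - (q - x0)) / d = L0 / (2 * d) by field; rewrite gt_eqF.
move/le_trans; apply; apply: ler_sum => m _.
rewrite {1}/ind; case: ifP => [/andP[m1 m2]|_]; last first.
  by rewrite mulr_ge0 ?ind_ge0 ?half_below_ge0.
have tm : q <= T m by rewrite /T; move: m1; lra.
have tm' : T m.+1 <= q + L0 / 2 by rewrite /T; move: m2; lra.
have tS := TS m.
have tb : T m.+1 <= b := le_trans tm' qb2.
have tmb : T m <= b by move: tb tS d_gt0; lra.
have tqS : q <= T m.+1 by move: tm tS d_gt0; lra.
have h1 := H_end (introT andP (conj tm tmb)).
have h2 := H_end (introT andP (conj tqS tb)).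
have rpos : 0 < rise V u m.
  rewrite riseE (_ : _ - _ = (H (T m.+1) - H q) - (H (T m) - H q)); last by ring.
  rewrite !H_flat ?tm ?tmb ?tb ?tqS// -mulrBl pmulr_lgt0//.
  have : x (T m) < x (T m.+1) by apply: flat_mono => //; rewrite tS ltrDl.
  by lra.
have le2 : t * (T m.+1 - q) <= t * (L0 / 2) by rewrite ler_pM2l//; move: tm'; lra.
have le1 : t * (T m - q) <= t * (L0 / 2).
  by rewrite ler_pM2l//; move: tm' tS d_gt0; lra.
rewrite /half_below /ind rpos !VE -/(H (T m)) -/(H (T m.+1)).
have -> : H (T m) <= lam by move: h1 le1 hlam; lra.
have -> : H (T m.+1) <= lam by move: h2 le2 hlam; lra.
by lra.
Qed.

(** Falling edges below the level only occur before [q]: after the segment the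
    loop is above the level until it comes back to [p]. *)
Lemma flat_down lam : lam <= lam1 -> down_below N V u lam <= (eta + 2 * d) / d.
Proof.
rewrite /lam1 => hlam; have Lt0 : 0 < L0 * t by rewrite mulr_gt0.
have z0 : 0 <= q - x0 by move: pq k0p; lra.
have : (q - x0) / d + 1 <= (eta + 2 * d) / d.
  rewrite ler_pdivlMr// mulrDl divfK ?gt_eqF//; move: qp k0p'; lra.
apply: le_trans; apply: le_trans (count_le N d_gt0 z0).
rewrite /down_below big_nat [leRHS]big_nat; apply: ler_sum => m /andP[_ mN].
have hb1 : half_below V u lam m <= 1.
  by rewrite /half_below /ind; case: ifP; case: ifP; lra.
case: (ltP (m%:R * d) (q - x0)) => hm.
  by rewrite /ind; case: ifP => _; rewrite ?mul1r ?mul0r ?ler01.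
suff : rise V u m < 0 -> half_below V u lam m = 0.
  by rewrite /ind; case: ifP => [_ ->//|_ _]; rewrite ?mulr0 ?mul0r.
rewrite riseE subr_lt0 => fall.
have tm : q <= T m by rewrite /T; move: hm; lra.
have tS := TS m.
have tN : T m.+1 <= p + l.
  have : T m.+1 <= T N by rewrite /T lerD2l ler_pM2r// ler_nat.
  by rewrite TN; move: k0p; lra.
have high w : L0 * t <= H w - H q -> (H w <= lam) = false.
  by move=> h; apply/negP => h'; move: h h' hlam Lt0; lra.
rewrite /half_below !VE -/(H (T m)) -/(H (T m.+1)).
have [tb|tb] := leP (T m.+1) b.
  have : x (T m) < x (T m.+1) by apply: flat_mono => //; rewrite tS ltrDl.
  have f1 := @H_flat (T m) ltac:(apply/andP; split; [exact: tm|move: tb tS d_gt0; lra]).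
  have f2 := @H_flat (T m.+1) ltac:(apply/andP; split; [move: tm tS d_gt0; lra|exact: tb]).
  rewrite -(ltr_pM2r t_gt0) => h; exfalso; move: h f1 f2 fall; lra.
have r1 := @H_right (T m.+1) ltac:(by rewrite tN (ltW tb)).
have r0 : L0 * t <= H (T m) - H q by move: r1 fall; lra.
by rewrite !high// /ind addr0 mul0r.
Qed.

(** The level interval has length [L0 t / 4], and the runs have lengths of at least
    [Y0 / (8 d)] edges. *)
Lemma flat_energy_gap k a b' cc CC :
  updown N (fun j => rise V u (k + j)%N) a b' ->
  (forall i, cc <= dotp (V i) u <= CC) ->
  2 * ((Y0 / (8 * d)) * (Y0 / (8 * d))) * (L0 / (4 * l)) ^+ 2 * (L0 * t / 4)
    <= energy_gap V u k a b' cc CC.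
Proof.
move=> ud hcC; have [a0 b0 abN _ _] := ud.
have Lt0 : 0 < L0 * t by rewrite mulr_gt0.
have Vper j : V (j + N)%N = V j.
  by rewrite /V !rgridE addnA; exact: (grid_period LG N_gt1).
have Vd m : enorm (edge V m) <= d by rewrite /V rgrid_edge; exact: (grid_edge_le LG N_gt1).
have Y00 : 0 < Y0 by move: d_Y0 d_gt0; lra.
have /andP[X1 X2] := Xb.
have zi : 0 <= (q - x0) / d by rewrite divr_ge0 ?(ltW d_gt0)//; move: pq k0p; lra.
have [i /andP[i1 i2]] := nat_floor zi.
rewrite ler_pdivlMr// in i1; rewrite ltr_pdivrMr// -(natr1 i) mulrDl mul1r in i2.
have zj : 0 <= (X - x0) / d.
  by rewrite divr_ge0 ?(ltW d_gt0)//; move: X1 qb pq k0p; lra.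
have [j /andP[j1 j2]] := nat_floor zj.
rewrite ler_pdivlMr// in j1; rewrite ltr_pdivrMr// -(natr1 j) mulrDl mul1r in j2.
have ij : (i <= j)%N.
  rewrite -ltnS -(@ltr_nat R) -(ltr_pM2r d_gt0) -(natr1 j) mulrDl mul1r.
  by move: i1 j2 X1 qb; lra.
have jN : (j <= N)%N.
  rewrite -ltnS -(@ltr_nat R) -(ltr_pM2r d_gt0) -(natr1 N) mulrDl mul1r Nd.
  by move: j1 X2 k0p'; lra.
have Hi : `|H (T i) - H q| <= d.
  apply: le_trans (loop_lip_dotp _ _ hu) _; rewrite distrC ger0_norm /T;
  by move: i1 i2; lra.
have Hj : `|H (T j) - H X| <= d.
  apply: le_trans (loop_lip_dotp _ _ hu) _; rewrite distrC ger0_norm /T;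
  by move: j1 j2; lra.
have HX := H_lower (y_ge X).
have HX' : Y0 / 4 <= H X - H q by move: HX yX t_Y0; lra.
have [la lb] := runs_long Vper hu Vd ud ij jN.
rewrite !VE -/(H (T i)) -/(H (T j)) in la lb.
have big : Y0 / 8 <= H (T j) - H (T i).
  move: Hi Hj; rewrite !ler_norml => /andP[_ h1] /andP[h2 _].
  by move: h1 h2 HX' d_Y0; lra.
have A : Y0 / (8 * d) <= a%:R.
  rewrite (_ : Y0 / (8 * d) = Y0 / 8 / d); last by field; rewrite gt_eqF.
  by rewrite ler_pdivrMr// (le_trans big).
have B : Y0 / (8 * d) <= b'%:R.
  rewrite (_ : Y0 / (8 * d) = Y0 / 8 / d); last by field; rewrite gt_eqF.
  by rewrite ler_pdivrMr// (le_trans big).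
have Y8 : 0 < Y0 / (8 * d) by rewrite divr_gt0// mulr_gt0.
have A0 := lt_le_trans Y8 A; have B0 := lt_le_trans Y8 B.
have l01 : lam0 <= lam1 by rewrite /lam0 /lam1; move: Lt0; lra.
have c0 : cc <= lam0.
  have /andP[h1 _] := hcC i; apply: (le_trans h1); rewrite VE -/(H (T i)) /lam0.
  by move: Hi; rewrite ler_norml => /andP[_]; move: d_t; lra.
have C1 : lam1 <= CC.
  have /andP[_ h1] := hcC j; apply: (le_trans _ h1); rewrite VE -/(H (T j)) /lam1.
  have : L0 * t <= l * t by rewrite ler_pM2r// (le_trans L0_le).
  by move: Hj; rewrite ler_norml => /andP[h _]; move: h HX' d_Y0 t_Y0; lra.
have dpos : 0 <= L0 / (4 * l) by rewrite divr_ge0 ?(ltW L0_gt0)// mulr_ge0// ltW.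
have key lam : lam0 <= lam <= lam1 -> L0 / (4 * l) * (a%:R * b'%:R) <=
    b'%:R * up_below N V u lam - a%:R * down_below N V u lam.
  move=> /andP[h0 h1]; have hup := flat_up h0; have hdn := flat_down h1.
  have aN : a%:R * d <= l by rewrite -Nd ler_pM2r// ler_nat -abN leq_addr.
  have U : 7 * L0 / (16 * l) * a%:R <= up_below N V u lam.
    apply: (le_trans _ hup).
    apply: (@le_trans _ _ (7 * L0 / (16 * d))).
      rewrite -(ler_pM2r d_gt0).
      have -> : 7 * L0 / (16 * l) * a%:R * d = 7 * L0 / (16 * l) * (a%:R * d) by ring.
      have -> : 7 * L0 / (16 * d) * d = 7 * L0 / (16 * l) * l by field; rewrite !gt_eqF.
      by rewrite ler_wpM2l// divr_ge0// mulr_ge0// ltW.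
    rewrite -(ler_pM2r d_gt0) mulrBl.
    have -> : 7 * L0 / (16 * d) * d = 7 * L0 / 16 by field; rewrite gt_eqF.
    have -> : L0 / (2 * d) * d = L0 / 2 by field; rewrite gt_eqF.
    by move: d_L0; lra.
  have Dn : down_below N V u lam <= L0 / (8 * l) * b'%:R.
    apply: (le_trans hdn); apply: (@le_trans _ _ (L0 / (8 * l) * (Y0 / (8 * d)))).
      rewrite -(ler_pM2r d_gt0) divfK ?gt_eqF//.
      have -> : L0 / (8 * l) * (Y0 / (8 * d)) * d = (L0 * Y0) / (64 * l).
        by field; rewrite !gt_eqF.
      rewrite ler_pdivlMr ?mulr_gt0//; move: etaE d_LY; lra.
    by rewrite ler_wpM2l// divr_ge0 ?(ltW L0_gt0)// mulr_ge0// ltW.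
  have U' := ler_wpM2l (ltW B0) U; have D' := ler_wpM2l (ltW A0) Dn.
  apply: (@le_trans _ _ (b'%:R * (7 * L0 / (16 * l) * a%:R) - a%:R * (L0 / (8 * l) * b'%:R))); last first.
    by move: U' D'; lra.
  have -> : b'%:R * (7 * L0 / (16 * l) * a%:R) - a%:R * (L0 / (8 * l) * b'%:R) =
    5 * L0 / (16 * l) * (a%:R * b'%:R) by field; rewrite gt_eqF.
  rewrite ler_pM2r ?mulr_gt0//.
  have -> : L0 / (4 * l) = 4 * (L0 / (16 * l)) by field; rewrite gt_eqF.
  have -> : 5 * L0 / (16 * l) = 5 * (L0 / (16 * l)) by field; rewrite gt_eqF.
  by rewrite ler_pM2r ?ler_nat// divr_gt0// mulr_gt0.
apply: le_trans (gap_ge Vper ud c0 l01 C1 dpos key).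
have -> : lam1 - lam0 = L0 * t / 4 by rewrite /lam1 /lam0; field.
rewrite ler_pM2r ?divr_gt0//; apply: ler_wpM2r; first exact: sqr_ge0.
by rewrite ler_pM2l//; apply: ler_pM => //; exact: ltW.
Qed.

End flat_gap.

(** * The gain of a loop with a segment *)

Section angles.
Variable R : realType.

Lemma MVT_lip (f df : R -> R) : (forall x : R, is_derive x (1 : R) f (df x)) ->
  continuous f -> (forall x, `|df x| <= 1) -> forall x y, `|f x - f y| <= `|x - y|.
Proof.
move=> hd cf b; have key x y : x < y -> `|f y - f x| <= `|y - x|.
  move=> xy; have [z _ ->] := @MVT R f df x y xy (fun z _ => hd z) (continuous_subspaceT cf).
  by rewrite normrM ler_piMl.
move=> x y; have [xy|yx|->] := ltgtP x y; last by rewrite !subrr.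
  by rewrite distrC (distrC x); exact: key.
exact: key.
Qed.

Lemma sin_lip (x y : R) : `|sin x - sin y| <= `|x - y|.
Proof.
by apply: (@MVT_lip sin cos); [exact: continuous_sin|exact: cos_max].
Qed.

Lemma cos_lip (x y : R) : `|cos x - cos y| <= `|x - y|.
Proof.
apply: (@MVT_lip cos (fun z => - sin z)); first exact: continuous_cos.
by move=> z; rewrite normrN sin_max.
Qed.

Lemma angle_exists (v : R * R) : enorm v = 1 ->
  exists2 w : R, 0 <= w < pi *+ 2 & v = (cos w, sin w).
Proof.
move=> h; have vv := unit_sq h.
have v1b : - 1 <= v.1 <= 1.
  by rewrite -ler_norml; have := normr1_le_enorm v; rewrite h.
have s : sin (acos v.1) = `|v.2|.
  by rewrite sin_acos// -sqrtr_sqr; congr Num.sqrt; rewrite -vv; ring.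
have a0 := acos_ge0 v1b; have api := acos_lepi v1b; have pi0 := @pi_gt0 R.
have [v2|v2] := leP 0 v.2.
  exists (acos v.1); first by rewrite a0 mulr2n; lra.
  by rewrite acosK ?in_itv// s ger0_norm//; case: v {h vv v1b s a0 api v2}.
exists (pi *+ 2 - acos v.1).
  have : acos v.1 != 0.
    apply/eqP => e; move: s; rewrite e sin0 => /esym/eqP.
    by rewrite normr_eq0 => /eqP e2; rewrite e2 ltxx in v2.
  by rewrite neq_lt ltNge a0 /= => ?; rewrite mulr2n; apply/andP; split; lra.
rewrite [X in cos X]addrC [X in sin X]addrC cosD2pi sinD2pi cosN sinN s ltr0_norm// opprK.
by rewrite acosK ?in_itv//; case: v {h vv v1b s a0 api v2}.
Qed.

(** An arc of the circle of length [r] near [v] is close to [v] in both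
    coordinates. *)
Lemma Lam_near (v : R * R) (f : R * R -> R) (r : R) : enorm v = 1 -> dmeas f ->
  (forall u, 0 <= f u) -> 0 <= r <= 1 ->
  (forall u, enorm u = 1 -> `|u.1 - v.1| <= r -> `|u.2 - v.2| <= r -> 1 <= f u) ->
  r <= Lam f.
Proof.
move=> hv mf f0 /andP[r0 r1] hf; have [w0 /andP[w00 w02] vE] := angle_exists hv.
have pi2 := @pi_ge2 R.
have [al [al0 be2 near]] : exists al, [/\ 0 <= al, al + r <= pi *+ 2 &
    forall w, al <= w <= al + r -> `|w - w0| <= r].
  have [h|h] := leP w0 pi.
    exists w0; split => //; first by rewrite mulr2n; lra.
    by move=> w hw; rewrite ger0_norm; lra.
  exists (w0 - r); split; [lra|lra|].
  by move=> w hw; rewrite ler_norml; lra.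
have ar : al <= al + r by rewrite lerDl.
have f0' w : 0 <= f (cos w, sin w) by exact: f0.
rewrite /Lam (Int_split mf al0 (le_trans ar be2)) (Int_split mf ar be2).
have i1 : 0 <= Int 0 al (fun w => f (cos w, sin w)) by exact: Int_ge0.
have i3 : 0 <= Int (al + r) (pi *+ 2) (fun w => f (cos w, sin w)) by exact: Int_ge0.
have : r <= Int al (al + r) (fun w => f (cos w, sin w)); last by lra.
apply: (@le_trans _ _ (Int al (al + r) (fun=> 1))).
  by rewrite Int_cst// mul1r addrC addKr.
apply: le_Int; [exact: bmeas_cst|exact: mf|].
move=> w hw; apply: hf; first exact: enorm_circle.
  by rewrite vE /=; apply: le_trans (cos_lip _ _) (near _ hw).
by rewrite vE /=; apply: le_trans (sin_lip _ _) (near _ hw).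
Qed.

End angles.

(** The gap of [flat_energy_gap] holds for a set of directions of measure of
    order [t1]: those whose component along the segment is in [[t1, 2 t1]]. *)
Lemma flat_gain_exists (R : realType) (l : R) (G : R -> R * R) (tau : R * R) (c a b : R) :
  convex_loop l G -> enorm tau = 1 -> l <= a -> flat_on l G tau c a b ->
  exists2 c0 : R, 0 < c0 & exists N1, forall N, (N1 <= N)%N ->
    exists k gp, valid_gap N (rgrid l G N k) gp /\ c0 * N%:R ^+ 2 <= Lam gp / 4.
Proof.
move=> LG htau la fl; have l0 := loop_gt0 LG.
have [/andP[ab bal] y_ge y_ab xab] := fl.
have n1 : enorm (normal tau) = 1.
  by rewrite -htau /enorm /normal /= sqrrN addrC.
have nn0 : normal tau <> 0.
  by move=> e; move: n1; rewrite e enorm0 => /esym/eqP; rewrite oner_eq0.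
have [X' X'w X'c] := loop_off_line LG a c nn0.
have [Y0 Y0E] : exists Y0, Y0 = dotp (G X') (normal tau) - c by eexists.
have Y00 : 0 < Y0 by rewrite Y0E subr_gt0 lt_neqAle y_ge andbT eq_sym.
have lip v s t : enorm v = 1 -> `|dotp (G s) v - dotp (G t) v| <= `|s - t|.
  by move=> v1; exact: (loop_lip_dotp LG).
have Y0l : Y0 <= l.
  have ya : dotp (G a) (normal tau) = c by apply: y_ab; rewrite lexx ltW.
  have := lip _ X' a n1; rewrite ya -Y0E (ger0_norm (ltW Y00)) => /le_trans; apply.
  by rewrite ger0_norm; move: X'w; clear; lra.
have [L0 L0E] : exists L0, L0 = dotp (G b) tau - dotp (G a) tau by eexists.
have L00 : 0 < L0 by rewrite L0E -dotpBl.
have L0l : L0 <= l.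
  rewrite L0E; apply: (le_trans (ler_norm _)); apply: (le_trans (lip _ _ _ htau)).
  by rewrite ger0_norm; move: ab bal; clear; lra.
have [eta etaE] : exists eta, eta = L0 * Y0 / (128 * l) by eexists.
have l128 : 0 < 128 * l := mulr_gt0 (ltr0Sn _ 127) l0.
have eta0 : 0 < eta by rewrite etaE divr_gt0// mulr_gt0.
have etaEq : 128 * l * eta = L0 * Y0 by rewrite etaE mulrC divfK// gt_eqF.
have etaY : eta < Y0.
  rewrite etaE ltr_pdivrMr// mulrC ltr_pM2l//; move: L0l l0; clear; lra.
have etal : eta < l := lt_le_trans etaY Y0l.
have [p [q [/andP[qp pq] qa bp yp y_flat]]] := flat_start LG htau fl eta0 etal.
have qb : q < b := le_lt_trans qa ab.
have [y0 y0E] : exists y0, y0 = dotp (G p) (normal tau) - c by eexists.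
have y00 : 0 < y0 by rewrite y0E subr_gt0.
have [X /andP[X1 X2] XE] := loop_reduce LG q X'.
have yX : Y0 <= dotp (G X) (normal tau) - c by rewrite XE Y0E.
have Xb : b <= X < p + l.
  apply/andP; split.
    rewrite leNgt; apply/negP => Xb.
    have yXc : dotp (G X) (normal tau) = c by apply: y_flat; rewrite X1 ltW.
    by move: yX; rewrite yXc subrr leNgt Y00.
  rewrite ltNge; apply/negP => Xp.
  have yq : dotp (G q) (normal tau) = c by apply: y_flat; rewrite lexx ltW.
  have := le_trans (ler_norm _) (lip _ (X - l) q n1).
  rewrite -(loop_period LG (X - l)) subrK yq ler0_norm; last by move: X2; clear; lra.
  by move: yX etaY Xp qp; clear; lra.
have L0q : L0 <= dotp (G b) tau - dotp (G q) tau.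
  rewrite L0E lerD2l lerN2; move: qa; rewrite le_eqVlt => /predU1P[->//|qa].
  by apply/ltW; apply: (flat_mono LG htau pq bp yp y_flat) => //; exact: ltW.
(* the tilt is small compared with the height of the loop over the line and with
   the height of the point p from which the segment is approached *)
have [t1 [t10 t1y t1Y t18]] : exists t1, [/\ 0 < t1, 8 * l * t1 <= y0, 8 * l * t1 <= Y0 & 8 * t1 <= 1].
  pose m := Num.min y0 (Num.min Y0 l).
  have m0 : 0 < m by rewrite !lt_min y00 Y00 l0.
  have ma : m <= y0 by rewrite ge_min lexx.
  have mb : m <= Y0 by rewrite !ge_min lexx orbT.
  have mc : m <= l by rewrite !ge_min lexx !orbT.
  exists (m / (8 * l)); have e : 8 * l * (m / (8 * l)) = m by field; rewrite gt_eqF.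
  have l8 : 0 < 8 * l by rewrite mulr_gt0.
  split; rewrite ?e//; first exact: divr_gt0.
  have e2 : 8 * (m / (8 * l)) * l = m by field; rewrite gt_eqF.
  by rewrite -(ler_pM2r l0) e2 mul1r.
have l256 : 0 < 256 * l := mulr_gt0 (ltr0Sn _ 255) l0.
have [d0 [d00 dL dY dt dLY]] : exists d0, [/\ 0 < d0, 32 * d0 <= L0, 32 * d0 <= Y0,
    2 * d0 <= t1 * L0 & 256 * l * d0 <= L0 * Y0].
  pose m := Num.min (L0 / 32) (Num.min (Y0 / 32) (Num.min (t1 * L0 / 2) (L0 * Y0 / (256 * l)))).
  have m0 : 0 < m.
    rewrite !lt_min (divr_gt0 L00 (ltr0Sn _ _)) (divr_gt0 Y00 (ltr0Sn _ _)).
    by rewrite (divr_gt0 (mulr_gt0 t10 L00) (ltr0Sn _ _)) (divr_gt0 (mulr_gt0 L00 Y00) l256).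
  have ma : m <= L0 / 32 by rewrite ge_min lexx.
  have mb : m <= Y0 / 32 by rewrite !ge_min lexx orbT.
  have mc : m <= t1 * L0 / 2 by rewrite !ge_min lexx !orbT.
  have md : m <= L0 * Y0 / (256 * l) by rewrite !ge_min lexx !orbT.
  exists m; split => //; [move: ma; clear; lra|move: mb; clear; lra|move: mc; clear; lra|].
  by rewrite mulrC -ler_pdivlMr.
pose K := 2 * ((Y0 / (8 * l)) * (Y0 / (8 * l))) * (L0 / (4 * l)) ^+ 2 * (L0 * t1 / 4).
have K0 : 0 < K.
  apply: mulr_gt0; last by rewrite divr_gt0// mulr_gt0.
  apply: mulr_gt0; last by rewrite exprn_gt0// divr_gt0// mulr_gt0.
  by apply: mulr_gt0 => //; apply: mulr_gt0; rewrite divr_gt0// mulr_gt0.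
exists (K * t1 / 16); first by rewrite divr_gt0// mulr_gt0.
have [N1 hN1] := nat_above (l / d0).
exists N1.+2 => N hN.
have N_gt1 : (1 < N)%N := gt1_of_ge hN.
have N0 : 0 < N%:R :> R by rewrite ltr0n ltnW.
have [d dE] : exists d, d = l / N%:R by eexists.
have dd : 0 < d by rewrite dE divr_gt0.
have dle : d <= d0.
  have := lt_le_trans hN1 (natr_le_of_ge2 R hN).
  by rewrite ltr_pdivrMr// dE ler_pdivrMr// mulrC => /ltW.
have p0 : 0 <= p / d by apply: divr_ge0; [move: bp ab la l0; clear; lra|exact: ltW].
have [k /andP[k1 k2]] := nat_floor p0.
rewrite ler_pdivlMr// in k1; rewrite ltr_pdivrMr// -(natr1 k) mulrDl mul1r in k2.
pose S u : R := ind R (`|dotp tau u - 3 / 2 * t1| <= t1 / 2) * ind R (0 < dotp (normal tau) u).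
have mS : dmeas S by rewrite /S; dmeas_tac.
have S0 u : 0 <= S u by rewrite mulr_ge0 ?ind_ge0.
exists k, (fun u => K * N%:R ^+ 2 * S u); split; last first.
  rewrite LamZ//.
  have h : t1 / 4 <= Lam S.
    pose nu0 := Num.sqrt (1 - (3 / 2 * t1) ^+ 2).
    have sq0 : 1 / 4 <= 1 - (3 / 2 * t1) ^+ 2.
      have : (3 / 2 * t1) ^+ 2 <= (1 / 2) ^+ 2.
        by rewrite lerXn2r ?nnegrE//; move: t10 t18; clear; lra.
      by move=> ?; lra.
    have nu02 : nu0 ^+ 2 = 1 - (3 / 2 * t1) ^+ 2.
      by rewrite sqr_sqrtr//; move: sq0; clear; lra.
    have nu0h : 1 / 2 <= nu0.
      rewrite -(@ler_pXn2r _ 2) ?nnegrE ?sqrtr_ge0 ?divr_ge0// nu02.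
      by move: sq0; clear; lra.
    pose s := 3 / 2 * t1.
    pose v : R * R := (s * tau.1 + nu0 * (normal tau).1, s * tau.2 + nu0 * (normal tau).2).
    have tt := unit_sq htau.
    have vt : dotp tau v = s.
      transitivity (s * (tau.1 ^+ 2 + tau.2 ^+ 2)); last by rewrite tt mulr1.
      by rewrite /dotp /v /normal /=; ring.
    have vn : dotp (normal tau) v = nu0.
      transitivity (nu0 * (tau.1 ^+ 2 + tau.2 ^+ 2)); last by rewrite tt mulr1.
      by rewrite /dotp /v /normal /=; ring.
    have v1 : enorm v = 1.
      apply/eqP; rewrite -(@eqrXn2 _ 2)// ?enorm_ge0//; apply/eqP.
      rewrite enorm_sq expr1n; transitivity ((s ^+ 2 + nu0 ^+ 2) * (tau.1 ^+ 2 + tau.2 ^+ 2)).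
        by rewrite /dotp /v /normal /=; ring.
      by rewrite tt mulr1 nu02 /s; ring.
    apply: (Lam_near v1 mS S0).
      by move: t10 t18; clear; lra.
    move=> u u1 h1 h2.
    have near z : enorm z = 1 -> `|dotp z u - dotp z v| <= t1 / 2.
      move=> z1; have -> : dotp z u - dotp z v = z.1 * (u.1 - v.1) + z.2 * (u.2 - v.2).
        by rewrite /dotp; ring.
      apply: (le_trans (ler_normD _ _)); rewrite !normrM.
      have e1 : `|z.1| <= 1 by rewrite -z1 normr1_le_enorm.
      have e2 : `|z.2| <= 1 by rewrite -z1 normr2_le_enorm.
      have : `|z.1| * `|u.1 - v.1| <= 1 * (t1 / 4) by apply: ler_pM.
      have : `|z.2| * `|u.2 - v.2| <= 1 * (t1 / 4) by apply: ler_pM.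
      by clear; lra.
    have := near _ htau; rewrite vt /S => ->.
    have := near _ n1; rewrite vn ler_norml => /andP[h3 _].
    have -> : 0 < dotp (normal tau) u by move: h3 nu0h t18; clear; lra.
    by rewrite /ind mulr1.
  have : K * N%:R ^+ 2 * (t1 / 4) <= K * N%:R ^+ 2 * Lam S.
    by rewrite ler_pM2l// mulr_gt0// exprn_gt0.
  by clear; lra.
split; first by apply: bmeasM => //; exact: bmeas_cst.
move=> u k' a' b' cc CC u1 ud hcC.
have g0 : 0 <= energy_gap (rgrid l G N k) u k' a' b' cc CC.
  exact: (proj2 (valid_gap0 N (rgrid l G N k)) u k' a' b' cc CC u1 ud hcC).
rewrite /S /ind; case: ifP => [ht|_]; last by rewrite mul0r mulr0.
case: ifP => [hn|_]; last by rewrite mulr0 mulr0.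
rewrite !mulr1; move: ht; rewrite ler_norml => /andP[ht1 ht2].
have cm (z : R * R) : dotp z u = dotp u z by rewrite /dotp; ring.
rewrite !cm in ht1 ht2 hn.
have [t tE] : exists t, t = dotp u tau by eexists.
rewrite -tE in ht1 ht2.
have t_lo : t1 <= t by move: ht1; clear; lra.
have t_hi : t <= 2 * t1 by move: ht2; clear; lra.
have t_gt0 : 0 < t := lt_le_trans t10 t_lo.
have nu_ge : 1 / 2 <= dotp u (normal tau).
  have := frame u u htau; rewrite -enorm_sq u1 expr1n -tE => e.
  rewrite -(@ler_pXn2r _ 2) ?nnegrE ?divr_ge0 ?(ltW hn)// expr2 [leRHS]expr2.
  have : t * t <= (1 / 4) * (1 / 4) by apply: ler_pM; move: t_gt0 t_hi t18; clear; lra.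
  by move: e; clear; lra.
have t_yp : 4 * l * t <= dotp (G p) (normal tau) - c.
  rewrite -y0E; apply: le_trans t1y; have : l * t <= l * (2 * t1) by rewrite ler_pM2l.
  by clear; lra.
have t_Y0 : 4 * l * t <= Y0.
  apply: le_trans t1Y; have : l * t <= l * (2 * t1) by rewrite ler_pM2l.
  by clear; lra.
have d_t : 2 * d <= t * L0.
  apply: (@le_trans _ _ (t1 * L0)); first by move: dle dt; clear; lra.
  by rewrite ler_pM2r.
have d_LY : 256 * l * d <= L0 * Y0.
  by apply: (le_trans _ dLY); rewrite (ler_pM2l l256).
have d_L0 : 32 * d <= L0 by move: dle dL; clear; lra.
have d_Y0 : 32 * d <= Y0 by move: dle dY; clear; lra.
rewrite dE in k1 k2 d_t d_LY d_L0 d_Y0.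
rewrite tE in t_gt0 t_yp t_Y0 d_t.
have qpe : q - p <= eta by move: qp; clear; lra.
have := flat_energy_gap LG htau pq qb bp yp y_ge y_flat N_gt1 k1 k2 u1 L00 L0q t_gt0
  nu_ge qpe t_yp Xb yX t_Y0 d_L0 d_Y0 d_t etaEq d_LY ud hcC.
apply: le_trans.
have -> : Y0 / (8 * (l / N%:R)) = Y0 / (8 * l) * N%:R.
  by field; rewrite !gt_eqF.
rewrite -tE /K.
have hK : 0 <= 2 * ((Y0 / (8 * l)) * (Y0 / (8 * l))) * (L0 / (4 * l)) ^+ 2 * N%:R ^+ 2.
  have y8 : 0 <= Y0 / (8 * l) by rewrite divr_ge0 ?(ltW Y00)// mulr_ge0// ltW.
  apply: mulr_ge0; last exact: sqr_ge0.
  apply: mulr_ge0; last exact: sqr_ge0.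
  by apply: mulr_ge0 => //; exact: mulr_ge0.
have : L0 * t1 / 4 <= L0 * t / 4 by rewrite ler_pM2r// ler_pM2l.
move=> /(ler_wpM2l hK); congr (_ <= _); ring.
Qed.

(** * The strict asymptotic inequality for a convex loop *)

Section loop_sums.
Variables (R : realType) (l : R) (G : R -> R * R).

(** The inscribed polygons exhaust the length. *)
Definition grid_rectifies := forall e : R, 0 < e ->
  exists N0, forall N, (N0 <= N)%N -> l - e <= perim N (grid l G N).

(** Either three points of the loop are collinear, and the loop contains a
    segment, or it is strictly convex. *)
Lemma loop_gain_exists : convex_loop l G ->
  exists2 c : R, 0 < c & exists N1, forall N, (N1 <= N)%N ->
  exists k gain gp, [/\ valid_gain (rgrid l G N k) gain, valid_gap N (rgrid l G N k) gp &
    c * N%:R ^+ 2 <= l / 2 * wsum N (fun i r q =>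
      gain i r q * window_mass (rgrid l G N k) i (r + q)) + Lam gp / 4].
Proof.
move=> LG.
have [[s1 [s2 [s3 [s12 s23 s31 o]]]]|none] := pselect (exists s1 s2 s3,
    [/\ s1 < s2, s2 < s3, s3 < s1 + l & orient (G s1) (G s2) (G s3) = 0]).
  have [tau [c [a [b [h la fl]]]]] := flat_arc LG s12 s23 s31 o.
  have [c0 c00 [N1 hN1]] := flat_gain_exists LG h la fl.
  exists c0 => //; exists N1.+2 => N hN.
  have [k [gp [vg hc]]] := hN1 N (leq_trans (leqW (leqnSn N1)) hN).
  exists k, (fun _ _ _ => 0), gp; split => //.
    by apply: valid_gain0 => //; exact: gt1_of_ge hN.
  rewrite (_ : wsum _ _ = 0) ?mulr0 ?add0r//.
  rewrite /wsum big1// => i _; rewrite big1// => r _; rewrite big1// => q _.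
  by rewrite mul0r mulr0.
have strict s t v : s < t -> t < v -> v < s + l -> 0 < orient (G s) (G t) (G v).
  move=> st tv vs; rewrite lt_neqAle; apply/andP; split; last first.
    by apply: (loop_orient LG); exact: ltW.
  by apply/eqP => e; apply: none; exists s, t, v; split.
have [c0 c00 [N1 hN1]] := strict_gain_exists LG strict.
exists c0 => //; exists N1 => N hN.
have [k [gain [vg hc]]] := hN1 N hN.
exists k, gain, (fun=> 0); split => //; first exact: valid_gap0.
by rewrite Lam_cst !mul0r addr0.
Qed.

(** [perim] of the inscribed polygons tends to [l], so that the error terms of
    [grid_mean_distance] are absorbed by half of the gain. *)
Theorem loop_sum_gt : convex_loop l G -> grid_rectifies ->
  exists2 e : R, 0 < e & exists N0, forall N, (N0 <= N)%N ->
  N%:R ^+ 2 * (l / 6 + e) <=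
  \sum_(0 <= i < N) \sum_(0 <= j < N) enorm (grid l G N i - grid l G N j).
Proof.
move=> LG len; have [c c0 [N1 hN1]] := loop_gain_exists LG.
have c4 : 0 < c / 4 by rewrite divr_gt0.
have [N2 hN2] := len _ c4.
exists (c / 4) => //; exists (N1 + N2).+2 => N hN.
have [k [gain [gp [vg vp hc]]]] := hN1 N (leq_trans (leqW (leqW (leq_addr N2 N1))) hN).
have hp := hN2 N (leq_trans (leqW (leqW (leq_addl N1 N2))) hN).
have N_gt1 := gt1_of_ge hN.
apply: le_trans (grid_mean_distance LG N_gt1 vg vp).
set W := l / 2 * _ in hc *; set P := perim _ _ in hp *.
have n2 : 0 <= N%:R ^+ 2 :> R by exact: sqr_ge0.
have h : (l - c / 4) * N%:R ^+ 2 <= P * N%:R ^+ 2 by rewrite ler_wpM2r.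
have ln2 : 0 <= c * N%:R ^+ 2 by rewrite mulr_ge0// ltW.
move: hc h ln2; clear; lra.
Qed.

End loop_sums.

(** * Boundaries of convex bodies *)

Section bodies.
Variable R : realType.
Implicit Types (K : set (R * R)%type) (x y z w O : R * R) (t r : R).

Lemma ball_enorm x y r : ball x r y -> enorm (y - x) <= 2 * r.
Proof.
move=> [h1 h2]; apply: (le_trans (enorm_le_l1 _)); rewrite !pairE.
move: h1 h2; rewrite /ball /= /ball_ distrC (distrC x.2) => h1 h2; lra.
Qed.

Lemma enorm_ball x y r : enorm (y - x) < r -> ball x r y.
Proof.
move=> h; split; rewrite /ball /= /ball_ distrC.
  by apply: le_lt_trans h; rewrite -fstB normr1_le_enorm.
by apply: le_lt_trans h; rewrite -sndB normr2_le_enorm.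
Qed.

Lemma interior_enormP K x : K° x <-> exists2 r, 0 < r & forall y, enorm (y - x) < r -> K y.
Proof.
split=> [/nbhs_ballP[r /= r0 h]|[r r0 h]].
  by exists r => // y hy; apply: h; exact: enorm_ball.
apply/nbhs_ballP; exists (r / 3) => /=; first by rewrite divr_gt0.
by move=> y /ball_enorm hy; apply: h; apply: le_lt_trans hy _; lra.
Qed.

Lemma pair_ext x y : x.1 = y.1 -> x.2 = y.2 -> x = y.
Proof. by case: x; case: y => a b c d /= -> ->. Qed.

Lemma enormZ r x : enorm (r * x.1, r * x.2) = `|r| * enorm x.
Proof.
rewrite -[`|r|]sqrtr_sqr /enorm -sqrtrM ?sqr_ge0//; congr Num.sqrt.
by rewrite /=; ring.
Qed.

Variable K : set (R * R)%type.
Hypothesis bodyK : convex_body K.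

Lemma body_conv x y t : 0 <= t -> t <= 1 -> K x -> K y ->
  K (t * x.1 + (1 - t) * y.1, t * x.2 + (1 - t) * y.2).
Proof.
move=> t0 t1 Kx Ky; have [_ cK _] := bodyK.
by have := cK x y (Itv01 t0 t1); rewrite !inE => /(_ Kx Ky).
Qed.

Lemma body_closed : closure K = K.
Proof.
have [cK _ _] := bodyK; apply/esym/closure_id.
by apply: compact_closed cK; exact: norm_hausdorff.
Qed.

Lemma boundaryE x : boundary K x <-> K x /\ ~ K° x.
Proof. by rewrite /boundary body_closed. Qed.

(** The interior point has a positive coefficient in this combination, and moving
    it gives a neighbourhood. *)
Lemma body_cone O x y (al be : R) : K° O -> K x -> K y -> 0 <= al -> 0 <= be ->
  al + be < 1 ->
  K° (O.1 + al * (x.1 - O.1) + be * (y.1 - O.1), O.2 + al * (x.2 - O.2) + be * (y.2 - O.2)).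
Proof.
move=> /interior_enormP[r r0 hr] Kx Ky al0 be0 ab1; set X := (_, _).
pose s := al + be; have s1 : 0 < 1 - s by rewrite subr_gt0.
have [s0|s0] := eqVneq s 0.
  have al00 : al = 0 by rewrite /s in s0; lra.
  have be00 : be = 0 by rewrite /s in s0; lra.
  apply/interior_enormP; exists r => // w hw; apply: hr; move: hw.
  by rewrite /X al00 be00 !mul0r !addr0 -surjective_pairing.
have s_gt0 : 0 < s by rewrite lt_neqAle eq_sym s0 addr_ge0.
pose t := al / s; pose z : R * R := (t * x.1 + (1 - t) * y.1, t * x.2 + (1 - t) * y.2).
have Kz : K z.
  apply: body_conv => //; first by rewrite divr_ge0// ltW.
  by rewrite ler_pdivrMr// mul1r lerDl.
apply/interior_enormP; exists ((1 - s) * r); first by rewrite mulr_gt0.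
move=> w hw.
pose O' : R * R := (O.1 + (w.1 - X.1) / (1 - s), O.2 + (w.2 - X.2) / (1 - s)).
have KO' : K O'.
  apply: hr; rewrite -(ltr_pM2l s1); apply: le_lt_trans hw; rewrite le_eqVlt.
  apply/orP; left; apply/eqP.
  rewrite -{1}(gtr0_norm s1) -[`|_|]sqrtr_sqr /enorm -sqrtrM ?sqr_ge0//.
  congr Num.sqrt; rewrite /O' /=; field; by rewrite gt_eqF.
have alE : al = s * t by rewrite /t mulrC divfK.
have beE : be = s * (1 - t) by rewrite mulrBr mulr1 -alE /s; ring.
have s1' := gt_eqF s1.
have <- : (s * z.1 + (1 - s) * O'.1, s * z.2 + (1 - s) * O'.2) = w.
  by apply: pair_ext => /=; rewrite alE beE; field; rewrite s1'.
by apply: body_conv => //; [exact: ltW|move: s1; rewrite subr_gt0 => /ltW].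
Qed.

(** The form in which convexity is used: seen from an interior point, a boundary
    point is not below any chord of the body. *)
Lemma boundary_cone O x y q (al be : R) : K° O -> K x -> K y -> boundary K q ->
  0 <= al -> 0 <= be ->
  q.1 - O.1 = al * (x.1 - O.1) + be * (y.1 - O.1) ->
  q.2 - O.2 = al * (x.2 - O.2) + be * (y.2 - O.2) -> 1 <= al + be.
Proof.
move=> KO Kx Ky /boundaryE[_ nq] al0 be0 e1 e2; rewrite leNgt; apply/negP => ab.
apply: nq; have -> : q = (O.1 + al * (x.1 - O.1) + be * (y.1 - O.1),
   O.2 + al * (x.2 - O.2) + be * (y.2 - O.2)).
  by apply: pair_ext => /=; rewrite -addrA -(e1, e2) addrC subrK.
exact: body_cone.
Qed.

Lemma continuous_dotpl (n : R * R) : continuous (fun x : R * R => dotp x n).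
Proof.
move=> x; rewrite /dotp; apply: cvgD; apply: cvgM; try exact: cvg_cst.
  exact: cvg_fst.
exact: cvg_snd.
Qed.

(** The boundary contains points where the linear form is extremal on the body,
    and the two extrema differ. *)
Lemma boundary_off_line (n : R * R) (c : R) : n <> 0 ->
  exists2 q, boundary K q & dotp q n != c.
Proof.
move=> n0; have [cK _ [ O KO]] := bodyK.
have [r r0 hr] := (interior_enormP K O).1 KO.
have nn : 0 < dotp n n by rewrite -enorm_sq exprn_gt0// enorm_gt0.
have en := enorm_gt0 n0.
have K0 : K !=set0 by exists O; apply: hr; rewrite subrr enorm0.
have cf : {within K, continuous (fun x : R * R => dotp x n)}.
  exact/continuous_subspaceT/continuous_dotpl.
have [a] := compact_EVT_max K0 cK cf; rewrite inE => Ka amax.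
have [b] := compact_EVT_min K0 cK cf; rewrite inE => Kb bmin.
have push x e : K° x -> exists2 d, 0 < d & K (x.1 + e * d * n.1, x.2 + e * d * n.2).
  move=> /interior_enormP[s s0 hs].
  pose d := s / (2 * ((`|e| + 1) * enorm n)).
  have e1 : 0 < `|e| + 1 by rewrite ltr_wpDl.
  have D0 : 0 < 2 * ((`|e| + 1) * enorm n) by rewrite !mulr_gt0.
  have d0 : 0 < d by rewrite divr_gt0.
  exists d => //; apply: hs.
  have -> : enorm ((x.1 + e * d * n.1, x.2 + e * d * n.2) - x) = `|e| * d * enorm n.
    rewrite -{3}(gtr0_norm d0) -normrM -enormZ; congr enorm.
    by apply: pair_ext; rewrite !pairE /=; ring.
  apply: (@le_lt_trans _ _ (s / 2)); last by rewrite ltr_pdivrMr// mulr2n mulrDr mulr1 ltrDl.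
  have -> : s / 2 = (`|e| + 1) * d * enorm n by rewrite /d; field; rewrite !gt_eqF.
  by rewrite ler_pM2r// ler_pM2r// lerDl.
have Ba : boundary K a.
  apply/boundaryE; split=> // /(push _ 1)[d d0 /mem_set/amax].
  rewrite leNgt => /negP; apply.
  have -> : dotp (a.1 + 1 * d * n.1, a.2 + 1 * d * n.2) n = dotp a n + d * dotp n n.
    by rewrite /dotp /=; ring.
  by rewrite ltrDl mulr_gt0.
have Bb : boundary K b.
  apply/boundaryE; split=> // /(push _ (-1))[d d0 /mem_set/bmin].
  rewrite leNgt => /negP; apply.
  have -> : dotp (b.1 + -1 * d * n.1, b.2 + -1 * d * n.2) n = dotp b n - d * dotp n n.
    by rewrite /dotp /=; ring.
  by rewrite gtrBl mulr_gt0.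
have [d d0 /mem_set/amax h1] := push _ 1 KO.
have h2 : dotp b n <= dotp O n.
  by apply: bmin; rewrite inE; apply: hr; rewrite subrr enorm0.
have h3 : dotp b n < dotp a n.
  apply: (le_lt_trans h2); apply: lt_le_trans h1.
  have -> : dotp (O.1 + 1 * d * n.1, O.2 + 1 * d * n.2) n = dotp O n + d * dotp n n.
    by rewrite /dotp /=; ring.
  by rewrite ltrDl mulr_gt0.
have [ac|ac] := eqVneq (dotp a n) c; last by exists a.
by exists b => //; rewrite -ac lt_eqF.
Qed.

End bodies.

(** * Curve length and inscribed polygons *)
Section curve_length_lemmas.
Variable R : realType.
Implicit Types (g : R -> R * R) (a b s t : R).

(** The sums of which [curve_length] is the supremum; [b] is the default value of
    [nth]. *)
Definition chords g b a (u : seq R) : R :=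
  let F := g \o nth b (a :: u) in \sum_(0 <= n < size u) enorm (F n.+1 - F n).

Lemma chords_nil g b a : chords g b a [::] = 0.
Proof. by rewrite /chords big_geq. Qed.

Lemma chords_cons g b a t u : chords g b a (t :: u) = enorm (g t - g a) + chords g b t u.
Proof. by rewrite /chords /= big_nat_recl. Qed.

Lemma curve_lengthE g a b :
  curve_length g a b = ereal_sup [set (chords g b a u)%:E | u in [set u | itv_partition a b u]].
Proof. by []. Qed.

Lemma chord_le_curve_length g a b : a <= b ->
  ((enorm (g b - g a))%:E <= curve_length g a b)%E.
Proof.
rewrite le_eqVlt => /predU1P[->|ab].
  rewrite subrr enorm0; apply: ereal_sup_ubound; exists [::]; last by rewrite /= big_geq.
  by split => //=.
apply: ereal_sup_ubound; exists [:: b]; first exact: itv_partition1.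
by have := chords_cons g b a b [::]; rewrite chords_nil addr0 /chords /= => ->.
Qed.

Section rectify.
Variables (l : R) (G : R -> R * R).
Hypothesis l0 : 0 < l.
Hypothesis lip : forall s t, enorm (G s - G t) <= `|s - t|.

Lemma grid_chain N (m m' : nat) : (m <= m')%N ->
  enorm (grid l G N m' - grid l G N m) <= \sum_(m <= j < m') enorm (edge (grid l G N) j).
Proof.
move=> /subnK; move: (m' - m)%N => k <-; elim: k => [|k ih].
  by rewrite add0n subrr enorm0 big_geq.
rewrite addSn big_nat_recr ?leq_addl//=; apply: (le_trans (enorm_triangle _ (grid l G N (k + m)) _)).
by rewrite addrC lerD.
Qed.

(** Each point of a partition is replaced by the grid point on its left, which
    costs at most two steps of the grid per chord. *)
Lemma chords_le_grid N u a : (0 < N)%N -> 0 <= a ->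
  path <%O a u -> last a u = l -> forall m : nat,
  `|a - m%:R * (l / N%:R)| <= l / N%:R -> m%:R * (l / N%:R) <= a -> 
  chords G l a u <= \sum_(m <= j < N) enorm (edge (grid l G N) j) + 2 * (l / N%:R) * (size u)%:R.
Proof.
move=> N0; have n0 : 0 < N%:R :> R by rewrite ltr0n.
have d0 : 0 < l / N%:R by rewrite divr_gt0.
have Nd : N%:R * (l / N%:R) = l by rewrite mulrC divfK// gt_eqF.
set d := l / N%:R in d0 Nd *.
elim: u a => [|t u ih] a a0 /=.
  move=> _ al m h1 h2; rewrite chords_nil mulr0 addr0; apply: sumr_ge0 => j _; exact: enorm_ge0.
move=> /andP[at' pu] lst m h1 h2.
have t0 : 0 <= t := le_trans a0 (ltW at').
have [m' /andP[m1 m2]] := nat_floor (divr_ge0 t0 (ltW d0)).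
rewrite ler_pdivlMr// in m1; rewrite ltr_pdivrMr// -(natr1 m') mulrDl mul1r in m2.
have mm' : (m <= m')%N.
  rewrite -ltnS -(@ltr_nat R) -(ltr_pM2r d0) -(natr1 m') mulrDl mul1r.
  by move: h2 at' m2; clear; lra.
have m'N : (m' <= N)%N.
  rewrite -ltnS -(@ltr_nat R) -(ltr_pM2r d0) -(natr1 N) mulrDl mul1r Nd.
  have tl : t <= l.
    rewrite -lst; clear -pu; elim: u t pu => //= x u ih t /andP[tx pu].
    exact: le_trans (ltW tx) (ih _ pu).
  by move: m1 tl d0; clear; lra.
have hm : `|t - m'%:R * d| <= d by rewrite ger0_norm; move: m1 m2; clear; lra.
have := ih t t0 pu lst m' hm m1.
rewrite chords_cons -[(size u).+1%:R]natr1 => h3; rewrite (big_cat_nat mm' m'N)/=.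
have h4 := grid_chain N mm'.
have h5 : enorm (G t - G a) <= enorm (grid l G N m' - grid l G N m) + 2 * d.
  apply: (le_trans (enorm_triangle _ (grid l G N m') _)).
  apply: (@le_trans _ _ (d + (enorm (grid l G N m' - grid l G N m) + d))); last by clear; lra.
  apply: lerD; first exact: le_trans (lip _ _) hm.
  apply: (le_trans (enorm_triangle _ (grid l G N m) _)); rewrite lerD2l.
  by apply: le_trans (lip _ _) _; rewrite distrC.
by move: h3 h4 h5; clear; lra.
Qed.

Lemma rectifies_of_length : curve_length G 0 l = l%:E -> grid_rectifies l G.
Proof.
move=> len e e0.
have e2 : 0 < e / 2 by rewrite divr_gt0.
have lfin : ereal_sup [set (chords G l 0 u)%:E | u in [set u | itv_partition 0 l u]] \is a fin_num.
  by rewrite -curve_lengthE len.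
have [_ [u [pu /eqP lst] <-]] := ub_ereal_sup_adherent e2 lfin.
rewrite -curve_lengthE len -EFinB lte_fin => hu.
have [M hM] := nat_above (4 * l * (size u)%:R / e).
exists M.+2 => N hN; have N_gt1 := gt1_of_ge hN; have N0 := ltnW N_gt1.
have n0 : 0 < N%:R :> R by rewrite ltr0n.
have := chords_le_grid N0 (lexx 0) pu lst (m := 0%N).
rewrite mul0r subrr normr0 => /(_ (divr_ge0 (ltW l0) (ltW n0)) (lexx 0)) h.
have hMN := lt_le_trans hM (natr_le_of_ge2 R hN).
rewrite ltr_pdivrMr// in hMN.
have : 2 * (l / N%:R) * (size u)%:R <= e / 2.
  rewrite -(ler_pM2r n0).
  have -> : 2 * (l / N%:R) * (size u)%:R * N%:R = 2 * l * (size u)%:R.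
    by field; rewrite gt_eqF.
  by move: hMN; clear; lra.
by rewrite /perim; move: h hu; clear; lra.
Qed.

End rectify.

End curve_length_lemmas.

(** * Curves that are star-shaped and convex *)

Section triples.
Variable R : realType.
Implicit Types (p q r a b c : R * R) (al be : R).

(** With the origin at an interior point, this is [boundary_cone]. *)
Definition cone_above p q r : Prop := forall al be, 0 <= al -> 0 <= be ->
  q.1 = al * p.1 + be * r.1 -> q.2 = al * p.2 + be * r.2 -> 1 <= al + be.

(** The product of the three lengths with the orientation of the triangle of unit
    vectors in the directions of the three points. Unlike the orientation of the
    points themselves it cannot vanish for distinct directions, because a line
    meets the circle in two points at most. *)
Definition dirdet p q r : R :=
  enorm r * crossp p q + enorm p * crossp q r + enorm q * crossp r p.

Lemma dirdet_rot p q r : dirdet q r p = dirdet p q r.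
Proof. by rewrite /dirdet; ring. Qed.

Lemma orient_rot p q r : orient q r p = orient p q r.
Proof. by rewrite /orient /crossp !pairE; ring. Qed.

Lemma orient_cross p q r : orient p q r = crossp p q + crossp q r + crossp r p.
Proof. by rewrite /orient /crossp !pairE; ring. Qed.

Lemma crossC p q : crossp p q = - crossp q p.
Proof. by rewrite /crossp; ring. Qed.

(** The case in which [q] is between [p] and [r]: positivity of [dirdet] says that
    the unit vector of [q] is beyond the chord of the other two, which gives
    nonnegative coefficients, and then [cone_above] says the same of [q]
    itself. *)
Lemma orient_of_dirdet_wide p q r : cone_above p q r -> 0 < dirdet p q r ->
  crossp r p < 0 -> 0 <= orient p q r.
Proof.
move=> cone D rp; have k0 : 0 < crossp p r by rewrite crossC oppr_gt0.
have kn0 := gt_eqF k0.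
have [al alE] : exists al, al = crossp q r / crossp p r by eexists.
have [be beE] : exists be, be = crossp p q / crossp p r by eexists.
have qE1 : q.1 = al * p.1 + be * r.1.
  by rewrite alE beE; move: kn0; rewrite /crossp => kn0; field; rewrite kn0.
have qE2 : q.2 = al * p.2 + be * r.2.
  by rewrite alE beE; move: kn0; rewrite /crossp => kn0; field; rewrite kn0.
have hn : enorm q < al * enorm p + be * enorm r.
  rewrite -subr_gt0 -(pmulr_rgt0 _ k0).
  have -> : crossp p r * (al * enorm p + be * enorm r - enorm q) = dirdet p q r.
    by rewrite alE beE /dirdet (crossC r p); field; rewrite kn0.
  exact: D.
have hq : q = (al * p.1, al * p.2) + (be * r.1, be * r.2).
  by apply: pair_ext; rewrite pairE.
have tri1 : `|al| * enorm p <= enorm q + `|be| * enorm r.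
  rewrite -!enormZ -[enorm (be * _, _)]enormN; apply: le_trans (enormD _ _).
  by rewrite {1}hq addrK.
have tri2 : `|be| * enorm r <= enorm q + `|al| * enorm p.
  rewrite -!enormZ -[enorm (al * _, _)]enormN; apply: le_trans (enormD _ _).
  by rewrite {1}hq [X in X - _]addrC addrK.
have p0 := enorm_ge0 p; have r0 := enorm_ge0 r.
have al0 : 0 <= al.
  rewrite leNgt; apply/negP => h; have h' : al * enorm p <= 0 by rewrite nmulr_rle0.
  move: tri2 hn (ler_norm be) h'; rewrite (ltr0_norm h).
  by move=> t1 t2 t3 t4; have := ler_wpM2r r0 t3; move: t1 t2 t4; clear; lra.
have be0 : 0 <= be.
  rewrite leNgt; apply/negP => h; have h' : be * enorm r <= 0 by rewrite nmulr_rle0.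
  move: tri1 hn (ler_norm al) h'; rewrite (ltr0_norm h).
  by move=> t1 t2 t3 t4; have := ler_wpM2r p0 t3; move: t1 t2 t4; clear; lra.
have -> : orient p q r = crossp p r * (al + be - 1).
  by rewrite orient_cross alE beE (crossC r p); field; rewrite kn0.
by rewrite mulr_ge0 ?(ltW k0)// subr_ge0 (cone _ _ al0 be0).
Qed.

Lemma orient_of_dirdet p q r :
  cone_above p q r -> cone_above q r p -> cone_above r p q ->
  0 < dirdet p q r -> 0 <= orient p q r.
Proof.
move=> c1 c2 c3 D.
have [h1|h1] := leP 0 (crossp r p); last exact: orient_of_dirdet_wide.
have [h2|h2] := leP 0 (crossp p q); last first.
  by rewrite -orient_rot; apply: orient_of_dirdet_wide => //; rewrite dirdet_rot.
have [h3|h3] := leP 0 (crossp q r); last first.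
  by rewrite -2!orient_rot; apply: orient_of_dirdet_wide => //; rewrite 2!dirdet_rot.
by rewrite orient_cross; exact: addr_ge0 (addr_ge0 h2 h3) h1.
Qed.

(** A line through a point of the unit circle meets the circle in one other point
    at most. *)
Lemma circle_collinear a b c : dotp a a = 1 -> dotp b b = 1 -> dotp c c = 1 ->
  orient a b c = 0 -> [\/ a = b, b = c | a = c].
Proof.
move=> a1 b1 c1 o.
have [d dE] : exists d, d = b - a by eexists.
have [w wE] : exists w, w = c - a by eexists.
have bE : b = a + d by rewrite dE addrC subrK.
have cE : c = a + w by rewrite wE addrC subrK.
have x0 : crossp d w = 0 by rewrite dE wE -o.
have hd : 2 * dotp a d + dotp d d = 0.
  by have := b1; rewrite bE /dotp !pairE; move: a1; rewrite /dotp; clear; lra.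
have hw : 2 * dotp a w + dotp w w = 0.
  by have := c1; rewrite cE /dotp !pairE; move: a1; rewrite /dotp; clear; lra.
have par1 : dotp d d * dotp w w = dotp d w ^+ 2 + crossp d w ^+ 2.
  by rewrite /dotp /crossp; ring.
have par2 : dotp d d * dotp a w = dotp a d * dotp d w + crossp d w * crossp d a.
  by rewrite /dotp /crossp; ring.
have key : dotp d w * (dotp d w - dotp d d) = 0.
  have e : dotp d d * (2 * dotp a w + dotp w w) = 0 by rewrite hw mulr0.
  have e2 : 2 * dotp a d = - dotp d d by move: hd; clear; lra.
  rewrite mulrDr par1 mulrCA par2 x0 in e.
  have -> : dotp d w * (dotp d w - dotp d d) = dotp d w ^+ 2 + (- dotp d d) * dotp d w by ring.
  by rewrite -e2 -[RHS]e; ring.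
have z (v : R * R) : dotp v v = 0 -> v = 0.
  by rewrite -enorm_sq => /eqP; rewrite sqrf_eq0 => /eqP/enorm_eq0.
have [d0|dn0] := eqVneq (dotp d d) 0.
  by apply: Or31; rewrite bE (z _ d0) addr0.
have dw : dotp d w ^+ 2 = dotp d d * dotp w w by rewrite par1 x0; ring.
move/eqP: key; rewrite mulf_eq0 => /orP[/eqP e|/eqP e].
  apply: Or33; rewrite cE; move/eqP: dw; rewrite e expr0n eq_sym mulf_eq0 (negPf dn0) /=.
  by move/eqP/z => ->; rewrite addr0.
apply: Or32; rewrite bE cE; congr (_ + _).
have e' : dotp d w = dotp d d by move: e; clear; lra.
have e3 : dotp w w = dotp d d.
  by apply: (mulfI dn0); rewrite -dw e' expr2.
apply/eqP; rewrite -subr_eq0; apply/eqP/z.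
have -> : dotp (d - w) (d - w) = dotp d d - 2 * dotp d w + dotp w w.
  by rewrite /dotp !pairE; ring.
by rewrite e' e3; ring.
Qed.

End triples.

Section star_curves.
Variables (R : realType) (l : R) (Q : R -> R * R).
Implicit Types (s t v : R).
Hypothesis l0 : 0 < l.
Hypothesis per : forall s, Q (s + l) = Q s.
Hypothesis lip : forall s t, enorm (Q s - Q t) <= `|s - t|.
Hypothesis star : forall s t v, cone_above (Q s) (Q t) (Q v).
Hypothesis off : forall s (n : R * R) c, n <> 0 ->
    exists2 t, s <= t <= s + l & dotp (Q t) n != c.
Hypothesis inj : forall s t, s < t -> t < s + l -> Q s <> Q t.

Lemma star_nonzero s : Q s <> 0.
Proof.
move=> h; have := @star s s s 0 0 (lexx 0) (lexx 0).
rewrite h !mul0r !addr0 => /(_ erefl erefl); rewrite leNgt => /negP; apply.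
exact: ltr01.
Qed.

Definition dir s : R * R := ((enorm (Q s))^-1 * (Q s).1, (enorm (Q s))^-1 * (Q s).2).

Lemma dir_unit s : dotp (dir s) (dir s) = 1.
Proof.
have h := enorm_gt0 (@star_nonzero s); have h' := gt_eqF h.
have e : dotp (dir s) (dir s) = (enorm (Q s))^-1 ^+ 2 * dotp (Q s) (Q s).
  by rewrite /dotp /dir /=; ring.
by rewrite e -enorm_sq -exprMn mulVf ?h'// expr1n.
Qed.

(** A ray from the origin meets the curve only once, by [cone_above] applied in
    both ways. *)
Lemma dir_inj s t : s < t -> t < s + l -> dir s <> dir t.
Proof.
move=> st ts e; apply: (inj st ts).
have hs := enorm_gt0 (@star_nonzero s); have ht := enorm_gt0 (@star_nonzero t).
have [k kE] : exists k, k = enorm (Q t) / enorm (Q s) by eexists.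
have k0 : 0 < k by rewrite kE divr_gt0.
have [e1 e2] : Q t = (k * (Q s).1 + 0 * (Q s).1, k * (Q s).2 + 0 * (Q s).2) /\
    Q s = (k^-1 * (Q t).1 + 0 * (Q t).1, k^-1 * (Q t).2 + 0 * (Q t).2).
  move: e => [h1 h2].
  have hs' := gt_eqF hs; have ht' := gt_eqF ht.
  have f1 : (Q t).1 = k * (Q s).1.
    by rewrite kE -mulrA h1 mulrA mulfV ?ht'// mul1r.
  have f2 : (Q t).2 = k * (Q s).2.
    by rewrite kE -mulrA h2 mulrA mulfV ?ht'// mul1r.
  by split; apply: pair_ext => /=; rewrite !mul0r addr0 ?f1 ?f2// mulKf ?gt_eqF.
have k1 : 1 <= k + 0.
  by apply: (@star s t s); [exact: ltW|exact: lexx|rewrite {1}e1|rewrite {1}e1].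
have k2 : 1 <= k^-1 + 0.
  by apply: (@star t s t); [rewrite invr_ge0; exact: ltW|exact: lexx|rewrite {1}e2|rewrite {1}e2].
have kk : k = 1.
  apply/le_anti; rewrite addr0 in k1; rewrite k1 andbT.
  by move: k2; rewrite addr0 -(ler_pM2r k0) mul1r mulVf ?gt_eqF.
by apply: pair_ext; rewrite e1 kk /= mul1r mul0r addr0.
Qed.

Lemma dirdet_neq0 s t v : s < t -> t < v -> v < s + l -> dirdet (Q s) (Q t) (Q v) != 0.
Proof.
move=> st tv vs; apply/eqP => D.
have hs := enorm_gt0 (@star_nonzero s); have ht := enorm_gt0 (@star_nonzero t).
have hv := enorm_gt0 (@star_nonzero v).
have o : orient (dir s) (dir t) (dir v) = 0.
  have -> : orient (dir s) (dir t) (dir v) =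
     (enorm (Q s))^-1 * (enorm (Q t))^-1 * (enorm (Q v))^-1 * dirdet (Q s) (Q t) (Q v).
    by rewrite orient_cross /dirdet /dir /crossp /=; field; rewrite !gt_eqF.
  by rewrite D mulr0.
have [] := circle_collinear (dir_unit s) (dir_unit t) (dir_unit v) o.
- by apply: dir_inj => //; exact: lt_trans vs.
- apply: dir_inj => //; apply: (lt_trans vs); by rewrite ltrD2r.
- by apply: dir_inj => //; exact: lt_trans tv.
Qed.

Lemma conv_lt (a b a' b' z : R) : 0 <= z -> z <= 1 -> a < b -> a' < b' ->
  a + z * (a' - a) < b + z * (b' - b).
Proof.
move=> z0; rewrite le_eqVlt => /predU1P[->|z1] ab ab'.
  by rewrite !mul1r !(addrC _ (_ - _)) !subrK.
have h1 : 0 < (1 - z) * (b - a) by rewrite mulr_gt0// subr_gt0.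
have h2 : 0 <= z * (b' - a') by rewrite mulr_ge0// subr_ge0 ltW.
by move: h1 h2; lra.
Qed.

Lemma lip_continuous (f : R -> R) : (forall s t, `|f s - f t| <= `|s - t|) -> continuous f.
Proof.
move=> h s; apply/cvgrPdist_le => e e0; near=> t.
apply: (le_trans (h _ _)); near: t.
exact: cvgr_dist_le.
Unshelve. all: by end_near. Qed.

Lemma fst_star_continuous : continuous (fun s => (Q s).1).
Proof.
by apply: lip_continuous => s t; rewrite -fstB; apply: le_trans (normr1_le_enorm _) (lip _ _).
Qed.

Lemma snd_star_continuous : continuous (fun s => (Q s).2).
Proof.
by apply: lip_continuous => s t; rewrite -sndB; apply: le_trans (normr2_le_enorm _) (lip _ _).
Qed.

Lemma enorm_star_continuous : continuous (fun s => enorm (Q s)).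
Proof.
apply: lip_continuous => s t; apply: le_trans (lip _ _).
have h1 := enormD (Q s - Q t) (Q t); have h2 := enormD (Q t - Q s) (Q s).
rewrite !subrK (enormBC (Q t)) in h1 h2.
by rewrite ler_norml; move: h1 h2; lra.
Qed.

(** The ordered triples of parameters form a convex set on which [dirdet] is
    continuous and does not vanish; apply the intermediate value theorem along
    segments. *)
Lemma dirdet_sign :
  (forall s t v, s < t -> t < v -> v < s + l -> 0 < dirdet (Q s) (Q t) (Q v)) \/
  (forall s t v, s < t -> t < v -> v < s + l -> dirdet (Q s) (Q t) (Q v) < 0).
Proof.
pose D s t v := dirdet (Q s) (Q t) (Q v).
have [h|h] := pselect (forall s t v, s < t -> t < v -> v < s + l -> 0 < D s t v).
  by left.
right=> s t v st tv vs; rewrite ltNge; apply/negP => D0.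
apply: h => s' t' v' st' tv' vs'; rewrite ltNge; apply/negP => D0'.
pose c (x y z : R) := x + z * (y - x).
have cc x y : continuous (c x y).
  by move=> z; apply: cvgD; [exact: cvg_cst|apply: cvgMl; exact: cvg_id].
pose f z := D (c s s' z) (c t t' z) (c v v' z).
have cf : continuous f.
  have c1 x y : continuous (fun z => (Q (c x y z)).1).
    by move=> z; apply: (@continuous_comp _ _ _ (c x y) (fun s => (Q s).1)); [exact: cc|exact: fst_star_continuous].
  have c2 x y : continuous (fun z => (Q (c x y z)).2).
    by move=> z; apply: (@continuous_comp _ _ _ (c x y) (fun s => (Q s).2)); [exact: cc|exact: snd_star_continuous].
  have cn x y : continuous (fun z => enorm (Q (c x y z))).
    by move=> z; apply: (@continuous_comp _ _ _ (c x y) (fun s => enorm (Q s))); [exact: cc|exact: enorm_star_continuous].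
  have cx x y x' y' : continuous (fun z => crossp (Q (c x y z)) (Q (c x' y' z))).
    move=> z; rewrite /crossp; apply: cvgB; apply: cvgM;
      first [exact: c1|exact: c2].
  move=> z; rewrite /f /D /dirdet.
  by apply: cvgD; [apply: cvgD|]; apply: cvgM; first [exact: cn|exact: cx].
have f0 : f 0 = D s t v by rewrite /f /c !mul0r !addr0.
have f1 : f 1 = D s' t' v' by rewrite /f /c !mul1r !(addrC _ (_ - _)) !subrK.
have [||z] := @IVT R f 0 1 0 ler01; first exact: continuous_subspaceT.
  by rewrite f0 f1 ge_min D0' orbT le_max D0.
rewrite in_itv /= => /andP[z0 z1]; apply/eqP/dirdet_neq0.
- exact: conv_lt.
- exact: conv_lt.
- have := conv_lt z0 z1 vs vs'; rewrite /c; congr (_ < _); ring.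
Qed.

Lemma star_loop_pos :
  (forall s t v, s < t -> t < v -> v < s + l -> 0 < dirdet (Q s) (Q t) (Q v)) ->
  convex_loop l Q.
Proof.
move=> pos; split => // s t v st tv vs.
have [->|nst] := eqVneq s t.
  by rewrite /orient subrr /crossp /= !mul0r subrr.
have [->|ntv] := eqVneq t v.
  by rewrite /orient /crossp mulrC subrr.
have [->|nvs] := eqVneq v (s + l).
  by rewrite per /orient subrr /crossp /= !mulr0 subrr.
apply: orient_of_dirdet; [exact: star..|].
by apply: pos; rewrite lt_neqAle ?nst ?ntv ?nvs.
Qed.

End star_curves.

Section flip.
Variables (R : realType) (l : R) (Q : R -> R * R).
Implicit Types (s t v : R) (x : R * R).
Hypothesis l0 : 0 < l.
Hypothesis per : forall s, Q (s + l) = Q s.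
Hypothesis lip : forall s t, enorm (Q s - Q t) <= `|s - t|.
Hypothesis star : forall s t v, cone_above (Q s) (Q t) (Q v).
Hypothesis off : forall s (n : R * R) c, n <> 0 ->
    exists2 t, s <= t <= s + l & dotp (Q t) n != c.
Hypothesis inj : forall s t, s < t -> t < s + l -> Q s <> Q t.

(** A reflection changes a clockwise curve into a counterclockwise one. *)
Definition flip x : R * R := (x.1, - x.2).

Lemma flipK : involutive flip.
Proof. by case=> a b; rewrite /flip /= opprK. Qed.

Lemma enorm_flip x : enorm (flip x) = enorm x.
Proof. by rewrite /enorm /= sqrrN. Qed.

Lemma flipB x y : flip x - flip y = flip (x - y).
Proof. by apply: pair_ext => //; rewrite !pairE /=; ring. Qed.

(** First coordinates are kept in order to compute with explicit bodies later. *)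
Lemma star_loop : exists G, [/\ convex_loop l G,
  forall s t, enorm (G s - G t) = enorm (Q s - Q t) & forall s, (G s).1 = (Q s).1].
Proof.
have [pos|neg] := dirdet_sign lip star inj.
  by exists Q; split => //; exact: star_loop_pos.
exists (flip \o Q); split => //; last by move=> s t /=; rewrite flipB enorm_flip.
apply: star_loop_pos => //=.
- by move=> s; rewrite per.
- by move=> s t; rewrite flipB enorm_flip.
- move=> s t v al be al0 be0 /= h1 h2; apply: (star al0 be0 h1).
  by rewrite !mulrN -opprD in h2; exact: oppr_inj.
- move=> s n c n0; have [|t st h] := @off s (flip n) c.
    by apply/eqP; apply: contra_notN n0 => /eqP h; rewrite -(flipK n) h /flip /= oppr0.
  by exists t => //; move: h; rewrite /dotp /flip /= mulrN mulNr.
- by move=> s t st ts /(can_inj flipK); exact: inj.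
- move=> s t v st tv vs; have := neg s t v st tv vs.
  rewrite /dirdet !enorm_flip /crossp /flip /= -oppr_gt0; congr (0 < _); ring.
Qed.

End flip.

(** * From a parametrization by arclength to a convex loop *)

Section wrap.
Variables (R : realType) (l : R).
Hypothesis l0 : 0 < l.
Implicit Types (s t : R).

Definition wrap s : R := s - l * (Num.floor (s / l))%:~R.

Lemma wrap_uniq s t (m : int) : 0 <= t -> t < l -> s = t + l * m%:~R -> wrap s = t.
Proof.
move=> t0 tl e; suff -> : wrap s = s - l * m%:~R by rewrite e addrK.
rewrite /wrap; congr (_ - l * _%:~R); apply: floor_def.
rewrite e mulrDl (mulrC l) mulfK ?gt_eqF// intrD addrC lerDl divr_ge0 ?(ltW l0)//=.
by rewrite ltrD2l ltr_pdivrMr// mul1r.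
Qed.

Lemma wrap_ge0 s : 0 <= wrap s.
Proof.
by rewrite /wrap subr_ge0 mulrC -ler_pdivlMr// floor_le_tmp.
Qed.

Lemma wrap_lt s : wrap s < l.
Proof.
rewrite /wrap ltrBlDr -[X in X + _]mulr1 -mulrDr mulrC -ltr_pdivrMr// addrC.
by have := floorD1_gt (s / l); rewrite intrD.
Qed.

Lemma wrapE s : s = wrap s + l * (Num.floor (s / l))%:~R.
Proof. by rewrite subrK. Qed.

Lemma wrap_id s : 0 <= s -> s < l -> wrap s = s.
Proof. by move=> h1 h2; apply: (@wrap_uniq _ _ 0) => //; rewrite mulr0 addr0. Qed.

Lemma wrap_add s x : 0 <= x -> wrap s + x < l -> wrap (s + x) = wrap s + x.
Proof.
move=> x0 h; apply: (@wrap_uniq _ _ (Num.floor (s / l))) => //.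
  by rewrite addr_ge0 ?wrap_ge0.
by rewrite {1}(wrapE s); ring.
Qed.

Lemma wrap_turn s x : x <= l -> l <= wrap s + x -> wrap (s + x) = wrap s + x - l.
Proof.
move=> xl h; apply: (@wrap_uniq _ _ (Num.floor (s / l) + 1)).
- by rewrite subr_ge0.
- by rewrite ltrBlDr ltr_leD// wrap_lt.
- by rewrite {1}(wrapE s) intrD; ring.
Qed.

Lemma wrap_period s : wrap (s + l) = wrap s.
Proof. by rewrite wrap_turn ?addrK// lerDr wrap_ge0. Qed.

End wrap.

Section boundary_loops.
Variable R : realType.
Implicit Types (K : set (R * R)%type) (s t l : R).

Lemma curve_length_congr (f g : R -> R * R) (a b : R) :
  (forall s t, a <= s <= b -> a <= t <= b -> enorm (f s - f t) = enorm (g s - g t)) ->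
  curve_length f a b = curve_length g a b.
Proof.
move=> h; rewrite !curve_lengthE; congr ereal_sup; apply: eq_imagel => u /= [pu /eqP lst].
congr (_%:E); suff key x : path <%O x u -> last x u = b -> a <= x -> chords f b x u = chords g b x u.
  exact: key.
elim: u x {pu lst} => [|t u ih] x /=; first by rewrite !chords_nil.
move=> /andP[xt pu] lst ax; rewrite !chords_cons.
have tb : t <= b.
  rewrite -lst; clear -pu; elim: u t pu => //= y u ih t /andP[ty pu].
  exact: le_trans (ltW ty) (ih _ pu).
have at' := le_trans ax (ltW xt).
have xb := le_trans (ltW xt) tb.
by rewrite h ?at' ?ax ?tb ?xb// ih.
Qed.

(** A chord is not longer than its arc. *)
Lemma param_lip l (C : set (R * R)%type) (g : R -> R * R) : arclength_param C l g ->
  forall s t, 0 <= s <= l -> 0 <= t <= l -> enorm (g s - g t) <= `|s - t|.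
Proof.
move=> [l0 _ _ _ len]; have key s t : 0 <= s -> s <= t -> t <= l -> enorm (g s - g t) <= `|s - t|.
  move=> s0 st tl; rewrite enormBC distrC ger0_norm ?subr_ge0//.
  by have := chord_le_curve_length g st; rewrite len// lee_fin.
move=> s t /andP[s0 sl] /andP[t0 tl]; have [st|ts] := leP s t; first exact: key.
by rewrite enormBC distrC key// ltW.
Qed.

(** The closed curve is extended periodically and moved so that an interior point
    of the body becomes the origin. *)
Section fix_body.
Variables (K : set (R * R)%type) (O : R * R) (l : R) (g : R -> R * R).
Hypothesis bodyK : convex_body K.
Hypothesis KO : K° O.
Hypothesis P : arclength_param (boundary K) l g.

Let l0 : 0 < l. Proof. by have [] := P. Qed.
Let g0l : g 0 = g l. Proof. by have [] := P. Qed.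

Let Q s : R * R := g (wrap l s) - O.

Let wrap_in s : 0 <= wrap l s <= l.
Proof. by rewrite wrap_ge0// ltW// wrap_lt. Qed.

Let Qdiff s t : Q s - Q t = g (wrap l s) - g (wrap l t).
Proof. by rewrite /Q opprB addrA subrK. Qed.

Let wrap_val x : 0 <= x <= l -> g (wrap l x) = g x.
Proof.
move=> /andP[x0]; rewrite le_eqVlt => /predU1P[->|xl]; last by rewrite wrap_id.
by rewrite -{2}(add0r l) wrap_period// wrap_id.
Qed.

Let QE s t : 0 <= s <= l -> 0 <= t <= l -> enorm (Q s - Q t) = enorm (g s - g t).
Proof. by move=> hs ht; rewrite Qdiff !wrap_val. Qed.

(** If the parameters wrap around between [s] and [t], pass through the common
    end point of the period. *)
Let Qlip s t : enorm (Q s - Q t) <= `|s - t|.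
Proof.
have gl := param_lip P.
wlog st : s t / s <= t.
  by move=> h; have [/h//|/ltW/h] := leP s t; rewrite enormBC distrC.
rewrite (distrC s) ger0_norm ?subr_ge0// Qdiff.
have w1 := wrap_in s; have w2 := wrap_in t.
have [h|h] := leP l (t - s).
  apply: (le_trans (gl _ _ w1 w2)); apply: le_trans h; rewrite ler_norml.
  by move: w1 w2 => /andP[? ?] /andP[? ?]; apply/andP; split; lra.
have tE : t = s + (t - s) by rewrite addrC subrK.
have x0 : 0 <= t - s by rewrite subr_ge0.
have [h1|h1] := ltP (wrap l s + (t - s)) l.
  have wt : wrap l t = wrap l s + (t - s) by rewrite {1}tE wrap_add.
  apply: (le_trans (gl _ _ w1 w2)); rewrite wt opprD addrA subrr add0r normrN.
  by rewrite ger0_norm.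
have wt : wrap l t = wrap l s + (t - s) - l by rewrite {1}tE wrap_turn// ltW.
apply: (le_trans (enorm_triangle _ (g l) _)); rewrite -{2}g0l.
have i0 : (0 : R) <= 0 <= l  by apply/andP; split; [exact: lexx|exact: ltW].
have il : 0 <= l <= l by apply/andP; split; [exact: ltW|exact: lexx].
have e1 := gl _ _ w1 il; have e2 := gl _ _ i0 w2.
rewrite distrC ger0_norm ?subr_ge0 in e1; last by case/andP: w1.
rewrite sub0r normrN ger0_norm in e2; last by case/andP: w2.
apply: (le_trans (lerD e1 e2)); rewrite wt; lra.
Qed.

Let Qinj s t : s < t -> t < s + l -> Q s <> Q t.
Proof.
move=> st ts e; have [_ _ gi _ _] := P.
have w1 := wrap_lt l0 s; have w2 := wrap_lt l0 t.
have : g (wrap l s) = g (wrap l t) by rewrite -(subrK O (g (wrap l t))) -/(Q t) -e subrK.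
move/gi; rewrite !in_itv /= !wrap_ge0// w1 w2 => /(_ isT isT) we.
have tE : t = s + (t - s) by rewrite addrC subrK.
have x0 : 0 < t - s by rewrite subr_gt0.
have xl : t - s < l by rewrite ltrBlDl.
have [h1|h1] := ltP (wrap l s + (t - s)) l.
  by move: we; rewrite {1}tE wrap_add// ?ltW// => we; move: x0 we; lra.
by move: we; rewrite {1}tE wrap_turn// ?ltW// => we; move: xl we; lra.
Qed.

Let Qin s : boundary K (g (wrap l s)).
Proof.
by have [_ _ _ <- _] := P; exists (wrap l s) => //=; rewrite in_itv /=.
Qed.

Let Kin q : boundary K q -> K q.
Proof. by move/(boundaryE bodyK) => []. Qed.

Let Qstar s t v : cone_above (Q s) (Q t) (Q v).
Proof.
move=> al be al0 be0 h1 h2.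
exact: (@boundary_cone _ K bodyK O (g (wrap l s)) (g (wrap l v)) (g (wrap l t))
  al be KO (Kin (Qin s)) (Kin (Qin v)) (Qin t)).
Qed.

Let Qoff s (n : R * R) c : n <> 0 -> exists2 t, s <= t <= s + l & dotp (Q t) n != c.
Proof.
move=> n0; have [q Bq hq] := boundary_off_line bodyK (c + dotp O n) n0.
have [x /andP[x0 xl] gx] : exists2 x, 0 <= x < l & g x = q.
  have [_ _ _ gK _] := P; move: Bq; rewrite -gK => -[x /=].
  rewrite in_itv /= => /andP[x0]; rewrite le_eqVlt => /predU1P[->|xl] <-.
    by exists 0; rewrite ?lexx.
  by exists x; rewrite ?x0.
have w0 := wrap_ge0 l0 s; have wl := wrap_lt l0 s.
have [t st wt] : exists2 t, s <= t <= s + l & wrap l t = x.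
  have [h|h] := leP (wrap l s) x.
    have e : wrap l s + (x - wrap l s) = x by rewrite addrC subrK.
    exists (s + (x - wrap l s)); first by move: w0 x0 xl h; lra.
    by rewrite (@wrap_add _ l l0) ?e// subr_ge0.
  have e : wrap l s + (x - wrap l s + l) - l = x by ring.
  exists (s + (x - wrap l s + l)); first by move: wl w0 x0 xl h; lra.
  rewrite (@wrap_turn _ l l0) ?e//; first by move: h; lra.
  by rewrite -subr_ge0 e.
exists t => //; rewrite /Q wt gx dotpBl; apply: contra hq => /eqP <-.
by rewrite subrK.
Qed.

Lemma boundary_loop_from : exists G, [/\ convex_loop l G,
  forall s t, 0 <= s <= l -> 0 <= t <= l -> enorm (G s - G t) = enorm (g s - g t) &
  forall s, 0 <= s <= l -> (G s).1 = (g s).1 - O.1].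
Proof.
have per s : Q (s + l) = Q s by rewrite /Q wrap_period.
have [G [LG GE G1]] := star_loop l0 per Qlip Qstar Qoff Qinj.
exists G; split => // [s t hs ht|s hs]; first by rewrite GE QE.
by rewrite G1 /Q fstB wrap_val.
Qed.

End fix_body.

Lemma boundary_loop K l (g : R -> R * R) : convex_body K -> arclength_param (boundary K) l g ->
  exists G, [/\ convex_loop l G, grid_rectifies l G,
    forall s t, 0 <= s <= l -> 0 <= t <= l -> enorm (G s - G t) = enorm (g s - g t) &
    exists o, forall s, 0 <= s <= l -> (G s).1 = (g s).1 - o].
Proof.
move=> bK P; have [_ _ [ O KO]] := bK.
have [G [LG GE G1]] := boundary_loop_from bK KO P; exists G; split => //; last by exists O.1.
apply: rectifies_of_length; [exact: loop_gt0 LG|exact: loop_lip LG|].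
rewrite (curve_length_congr GE); have [l0 _ _ _ len] := P.
by rewrite len ?subr0// ltW.
Qed.

End boundary_loops.

(** * Reparametrization by arclength *)

Section clamping.
Variable R : realType.
Implicit Types (l p q s t : R).

Lemma max0_diff p q : p <= q -> Num.max 0 q - Num.max 0 p <= q - p.
Proof. by rewrite /Num.max; case: ltP => h1; case: ltP => h2 h3; lra. Qed.

Lemma min_diff l p q : p <= q -> Num.min l q - Num.min l p <= q - p.
Proof. by rewrite /Num.min; case: ltP => h1; case: ltP => h2 h3; lra. Qed.

Definition clamp l s : R := Num.min l (Num.max 0 s).

Lemma clamp_id l s : 0 <= s <= l -> clamp l s = s.
Proof. by move=> /andP[h1 h2]; rewrite /clamp max_r// min_r. Qed.

Lemma clamp_in l s : 0 <= l -> 0 <= clamp l s <= l.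
Proof. by move=> l0; rewrite /clamp ge_min lexx le_min l0 le_max lexx. Qed.

Lemma clamp_lip l s t : `|clamp l s - clamp l t| <= `|s - t|.
Proof.
wlog st : s t / s <= t.
  by move=> h; have [/h//|/ltW/h] := leP s t; rewrite distrC (distrC s).
have h : Num.max 0 s <= Num.max 0 t by rewrite ge_max !le_max lexx st orbT.
rewrite (distrC s) (distrC (clamp l s)) [leRHS]ger0_norm ?subr_ge0//.
rewrite ger0_norm; first exact: le_trans (min_diff l h) (max0_diff st).
by rewrite subr_ge0 le_min !ge_min lexx h orbT.
Qed.

End clamping.

Section reparametrization.
Variables (R : realType) (c : R -> R * R) (M : R).
Hypothesis clip : forall s t, enorm (c s - c t) <= M * `|s - t|.
Implicit Types (a b s t : R) (u v w : seq R).

Let part a b u := path <%O a u /\ last a u = b.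

Lemma chords_base b b' a u : chords c b a u = chords c b' a u.
Proof. by elim: u a => [|t u ih] a; rewrite ?chords_nil// !chords_cons ih. Qed.

Lemma chords_cat d a u v : chords c d a (u ++ v) = chords c d a u + chords c d (last a u) v.
Proof.
elim: u a => [|t u ih] a /=; first by rewrite chords_nil add0r.
by rewrite !chords_cons ih addrA.
Qed.

Lemma part_le a b u : part a b u -> a <= b.
Proof.
move=> [pu <-]; elim: u a pu => //= t u ih a /andP[at' pu].
exact: le_trans (ltW at') (ih _ pu).
Qed.

Lemma chords_le_lip d a b u : part a b u -> chords c d a u <= M * (b - a).
Proof.
move=> [pu <-]; elim: u a pu => [|t u ih] a /=.
  by rewrite chords_nil subrr mulr0.
move=> /andP[at' pu]; rewrite chords_cons.
have -> : M * (last t u - a) = M * (t - a) + M * (last t u - t) by ring.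
apply: lerD (ih _ pu); apply: le_trans (clip _ _) _.
by rewrite ger0_norm// subr_ge0 ltW.
Qed.

(** Refining a partition by one point does not decrease the sum of the
    chords. *)
Lemma part_insert a b w x : a <= b -> b <= x -> part a x w -> exists u v,
  [/\ part a b u, part b x v & chords c x a w <= chords c x a u + chords c x b v].
Proof.
move=> ab bx; elim: w a ab => [|t w ih] a ab [/= pw lw].
  have -> : b = a by apply/le_anti; rewrite ab lw bx.
  by exists [::], [::]; split => //; rewrite !chords_nil addr0.
move: pw => /andP[at' pw].
have [ba|ba] := leP b a.
  have -> : b = a by apply/le_anti; rewrite ab ba.
  exists [::], (t :: w); split => //; last by rewrite chords_nil add0r.
  by split => //=; rewrite at'.
have [tb|bt] := leP t b.
  have [u [v [[pu lu] pv h]]] := ih t tb (conj pw lw).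
  exists (t :: u), v; split => //; first by split => //=; rewrite at'.
  by rewrite !chords_cons -addrA lerD2l.
exists [:: b], (t :: w); split; first by split => //=; rewrite ba.
  by split => //=; rewrite bt.
rewrite !chords_cons chords_nil addr0 addrA lerD2r [leRHS]addrC.
exact: enorm_triangle.
Qed.

Definition len a b : R := fine (curve_length c a b).

Lemma partP a b u : part a b u <-> itv_partition a b u.
Proof. by split=> [[pu lu]|[pu /eqP lu]]; split => //; apply/eqP. Qed.

Lemma part_exists a b : a <= b -> exists u, part a b u.
Proof.
rewrite le_eqVlt => /predU1P[->|ab]; first by exists [::].
by exists [:: b]; split => //=; rewrite ab.
Qed.

Lemma lenE a b : a <= b -> curve_length c a b = (len a b)%:E.
Proof.
move=> ab; rewrite /len fineK// fin_numElt; apply/andP; split.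
  have [u pu] := part_exists ab.
  apply: (@lt_le_trans _ _ (chords c b a u)%:E); first exact: ltNyr.
  by rewrite curve_lengthE; apply: ereal_sup_ubound; exists u => //; exact/partP.
apply: (@le_lt_trans _ _ (M * (b - a))%:E); last exact: ltry.
rewrite curve_lengthE; apply: ub_ereal_sup => _ [u /partP pu <-].
by rewrite lee_fin; exact: chords_le_lip.
Qed.

Lemma len_ub d a b u : part a b u -> chords c d a u <= len a b.
Proof.
move=> pu; rewrite -lee_fin -(lenE (part_le pu)) curve_lengthE (chords_base _ b).
by apply: ereal_sup_ubound; exists u => //; exact/partP.
Qed.

Lemma len_lub a b x : a <= b -> (forall u, part a b u -> chords c b a u <= x) -> len a b <= x.
Proof.
move=> ab h; rewrite -lee_fin -(lenE ab) curve_lengthE.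
by apply: ub_ereal_sup => _ [u /partP pu <-]; rewrite lee_fin; exact: h.
Qed.

Lemma len_add a b x : a <= b -> b <= x -> len a x = len a b + len b x.
Proof.
move=> ab bx; have ax := le_trans ab bx; apply/le_anti/andP; split.
  apply: len_lub => // w pw; have [u [v [pu pv h]]] := part_insert ab bx pw.
  by apply: (le_trans h); apply: lerD; exact: len_ub.
rewrite -lerBrDl; apply: len_lub => // v [pv lv].
rewrite lerBrDl -lerBrDr; apply: len_lub => // u [pu lu].
rewrite lerBrDr (chords_base b x).
have := @len_ub x a x (u ++ v); rewrite chords_cat lu; apply.
by split; rewrite ?cat_path ?last_cat lu ?pu.
Qed.

Lemma len_chord a b : a <= b -> enorm (c b - c a) <= len a b.
Proof. by move=> ab; rewrite -lee_fin -lenE//; exact: chord_le_curve_length. Qed.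

Lemma len_ge0 a b : a <= b -> 0 <= len a b.
Proof. by move=> ab; apply: le_trans (len_chord ab); exact: enorm_ge0. Qed.

Lemma len_le a b : a <= b -> len a b <= M * (b - a).
Proof. by move=> ab; apply: len_lub => // u; exact: chords_le_lip. Qed.

Lemma len_xx a : len a a = 0.
Proof. by have := len_add (lexx a) (lexx a); lra. Qed.

Variable T : R.
Hypothesis T0 : 0 < T.
Hypothesis closed : c 0 = c T.
Hypothesis inj : {in `[0, T[ &, injective c}.

Let l := len 0 T.

Lemma len_gt0 a b : 0 <= a -> a < b -> b <= T -> 0 < len a b.
Proof.
move=> a0 ab bT; have [x [ax xb]] : exists x, a < x /\ x < b.
  by exists ((a + b) / 2); split; lra.
rewrite (len_add (ltW ax) (ltW xb)) ltr_wpDr// ?len_ge0 ?ltW//.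
apply: lt_le_trans (len_chord (ltW ax)); apply: enorm_gt0 => /eqP.
rewrite subr_eq0 => /eqP/inj; rewrite !in_itv /= a0 (lt_le_trans xb bT).
rewrite (le_trans a0 (ltW ax)) (lt_le_trans (lt_trans ax xb) bT) => /(_ isT isT) e.
by move: ax; rewrite e ltxx.
Qed.

Let ell t := len 0 t.

Lemma ell_diff s t : 0 <= s -> s <= t -> ell t - ell s = len s t.
Proof. by move=> s0 st; rewrite /ell (len_add s0 st) addrC addKr. Qed.

Lemma ell_lt s t : 0 <= s -> s < t -> t <= T -> ell s < ell t.
Proof.
by move=> s0 st tT; rewrite -subr_gt0 ell_diff ?len_gt0// ltW.
Qed.

(** The length function is Lipschitz, hence has the intermediate value
    property. *)
Lemma ell_onto s : 0 <= s <= l -> exists2 t, 0 <= t <= T & ell t = s.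
Proof.
move=> /andP[s0 sl]; pose f t := ell (Num.max 0 t).
have cf : continuous f.
  have M0 : 0 <= M.
    by have := clip 1 0; rewrite subr0 normr1 mulr1; apply: le_trans (enorm_ge0 _).
  move=> x; apply/cvgrPdist_le => e e0; near=> y.
  have key (p q : R) : p <= q -> `|f p - f q| <= M * (q - p).
    move=> pq; have h : Num.max 0 p <= Num.max 0 q by rewrite ge_max !le_max lexx pq orbT.
    have h0 : 0 <= Num.max 0 p by rewrite le_max lexx.
    rewrite distrC /f ell_diff// ger0_norm ?len_ge0//.
    apply: (le_trans (len_le h)); apply: ler_wpM2l => //.
    exact: max0_diff.
  apply: (@le_trans _ _ (M * `|x - y|)).
    have [xy|yx] := leP x y.
      by apply: (le_trans (key _ _ xy)); rewrite distrC ler_wpM2l// ler_norm.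
    by rewrite distrC; apply: (le_trans (key _ _ (ltW yx))); rewrite ler_wpM2l// ler_norm.
  apply: (@le_trans _ _ ((M + 1) * `|x - y|)); first by rewrite ler_wpM2r// lerDl.
  rewrite mulrC -ler_pdivlMr ?ltr_wpDl//; near: y; apply: cvgr_dist_le => //.
  by rewrite divr_gt0// ltr_wpDl.
have f0 : f 0 = 0 by rewrite /f maxxx /ell len_xx.
have fT : f T = l by rewrite /f max_r// ltW.
have [||t] := @IVT R f 0 T s (ltW T0); first exact: continuous_subspaceT.
  by rewrite f0 fT ge_min s0 le_max sl orbT.
by rewrite in_itv /= => /andP[t0 tT] <-; exists t; rewrite ?t0// /f max_r.
Unshelve. all: by end_near. Qed.

Let sg s := xget 0 [set t | 0 <= t <= T /\ ell t = s].

Let sgP s : 0 <= s <= l -> 0 <= sg s <= T /\ ell (sg s) = s.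
Proof.
move=> hs; have [t ht e] := ell_onto hs.
by rewrite /sg; case: xgetP => [y -> //|/(_ t)]; case.
Qed.

Let ell_in t : 0 <= t <= T -> 0 <= ell t <= l.
Proof.
move=> /andP[t0 tT]; rewrite /ell len_ge0//= /l -subr_ge0 ell_diff//.
by rewrite len_ge0.
Qed.

Let ell_inj s t : 0 <= s <= T -> 0 <= t <= T -> ell s = ell t -> s = t.
Proof.
move=> /andP[s0 sT] /andP[t0 tT] e; apply/eqP; rewrite eq_le !leNgt.
by apply/andP; split; apply/negP => h; [have := ell_lt t0 h sT|have := ell_lt s0 h tT];
  rewrite e ltxx.
Qed.

Let sgK t : 0 <= t <= T -> sg (ell t) = t.
Proof. by move=> ht; have [h1 h2] := sgP (ell_in ht); exact: ell_inj. Qed.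

Let sg_lt s t : 0 <= s <= l -> 0 <= t <= l -> s < t -> sg s < sg t.
Proof.
move=> hs ht st; have [/andP[s0 sT] es] := sgP hs; have [/andP[t0 tT] et] := sgP ht.
rewrite ltNge; apply/negP; rewrite le_eqVlt => /predU1P[e|h].
  by move: st; rewrite -es -et e ltxx.
by have := ell_lt t0 h sT; rewrite es et ltNge (ltW st).
Qed.

Let g s := c (sg s).

Let path_map (f : R -> R) a b u :
  (forall s t, a <= s -> s < t -> t <= b -> f s < f t) -> part a b u ->
  path <%O (f a) (map f u).
Proof.
move=> hf [pu lu]; have hb := part_le (conj pu lu).
elim: u a pu lu hf hb => //= t u ih a /andP[at' pu] lu hf hb.
have tb := part_le (conj pu lu).
by rewrite hf// ih// => s s' ts; apply: hf; exact: le_trans (ltW at') ts.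
Qed.

Let chords_map (f g' : R -> R * R) (h : R -> R) d d' a b u :
  (forall s, a <= s <= b -> f s = g' (h s)) -> part a b u ->
  chords f d a u = chords g' d' (h a) (map h u).
Proof.
move=> hf pu; have ab := part_le pu.
elim: u a ab hf pu => [|t u ih] a ab hf [/= pu lu]; first by rewrite !chords_nil.
move: pu => /andP[at' pu]; have tb := part_le (conj pu lu).
rewrite !chords_cons !hf ?lexx ?ab ?tb ?(ltW at')// ih// => s /andP[ts sb].
by apply: hf; rewrite sb andbT (le_trans (ltW at')).
Qed.

(** The length function and its inverse carry partitions to partitions, in both
    ways. *)
Lemma curve_length_reparam s t : 0 <= s -> s <= t -> t <= l ->
  curve_length g s t = (t - s)%:E.
Proof.
move=> s0 st tl.
have hs : 0 <= s <= l by rewrite s0 (le_trans st).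
have ht : 0 <= t <= l by rewrite tl (le_trans s0).
have [/andP[a0 aT] ea] := sgP hs; have [/andP[b0 bT] eb] := sgP ht.
have ab : sg s <= sg t.
  by move: st; rewrite le_eqVlt => /predU1P[->//|/(sg_lt hs ht)/ltW].
have -> : t - s = len (sg s) (sg t) by rewrite -ell_diff// ea eb.
rewrite -lenE// !curve_lengthE; congr ereal_sup; apply/seteqP; split => _ [u /partP pu <-] /=.
  exists (map sg u); last first.
    by congr (_%:E); apply/esym; apply: chords_map pu.
  apply/partP; split; last by rewrite last_map pu.2.
  apply: path_map pu => x y sx xy yt; apply: sg_lt => //.
    by rewrite (le_trans s0)// (le_trans (ltW xy))// (le_trans yt).
  by rewrite (le_trans s0)// ?(le_trans sx (ltW xy))// (le_trans yt).
exists (map ell u); last first.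
  congr (_%:E); apply/esym; rewrite -{2}ea; apply: chords_map pu => x /andP[h1 h2].
  by rewrite /g sgK// (le_trans a0)// (le_trans h2).
apply/partP; split; last by rewrite -[in LHS]ea last_map pu.2 eb.
rewrite -ea; apply: path_map pu => x y h1 xy h2; apply: ell_lt => //.
  exact: le_trans h1.
exact: le_trans bT.
Qed.

(** Clamping the parameter makes the curve continuous on the whole line, hence
    measurable. *)
Definition reparam s : R * R := c (sg (clamp l s)).

Let l0 : 0 < l. Proof. exact: len_gt0. Qed.

Lemma reparam_arclength : arclength_param (c @` `[0, T]) l reparam.
Proof.
have i0 : (0 : R) <= 0 <= l by rewrite lexx ltW.
have il : 0 <= l <= l by rewrite lexx ltW.
have T_in : 0 <= T <= T by rewrite lexx ltW.
have s0 : sg 0 = 0 by rewrite -[in LHS](len_xx 0) sgK// lexx ltW.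
have sl : sg l = T by rewrite sgK.
split => //.
- by rewrite /reparam !clamp_id// s0 sl.
- move=> s t; rewrite !in_itv /= => /andP[h1 h2] /andP[h3 h4].
  have hs : 0 <= s <= l by rewrite h1 ltW.
  have ht : 0 <= t <= l by rewrite h3 ltW.
  have [/andP[a0 aT] ea] := sgP hs; have [/andP[b0 bT] eb] := sgP ht.
  rewrite /reparam !clamp_id// => /inj; rewrite !in_itv /= a0 b0 -sl !sg_lt//.
  by move=> /(_ isT isT) e; rewrite -ea -eb e.
- apply/seteqP; split => [x [s /=]|x [t /=]]; rewrite in_itv /=.
    move=> hs <-; have [h _] := sgP hs; exists (sg s); first by rewrite /= in_itv.
    by rewrite /reparam clamp_id.
  move=> ht <-; exists (ell t); first by rewrite /= in_itv /= ell_in.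
  by rewrite /reparam clamp_id ?ell_in// sgK.
- move=> s t h1 h2 h3; rewrite -curve_length_reparam//; apply: curve_length_congr.
  move=> x y /andP[x1 x2] /andP[y1 y2].
  by rewrite /reparam !clamp_id ?(le_trans h1)//= (le_trans _ h3).
Qed.

Lemma reparam_lip s t : enorm (reparam s - reparam t) <= `|s - t|.
Proof.
have cl x := @clamp_in R l x (ltW l0).
have e x : reparam x = reparam (clamp l x) by rewrite /reparam (clamp_id (cl x)).
rewrite (e s) (e t); apply: (le_trans (param_lip reparam_arclength (cl s) (cl t))).
exact: clamp_lip.
Qed.

Lemma reparam_measurable : measurable_fun [set: measurableTypeR R] reparam.
Proof.
have h1 : continuous (fun s => (reparam s).1).
  by apply: lip_continuous => s t; rewrite -fstB; apply: le_trans (normr1_le_enorm _) (reparam_lip _ _).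
have h2 : continuous (fun s => (reparam s).2).
  by apply: lip_continuous => s t; rewrite -sndB; apply: le_trans (normr2_le_enorm _) (reparam_lip _ _).
apply/measurable_fun_pairP; split; exact: continuous_measurable_fun.
Qed.

End reparametrization.

(** * The boundary of a convex body has a parametrization by arclength *)

Section radial.
Variables (R : realType) (K : set (R * R)%type) (O : R * R).
Hypothesis bodyK : convex_body K.
Hypothesis KO : K° O.
Implicit Types (x y u v : R * R) (r s t : R).

Definition ray v t : R * R := (O.1 + t * v.1, O.2 + t * v.2).

Lemma rayB v s t : ray v s - ray v t = ((s - t) * v.1, (s - t) * v.2).
Proof. by apply: pair_ext; rewrite !pairE /=; ring. Qed.

Lemma body_bound : exists2 D, 0 < D & forall x, K x -> enorm (x - O) <= D.
Proof.
have [cK _ _] := bodyK.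
have K0 : K !=set0.
  by exists O; move/interior_enormP : KO => [r r0]; apply; rewrite subrr enorm0.
have b (n : R * R) : exists B, forall x, K x -> dotp (x - O) n <= B.
  have [a _ amax] := compact_EVT_max K0 cK (continuous_subspaceT (@continuous_dotpl R n)).
  by exists (dotp a n - dotp O n) => x Kx; rewrite dotpBl lerD2r amax// inE.
have [B1 h1] := b (1, 0); have [B2 h2] := b (-1, 0).
have [B3 h3] := b (0, 1); have [B4 h4] := b (0, -1).
exists (`|B1| + `|B2| + `|B3| + `|B4| + 1); first by rewrite ltr_wpDl// !addr_ge0.
move=> x Kx; apply: (le_trans (enorm_le_l1 _)).
move: (h1 x Kx) (h2 x Kx) (h3 x Kx) (h4 x Kx); rewrite /dotp /= => g1 g2 g3 g4.
have f1 := ler_norm B1; have f2 := ler_norm B2.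
have f3 := ler_norm B3; have f4 := ler_norm B4.
apply: (@le_trans _ _ (`|B1| + `|B2| + (`|B3| + `|B4|))); last lra.
by apply: lerD; rewrite ler_norml; apply/andP; split;
   have := normr_ge0 B1; have := normr_ge0 B2; have := normr_ge0 B3; have := normr_ge0 B4; lra.
Qed.

(** The radial function, the reciprocal of the gauge on unit vectors. *)
Definition rad v : R := sup [set t | 0 <= t /\ K (ray v t)].

Lemma body_inner : exists2 r, 0 < r & forall x, enorm (x - O) <= r -> K x.
Proof.
move/interior_enormP : KO => [r r0 h]; exists (r / 2); first by rewrite divr_gt0.
by move=> x hx; apply: h; apply: (le_lt_trans hx); lra.
Qed.

Lemma enorm_ray v t : enorm v = 1 -> enorm (ray v t - O) = `|t|.
Proof.
move=> v1; rewrite -[RHS]mulr1 -v1 -enormZ; congr enorm.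
by apply: pair_ext; rewrite !pairE /=; ring.
Qed.

Lemma rad_boundary v : enorm v = 1 -> 0 < rad v /\ boundary K (ray v (rad v)).
Proof.
move=> v1; have [D D0 hD] := body_bound; have [r r0 hr] := body_inner.
set S := [set t | 0 <= t /\ K (ray v t)].
have Sr : S r.
  by split; [exact: ltW|apply: hr; rewrite enorm_ray// gtr0_norm].
have Sup : ubound S D.
  by move=> t [t0 Kt]; have := hD _ Kt; rewrite enorm_ray// ger0_norm.
have hsS : has_sup S by split; [exists r|exists D].
have rr : r <= rad v by apply: sup_ubound => //; exact: hsS.2.
have rad0 : 0 < rad v := lt_le_trans r0 rr.
split => //; apply/(boundaryE bodyK); split.
  rewrite -(body_closed bodyK) => B /nbhs_ballP[e /= e0 hB].
  have [t [t0 Kt] ht] := sup_adherent e0 hsS.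
  have tr : t <= rad v by apply: sup_ubound => //; exact: hsS.2.
  exists (ray v t); split => //; apply: hB; apply: enorm_ball.
  rewrite rayB enormZ v1 mulr1 ler0_norm ?subr_le0// opprB.
  by rewrite ltrBlDr addrC -ltrBlDr.
move=> /interior_enormP[e e0 he].
have : S (rad v + e / 2).
  split; first by rewrite addr_ge0 ?ltW// divr_gt0.
  apply: he; rewrite rayB addrC addrA addNr add0r enormZ v1 mulr1 ger0_norm ?divr_ge0 ?ltW//.
  lra.
move/(sup_ubound hsS.2); rewrite -/(rad v); lra.
Qed.

Lemma ray_uniq v s t : 0 <= s -> 0 <= t -> boundary K (ray v s) -> boundary K (ray v t) -> s = t.
Proof.
have key a b : 0 <= a -> 0 <= b -> boundary K (ray v a) -> boundary K (ray v b) -> b <= a.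
  move=> a0 b0 Ba Bb; rewrite leNgt; apply/negP => ab.
  have b_gt0 : 0 < b := le_lt_trans a0 ab.
  have [Kb _] := (boundaryE bodyK _).1 Bb.
  have := @boundary_cone R K bodyK O (ray v b) (ray v b) (ray v a) (a / b) 0 KO Kb Kb Ba
    (divr_ge0 a0 b0) (lexx 0).
  rewrite /ray /= !addr0 !mul0r !addr0 => h.
  have : 1 <= a / b by apply: h; field; rewrite gt_eqF.
  by rewrite ler_pdivlMr// mul1r leNgt ab.
by move=> s0 t0 Bs Bt; apply/le_anti/andP; split; apply: key.
Qed.

(** The gauge is Lipschitz: apply [boundary_cone] to the boundary point in the
    direction [u], written as a combination of the one in the direction [v] and
    of a point of the inner disc in the direction [u - v]. *)
Lemma rad_inv_lip u v : enorm u = 1 -> enorm v = 1 ->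
  forall r, 0 < r -> (forall x, enorm (x - O) <= r -> K x) ->
  rad v - rad u <= rad u * rad v / r * enorm (u - v).
Proof.
move=> u1 v1 r r0 hr; have [pu Bu] := rad_boundary u1; have [pv Bv] := rad_boundary v1.
have [uv|uv] := eqVneq (enorm (u - v)) 0.
  by move/enorm_eq0/eqP: uv; rewrite subr_eq0 => /eqP ->; rewrite !subrr enorm0 mulr0.
have d0 : 0 < enorm (u - v) by rewrite lt_neqAle eq_sym uv enorm_ge0.
pose d := enorm (u - v); have d0' : 0 < d by [].
pose y : R * R := (O.1 + r / d * (u.1 - v.1), O.2 + r / d * (u.2 - v.2)).
have Ky : K y.
  apply: hr; have -> : y - O = (r / d * (u - v).1, r / d * (u - v).2).
    by apply: pair_ext; rewrite !pairE /=; ring.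
  by rewrite enormZ gtr0_norm ?divr_gt0// -/d divfK// gt_eqF.
have [Kv _] := (boundaryE bodyK _).1 Bv.
have h : 1 <= rad u / rad v + rad u * d / r.
  apply: (@boundary_cone R K bodyK O (ray v (rad v)) y (ray u (rad u))) => //.
  - by rewrite divr_ge0// ltW.
  - by rewrite divr_ge0 ?mulr_ge0// ltW.
  - by rewrite /ray /y /=; field; rewrite !gt_eqF.
  - by rewrite /ray /y /=; field; rewrite !gt_eqF.
rewrite -/d -(ler_pM2r pv) in h *.
have e : (rad u / rad v + rad u * d / r) * rad v = rad u + rad u * rad v / r * d.
  by field; rewrite !gt_eqF.
by rewrite e mul1r in h; rewrite lerBlDl.
Qed.

Definition unit_vec (w : R) : R * R := (cos w, sin w).

Lemma unit_vec1 w : enorm (unit_vec w) = 1.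
Proof. by rewrite /enorm /= cos2Dsin2 sqrtr1. Qed.

Lemma unit_vec_lip s t : enorm (unit_vec s - unit_vec t) <= 2 * `|s - t|.
Proof.
apply: (le_trans (enorm_le_l1 _)); rewrite !pairE /=.
by have := sin_lip s t; have := cos_lip s t; lra.
Qed.

(** [cos (t - s) = 1] forces [sin ((t - s) / 2) = 0]. *)
Lemma unit_vec_inj s t : 0 <= s < pi *+ 2 -> 0 <= t < pi *+ 2 -> unit_vec s = unit_vec t -> s = t.
Proof.
wlog st : s t / s <= t.
  move=> h hs ht e; have [st|/ltW ts] := leP s t; first exact: h.
  by apply/esym; apply: h.
move=> /andP[s0 sp] /andP[t0 tp] [ec es]; apply/eqP; rewrite eq_le st /= leNgt; apply/negP => lst.
have h0 : 0 < sin ((t - s) / 2) :> R.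
  apply: sin_gt0_pi; apply/andP; split; first by rewrite divr_gt0// subr_gt0.
  by rewrite ltr_pdivrMr// mulr_natr ltrBlDr ltr_wpDr.
have c1 : cos (t - s) = 1 by rewrite cosB ec es -!expr2 cos2Dsin2.
have e2 : ((t - s) / 2) *+ 2 = t - s by rewrite -[LHS]mulr_natr divfK.
have := cos_mulr2n ((t - s) / 2); rewrite e2 c1.
have := cos2Dsin2 ((t - s) / 2); have := exprn_gt0 2 h0; rewrite mulr2n => h1 h2 h3.
by move: h1 h2 h3; lra.
Qed.

Definition radial w : R * R := ray (unit_vec w) (rad (unit_vec w)).

Lemma radial_lip : exists M, forall s t, enorm (radial s - radial t) <= M * `|s - t|.
Proof.
have [D D0 hD] := body_bound; have [r r0 hr] := body_inner.
have bD w : rad (unit_vec w) <= D.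
  have [p0 B] := rad_boundary (unit_vec1 w).
  have := hD _ ((boundaryE bodyK _).1 B).1.
  by rewrite enorm_ray ?unit_vec1// gtr0_norm.
have p0 w : 0 < rad (unit_vec w) by have [] := rad_boundary (unit_vec1 w).
exists (D * D / r * 2 + D * 2) => s t.
set u := unit_vec s; set v := unit_vec t.
have uv : enorm (u - v) <= 2 * `|s - t| by exact: unit_vec_lip.
have DD : 0 <= D * D / r by rewrite divr_ge0 ?mulr_ge0 ?ltW.
have b a b : rad (unit_vec a) - rad (unit_vec b) <= D * D / r * enorm (unit_vec b - unit_vec a).
  apply: (le_trans (rad_inv_lip (unit_vec1 b) (unit_vec1 a) r0 hr)).
  apply: ler_wpM2r; first exact: enorm_ge0.
  by rewrite ler_pM2r ?invr_gt0//; apply: ler_pM; rewrite ?bD// ltW.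
have dr : `|rad u - rad v| <= D * D / r * enorm (u - v).
  by rewrite ler_norml lerNl opprB b /u (enormBC (unit_vec s)) b.
have -> : radial s - radial t = ((rad u - rad v) * u.1, (rad u - rad v) * u.2) +
    (rad v * (u - v).1, rad v * (u - v).2).
  by apply: pair_ext; rewrite !pairE /radial /ray -/u -/v /=; ring.
apply: (le_trans (enormD _ _)); rewrite !enormZ unit_vec1 mulr1 (gtr0_norm (p0 t)).
rewrite mulrDl -!mulrA; apply: lerD.
  by apply: (le_trans dr); rewrite mulrA [leRHS]mulrA ler_wpM2l.
by apply: ler_pM; rewrite ?enorm_ge0 ?bD// ltW.
Qed.

Lemma radial_inj : {in `[0, (pi *+ 2 : R)[ &, injective radial}.
Proof.
move=> s t; rewrite !in_itv /= => hs ht e; apply: unit_vec_inj => //.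
have [ps Bs] := rad_boundary (unit_vec1 s); have [pt Bt] := rad_boundary (unit_vec1 t).
have rr : rad (unit_vec s) = rad (unit_vec t).
  rewrite -(gtr0_norm ps) -(gtr0_norm pt) -(enorm_ray _ (unit_vec1 s)) -(enorm_ray _ (unit_vec1 t)).
  by rewrite -/(radial s) e.
move: e; rewrite /radial /ray -rr => -[/addrI e1 /addrI e2].
by apply: pair_ext; apply: (mulfI (lt0r_neq0 ps)).
Qed.

Lemma radial_onto : radial @` `[0, pi *+ 2] = boundary K.
Proof.
apply/seteqP; split => [x [w _ <-]|x Bx]; first by have [] := rad_boundary (unit_vec1 w).
have xO : x - O <> 0.
  move/eqP; rewrite subr_eq0 => /eqP xO; move: Bx.
  by rewrite xO => /(boundaryE bodyK)[_]; apply.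
have n0 := enorm_gt0 xO.
have [w /andP[w0 wp] wE] : exists2 w : R, 0 <= w < pi *+ 2 &
    ((enorm (x - O))^-1 * (x - O).1, (enorm (x - O))^-1 * (x - O).2) = (cos w, sin w).
  by apply: angle_exists; rewrite enormZ gtr0_norm ?invr_gt0// mulVf// gt_eqF.
exists w; first by rewrite /= in_itv /= w0 ltW.
have rE : ray (unit_vec w) (enorm (x - O)) = x.
  rewrite /ray /unit_vec -wE /= !mulrA mulfV ?gt_eqF// !mul1r.
  by apply: pair_ext => /=; rewrite addrC subrK.
have [p B] := rad_boundary (unit_vec1 w).
have -> : radial w = ray (unit_vec w) (enorm (x - O)); last exact: rE.
rewrite /radial; congr ray; apply: (@ray_uniq (unit_vec w)) => //; rewrite ?rE ?ltW//.
Qed.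

End radial.

Section arclength_exists.
Variable R : realType.
Implicit Types (K : set (R * R)%type).

Lemma body_arclength_param K : convex_body K ->
  exists l, exists g : {mfun measurableTypeR R >-> (R * R)%type},
    arclength_param (boundary K) l g.
Proof.
move=> bK; have [_ _ [ O KO]] := bK; have [M hM] := radial_lip bK KO.
have p0 : 0 < pi *+ 2 :> R by rewrite pmulrn_rgt0// pi_gt0.
have cl : radial K O 0 = radial K O (pi *+ 2).
  by rewrite /radial /unit_vec cos0 sin0 cos2pi sin2pi.
have A := reparam_arclength hM p0 cl (radial_inj bK KO).
have m := reparam_measurable hM p0 cl (radial_inj bK KO).
rewrite (radial_onto bK KO) in A.
exists (len (radial K O) 0 (pi *+ 2)).
exists (@mfun_Sub _ _ (measurableTypeR R) (R * R)%type _ (mem_set m)).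
exact: A.
Qed.

(** The default values in the definitions of the length and of the
    parametrization do not occur. *)
Lemma per_arc_param K : convex_body K ->
  arclength_param (boundary K) (per K) (arc_param (boundary K)).
Proof.
move=> bK; have [l [g P]] := body_arclength_param bK.
have [g' P'] : exists g' : {mfun measurableTypeR R >-> (R * R)%type},
    arclength_param (boundary K) (arclength (boundary K)) g'.
  by apply: (xgetPex 0 (P := [set l | exists g' : {mfun measurableTypeR R >-> (R * R)%type},
    arclength_param (boundary K) l g'])); exists l, g.
exact: (xgetPex _ (P := [set g : {mfun measurableTypeR R >-> (R * R)%type} |
  arclength_param (boundary K) (arclength (boundary K)) g]) (ex_intro _ g' P')).
Qed.

End arclength_exists.

(** * The mean distance as a double integral *)

Section arclength_integral.
Variables (R : realType) (K : set (R * R)%type).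
Hypothesis bodyK : convex_body K.
Local Notation l := (per K).
Local Notation g := (arc_param (boundary K)).
Local Notation P := (normalized_arclength (boundary K)).

Lemma per_gt0 : 0 < l.
Proof. by have [] := per_arc_param bodyK. Qed.

Lemma arclength_total : arclength_measure (boundary K) setT = l%:E.
Proof.
rewrite /arclength_measure /pushforward preimage_setT /mrestr setTI.
by rewrite /= lebesgue_measure_itv /= lte_fin -/(per K) per_gt0 -EFinB subr0.
Qed.

Lemma normalizedE A : P A = (l^-1%:E * arclength_measure (boundary K) A)%E.
Proof.
have tot := arclength_total; rewrite /normalized_arclength /= /mnormalize.

rewrite [X in fine X](_ : _ = l%:E); last exact: tot.
rewrite [X in X == 0%E](_ : _ = l%:E); last exact: tot.
rewrite [X in X == +oo%E](_ : _ = l%:E); last exact: tot.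
by rewrite eqe gt_eqF ?per_gt0//= muleC.
Qed.

(** Change of variables for the pushforward of Lebesgue measure on
    [[0, per K]]. *)
Lemma integral_arclength (f : R * R -> \bar R) :
  measurable_fun setT f -> (forall x, (0 <= f x)%E) ->
  (\int[P]_x f x = l^-1%:E * \int[@lebesgue_measure R]_(s in `[0%R, l]) f (g s))%E.
Proof.
move=> mf f0; have li0 : 0 <= l^-1 by rewrite invr_ge0 ltW// per_gt0.
rewrite (@eq_measure_integral _ _ _ setT (mscale (NngNum li0) (arclength_measure (boundary K)))); last first.
  by move=> A mA _; exact: normalizedE.
rewrite ge0_integral_mscale//; congr (_ * _)%E.
have mg : measurable_fun [set: measurableTypeR R] g by exact: measurable_funP.
rewrite ge0_integral_pushforward//=. rewrite preimage_setT.
have mfg : measurable_fun [set: measurableTypeR R] (f \o g) by exact: measurableT_comp.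
set D := [set` `[0, l]]; have mD : measurable (D : set (measurableTypeR R)) := measurable_itv _.
apply: etrans.
  apply: (@ge0_negligible_integral _ (measurableTypeR R) R _ setT (~` D)).
  - exact: measurableC.
  - exact: measurableT.
  - exact: mfg.
  - by move=> x _; exact: f0.
  - rewrite /mrestr /= -(measure0 (@lebesgue_measure R)); congr (lebesgue_measure _).
    exact: setICl.
rewrite setTD setCK; apply: eq_measure_integral => A mA AD.
by rewrite /mrestr; congr (lebesgue_measure _); apply/setIidl.
Qed.

Lemma measurable_enorm : measurable_fun setT (@enorm R).
Proof.
apply: (@measurableT_comp _ _ _ _ _ _ (@Num.sqrt R)).
  by apply: continuous_measurable_fun; exact: sqrt_continuous.
by apply: measurable_funD; apply: measurable_funX;
  [exact: measurable_fst|exact: measurable_snd].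
Qed.

Lemma measurable_dist : measurable_fun setT (fun z : (R * R) * (R * R) => enorm (z.1 - z.2)).
Proof.
apply: (@measurableT_comp _ _ _ _ _ _ (@enorm R)); first exact: measurable_enorm.
apply/measurable_fun_pairP; split.
  apply: (@measurable_funB _ _ _ _ (fun z : (R * R) * (R * R) => z.1.1) (fun z => z.2.1)).
    by apply: (measurableT_comp measurable_fst); exact: measurable_fst.
  by apply: (measurableT_comp measurable_fst); exact: measurable_snd.
apply: (@measurable_funB _ _ _ _ (fun z : (R * R) * (R * R) => z.1.2) (fun z => z.2.2)).
  by apply: (measurableT_comp measurable_snd); exact: measurable_fst.
by apply: (measurableT_comp measurable_snd); exact: measurable_snd.
Qed.

Variable G : R -> R * R.
Hypothesis LG : convex_loop l G.
Hypothesis GE : forall s t, 0 <= s <= l -> 0 <= t <= l -> enorm (G s - G t) = enorm (g s - g t).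

Definition mean_dist_from s := Int 0 l (fun t => enorm (G s - G t)).

Lemma loop_dist_le s t : enorm (G s - G t) <= l.
Proof.
have [t' /andP[h1 h2] <-] := loop_reduce LG s t; apply: (le_trans (loop_lip LG _ _)).
by rewrite distrC ger0_norm ?subr_ge0// lerBlDl ltW.
Qed.

Lemma bmeas_lip (L : R) (f : R -> R) : (forall s t, `|f s - f t| <= L * `|s - t|) ->
  (exists M, forall s, `|f s| <= M) -> bmeas f.
Proof.
move=> h hM; split => //; apply: continuous_measurable_fun => x.
have L0 : 0 <= L.
  by have := h 1 0; rewrite subr0 normr1 mulr1; apply: le_trans.
apply/cvgrPdist_le => e e0; near=> y.
apply: (le_trans (h _ _)); apply: (@le_trans _ _ ((L + 1) * `|x - y|)).
  by rewrite ler_wpM2r// lerDl.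
rewrite mulrC -ler_pdivlMr ?ltr_wpDl//; near: y; apply: cvgr_dist_le => //.
by rewrite divr_gt0// ltr_wpDl.
Unshelve. all: by end_near. Qed.

Lemma dist_lip s t t' : `|enorm (G s - G t) - enorm (G s - G t')| <= 1 * `|t - t'|.
Proof.
rewrite mul1r; apply: le_trans (loop_lip LG t t').
have h1 := enorm_triangle (G s) (G t) (G t'); have h2 := enorm_triangle (G s) (G t') (G t).
by rewrite (enormBC (G t')) in h2; rewrite ler_norml; apply/andP; split; lra.
Qed.

Lemma bmeas_dist s : bmeas (fun t => enorm (G s - G t)).
Proof.
apply: (bmeas_lip (dist_lip s)); exists l => t.
by rewrite ger0_norm ?enorm_ge0// loop_dist_le.
Qed.

Lemma mean_dist_lip s t : `|mean_dist_from s - mean_dist_from t| <= l * `|s - t|.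
Proof.
have l0 := per_gt0.
rewrite /mean_dist_from -IntB; [|exact: bmeas_dist..].
have b (r : R) : bmeas (fun=> r) by exact: bmeas_cst.
have bB := bmeasB (bmeas_dist s) (bmeas_dist t).
have e r : Int 0 l (fun=> r) = l * r by rewrite Int_cst ?subr0 1?mulrC// ltW.
have d x : `|enorm (G s - G x) - enorm (G t - G x)| <= `|s - t|.
  by have := dist_lip x s t; rewrite mul1r !(enormBC (G x)).
rewrite ler_norml -mulrN -!e; apply/andP; split; apply: le_Int => // x _;
  by have := d x; rewrite ler_norml => /andP[].
Qed.

Lemma bmeas_mean_dist : bmeas mean_dist_from.
Proof.
apply: (bmeas_lip mean_dist_lip); exists (l * l) => s.
have l0 := per_gt0.
rewrite ger0_norm; last by apply: Int_ge0 => t; exact: enorm_ge0.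
have -> : l * l = Int 0 l (fun=> l) by rewrite Int_cst ?subr0// ltW.
apply: le_Int => [||t _]; [exact: bmeas_dist|exact: bmeas_cst|exact: loop_dist_le].
Qed.

Lemma integral_Int (f : R -> R) : bmeas f ->
  (\int[@lebesgue_measure R]_(s in `[0%R, l]) (f s)%:E = (Int 0 l f)%:E)%E.
Proof.
move=> bf; rewrite /Int /Rintegral fineK//.
by apply: integrable_fin_num => //; exact: bmeas_integrable.
Qed.

(** Tonelli's theorem; the integrand only depends on distances, so that the
    parametrization may be replaced by an isometric convex loop. *)
Lemma theta_integral : theta K = (l^-1 * (l^-1 * Int 0 l mean_dist_from))%:E.
Proof.
rewrite /theta unlock.
pose f z : \bar R := (enorm (z.1 - z.2 : R * R))%:E.
have mf : measurable_fun setT f by apply/measurable_EFinP; exact: measurable_dist.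
have f0 z : (0 <= f z)%E by rewrite lee_fin enorm_ge0.
rewrite (@fubini_tonelli1 _ _ _ _ _ P P f mf f0).
have inner s : 0 <= s <= l -> fubini_F P f (g s) = (l^-1 * mean_dist_from s)%:E.
  move=> hs; rewrite /fubini_F integral_arclength//; last by exact: measurableT_comp.
  rewrite EFinM; congr (_ * _)%E; rewrite -integral_Int; last exact: bmeas_dist.
  by apply: eq_integral => t; rewrite inE /= in_itv /= => ht; rewrite /f /= GE.
rewrite integral_arclength; first last.
- by move=> x; apply: integral_ge0 => y _; exact: f0.
- exact: measurable_fun_fubini_tonelli_F.
rewrite EFinM; congr (_ * _)%E; rewrite -IntZ; last exact: bmeas_mean_dist.
rewrite -integral_Int.
  by apply: eq_integral => s; rewrite inE /= in_itv /= => hs; rewrite inner.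
by apply: bmeasM; [exact: bmeas_cst|exact: bmeas_mean_dist].
Qed.

(** On each cell a Lipschitz function differs from its value at the left end by at
    most [L] times the mesh. *)
Lemma riemann_sum (L : R) (f : R -> R) (N : nat) : (0 < N)%N -> bmeas f -> 0 <= L ->
  (forall s t, `|f s - f t| <= L * `|s - t|) ->
  `|Int 0 l f - l / N%:R * \sum_(0 <= i < N) f (i%:R * (l / N%:R))| <= L * (l / N%:R) * l.
Proof.
move=> N0 bf L0 h; have n0 : 0 < N%:R :> R by rewrite ltr0n.
have l0 := per_gt0.
have [d dE] : exists d, d = l / N%:R by eexists.
have d0 : 0 < d by rewrite dE divr_gt0.
have key k : `|Int 0 (k%:R * d) f - d * \sum_(0 <= i < k) f (i%:R * d)| <= k%:R * (L * d * d).
  elim: k => [|k ih].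
    rewrite !mul0r big_geq// mulr0 subr0 /Int set_itv1 Rintegral_set1 normr0//.
  have k0 : 0 <= k%:R * d by rewrite mulr_ge0 ?ler0n ?(ltW d0).
  have kk : k%:R * d <= k.+1%:R * d by rewrite ler_pM2r// ler_nat.
  have kd : k.+1%:R * d - k%:R * d = d by rewrite -(natr1 k); ring.
  rewrite (Int_split bf k0 kk) big_nat_recr//= mulrDr opprD addrACA.
  apply: (le_trans (ler_normD _ _)); rewrite -[in leRHS](natr1 k) mulrDl mul1r; apply: lerD => //.
  have b (r : R) : bmeas (fun=> r) by exact: bmeas_cst.
  have e r : Int (k%:R * d) (k.+1%:R * d) (fun=> r) = d * r.
    by rewrite Int_cst// kd mulrC.
  rewrite -e -IntB// (mulrC (L * d)) ler_norml -mulrN -!e.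
  have bB := bmeasB bf (b (f (k%:R * d))).
  have hx x : k%:R * d <= x <= k.+1%:R * d -> `|f x - f (k%:R * d)| <= L * d.
    move=> /andP[x1 x2]; apply: (le_trans (h _ _)); apply: ler_wpM2l => //.
    by rewrite ger0_norm ?subr_ge0//; rewrite lerBlDr; apply: (le_trans x2); rewrite -lerBlDr kd.
  by apply/andP; split; apply: le_Int => // x /hx; rewrite ler_norml => /andP[].
have NE : N%:R * d = l by rewrite dE mulrC divfK ?gt_eqF.
have := key N; rewrite -dE NE => /le_trans; apply.
have -> : N%:R * (L * d * d) = L * d * (N%:R * d) by ring.
by rewrite NE.
Qed.

Lemma double_riemann_sum (N : nat) : (0 < N)%N ->
  `|Int 0 l mean_dist_from - (l / N%:R) ^+ 2 *
     \sum_(0 <= i < N) \sum_(0 <= j < N) enorm (grid l G N i - grid l G N j)|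
  <= 2 * l ^+ 2 * (l / N%:R).
Proof.
move=> N0; have l0 := per_gt0; have n0 : 0 < N%:R :> R by rewrite ltr0n.
have h1 := riemann_sum N0 bmeas_mean_dist (ltW l0) mean_dist_lip.
have h2 i : `|mean_dist_from (i%:R * (l / N%:R)) - l / N%:R *
   \sum_(0 <= j < N) enorm (grid l G N i - grid l G N j)| <= l / N%:R * l.
  by have := riemann_sum N0 (bmeas_dist (i%:R * (l / N%:R))) ler01 (dist_lip _); rewrite mul1r.
have [d dE] : exists d, d = l / N%:R by eexists.
have d0 : 0 <= d by rewrite dE divr_ge0// ltW.
have Nd : d * N%:R = l by rewrite dE divfK ?gt_eqF.
have h3 : `|d * \sum_(0 <= i < N) mean_dist_from (i%:R * (l / N%:R)) -
   d ^+ 2 * \sum_(0 <= i < N) \sum_(0 <= j < N) enorm (grid l G N i - grid l G N j)| <= l * (d * l).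
  have -> : l * (d * l) = d * (N%:R * (d * l)) by rewrite -{1}Nd; ring.
  rewrite expr2 -mulrA -mulrBr mulr_sumr -sumrB normrM (ger0_norm d0).
  apply: ler_wpM2l => //; apply: (le_trans (ler_norm_sum _ _ _)).
  have -> : N%:R * (d * l) = \sum_(0 <= i < N) d * l.
    by rewrite sumr_const_nat subn0 mulr_natl.
  by apply: ler_sum => i _; rewrite dE; exact: h2.
rewrite -dE in h1 *; apply: (le_trans (ler_distD (d * \sum_(0 <= i < N) mean_dist_from (i%:R * d)) _ _)).
rewrite -dE in h3.
apply: (le_trans (lerD h1 h3)); rewrite le_eqVlt; apply/orP; left; apply/eqP; ring.
Qed.

End arclength_integral.

Section lower_bound.
Variables (R : realType) (K : set (R * R)%type).
Hypothesis bodyK : convex_body K.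

(** The gain in [loop_sum_gt] does not depend on the mesh, whereas the error of
    the Riemann sums tends to zero. *)
Lemma theta_gt : ((per K / 6)%:E < theta K)%E.
Proof.
have P := per_arc_param bodyK; have l0 := per_gt0 bodyK.
have [G [LG rect GE _]] := boundary_loop bodyK P.
rewrite (theta_integral bodyK LG GE) lte_fin mulrA -invfM -expr2 -ltr_pdivrMl ?invr_gt0 ?exprn_gt0//.
rewrite invrK.
have [e e0 [N0 h]] := loop_sum_gt LG rect.
have [M hM] := nat_above (2 * per K / e).
pose N := (N0 + M.+2)%N; have hS := h N (leq_addr _ _).
have N1 : (M.+2 <= N)%N by exact: leq_addl.
have Ngt : (0 < N)%N := ltnW (gt1_of_ge N1).
have hT := double_riemann_sum bodyK LG Ngt.
have hMN := lt_le_trans hM (natr_le_of_ge2 R N1).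
have n0 : 0 < N%:R :> R by rewrite ltr0n.
rewrite ltr_pdivrMr// in hMN.
set T := Int _ _ _ in hT *; set S := \sum_(0 <= i < N) _ in hT hS.
rewrite ler_norml in hT; case/andP: hT => hT _.
have h1 : (per K / N%:R) ^+ 2 * (N%:R ^+ 2 * (per K / 6 + e)) <= (per K / N%:R) ^+ 2 * S.
  by apply: ler_wpM2l; [exact: sqr_ge0|exact: hS].
have e1 : (per K / N%:R) ^+ 2 * (N%:R ^+ 2 * (per K / 6 + e)) = per K ^+ 2 * (per K / 6 + e).
  by field; rewrite gt_eqF.
have h2 : 2 * per K ^+ 2 * (per K / N%:R) < per K ^+ 2 * e.
  have -> : 2 * per K ^+ 2 * (per K / N%:R) = per K ^+ 2 * (2 * per K / N%:R) by ring.
  by rewrite ltr_pM2l ?exprn_gt0// ltr_pdivrMr// [ltRHS]mulrC.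
rewrite e1 in h1; clearbody S T; move: h1 h2 hT; clear; lra.
Qed.

End lower_bound.

(** * Sums of distances on a folded interval *)

Section folded_sums.
Variable R : realType.
Implicit Types (n N : nat) (F : nat -> R).

(** [minn m (n.*2 - m)] is the distance from 0 on a cycle of length [2 n]; it takes
    every value at most twice. *)
Lemma sum_fold n F : (forall a, 0 <= F a) ->
  \sum_(0 <= m < n.*2) F (minn m (n.*2 - m)) <= 2 * \sum_(0 <= a < n.+1) F a.
Proof.
move=> F0; have nn : (n <= n.*2)%N by rewrite -addnn leq_addr.
rewrite (big_cat_nat (leq0n n) nn)/= mulr2n mulrDl mul1r; apply: lerD.
  rewrite big_nat_recr//= -[leLHS]addr0; apply: lerD => //.
  apply: ler_sum_nat => m /andP[_ mn]; rewrite (_ : minn _ _ = m)//; lia.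
rewrite -{1}[n]add0n big_addn (_ : n.*2 - n = n)%N; last by lia.
rewrite big_nat_rev big_nat_recl//= -[leLHS]add0r; apply: lerD => //.
apply: ler_sum_nat => m /andP[_ mn]; rewrite (_ : minn _ _ = m.+1)//; lia.
Qed.

Lemma sum_ramp n : \sum_(0 <= a < n.+1) (n.+1%:R - a%:R) = n.+1%:R * n.+2%:R / 2 :> R.
Proof.
elim: n => [|n ih]; first by rewrite big_nat1; field.
rewrite big_nat_recl//= subr0.
rewrite (eq_bigr (fun a => n.+1%:R - a%:R : R)); last first.
  by move=> a _; rewrite -(natr1 a) -(natr1 n.+1); ring.
by rewrite ih -(natr1 n.+2) -(natr1 n.+1); field.
Qed.

Lemma sum_absdiff n :
  \sum_(0 <= a < n.+1) \sum_(0 <= b < n.+1) `|a%:R - b%:R| = n%:R * n.+1%:R * n.+2%:R / 3 :> R.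
Proof.
elim: n => [|n ih]; first by rewrite !big_nat1 subrr normr0 !mul0r.
rewrite big_nat_recr//=.
under eq_bigr do rewrite big_nat_recr//=.
rewrite big_split /= ih [X in _ + X]big_nat_recr//= subrr normr0 addr0.
have e1 : \sum_(0 <= i < n.+1) `|i%:R - n.+1%:R| = n.+1%:R * n.+2%:R / 2 :> R.
  rewrite -sum_ramp; apply: eq_big_nat => i /andP[_ h].
  by rewrite distrC ger0_norm// subr_ge0 ler_nat ltnW.
have e2 : \sum_(0 <= i < n.+1) `|n.+1%:R - i%:R| = n.+1%:R * n.+2%:R / 2 :> R.
  by rewrite -e1; apply: eq_bigr => i _; rewrite distrC.
by rewrite e1 e2 -(natr1 n.+2) -(natr1 n.+1) -(natr1 n); field.
Qed.

Lemma sum_fold_absdiff n (D := fun m : nat => (minn m (n.*2 - m))%:R : R) :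
  \sum_(0 <= i < n.*2) \sum_(0 <= j < n.*2) `|D i - D j| <= 4 * (n%:R * n.+1%:R * n.+2%:R / 3).
Proof.
rewrite -sum_absdiff.
apply: (@le_trans _ _ (\sum_(0 <= i < n.*2) 2 * \sum_(0 <= b < n.+1) `|D i - b%:R|)).
  by apply: ler_sum => i _; apply: (@sum_fold n (fun b => `|D i - b%:R|)).
rewrite -mulr_sumr.
have := @sum_fold n (fun a => \sum_(0 <= b < n.+1) `|a%:R - b%:R|).
move=> /(_ (fun a => sumr_ge0 _ (fun b _ => normr_ge0 _))) h.
by rewrite /D; move: h; lra.
Qed.

End folded_sums.

(** * The length of a convex loop in terms of its width and height *)
Section loop_length.
Variables (R : realType) (l : R) (G : R -> R * R).
Hypothesis LG : convex_loop l G.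
Implicit Types (s t : R) (u : R * R).

Lemma len_control (c : R -> R * R) (M : R) (f : R -> R) (a b : R) :
  (forall s t, enorm (c s - c t) <= M * `|s - t|) -> a <= b ->
  (forall s t, a <= s -> s <= t -> t <= b -> enorm (c t - c s) <= f t - f s) ->
  len c a b <= f b - f a.
Proof.
move=> clip ab h; apply: (len_lub clip ab) => w [].
have : a <= a by []. 
suff key x : a <= x -> path <%O x w -> last x w = b -> chords c b x w <= f b - f x by exact: key.
elim: w x => [|t w ih] x ax /=; first by move=> _ ->; rewrite chords_nil subrr.
move=> /andP[xt pw] lst; rewrite chords_cons.
have tb : t <= b.
  rewrite -lst; clear -pw; elim: w t pw => //= y w ih t /andP[ty pw].
  exact: le_trans (ltW ty) (ih _ pw).
have h1 := h x t ax (ltW xt) tb; have h2 := ih t (le_trans ax (ltW xt)) pw lst.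
by move: h1 h2; lra.
Qed.

(** A lowest point can be chosen in the first period. *)
Lemma loop_updown_base u : u <> 0 -> exists A B, [/\ 0 <= A <= l,
  (A < B < A + l /\ dotp (G A) u < dotp (G B) u),
  forall s, dotp (G A) u <= dotp (G s) u <= dotp (G B) u,
  forall s t, A <= s -> s <= t -> t <= B -> dotp (G s) u <= dotp (G t) u &
  forall s t, B <= s -> s <= t -> t <= A + l -> dotp (G t) u <= dotp (G s) u].
Proof.
move=> u0; have l0 := loop_gt0 LG.
have [A [B [A0 [/andP[AB BA] AB'] rng up dn]]] := loop_updown LG u0.
have [n /andP[n1 n2]] := nat_floor (divr_ge0 A0 (ltW l0)).
rewrite ler_pdivlMr// in n1; rewrite ltr_pdivrMr// -(natr1 n) mulrDl mul1r in n2.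
have sh s : G (s - n%:R * l) = G s by rewrite -[in RHS](subrK (n%:R * l) s) (loop_period_nat LG).
have sh' s : G s = G (s + n%:R * l) by rewrite (loop_period_nat LG).
exists (A - n%:R * l), (B - n%:R * l); rewrite !sh; split => //.
- by apply/andP; split; [rewrite subr_ge0|rewrite lerBlDl; exact: ltW].
- by split => //; rewrite ltrD2r AB /= addrAC ltrD2r.
- move=> s t h1 h2 h3; rewrite (sh' s) (sh' t); apply: up; first by rewrite -lerBlDr.
    by rewrite lerD2r.
  by rewrite -lerBrDr.
- move=> s t h1 h2 h3; rewrite (sh' s) (sh' t); apply: dn; first by rewrite -lerBlDr.
    by rewrite lerD2r.
  by rewrite -lerBrDr addrAC.
Qed.

(** The projection of the loop to a line, as a curve in the plane, so that
    additivity of length applies to it. *)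
Definition shadow u s : R * R := (dotp (G s) u, 0).

Lemma enorm_shadow u s t : enorm (shadow u s - shadow u t) = `|dotp (G s) u - dotp (G t) u|.
Proof. by rewrite /enorm /= subrr [0 ^+ 2]expr0n /= addr0 sqrtr_sqr. Qed.

Lemma shadow_lip u s t : enorm (shadow u s - shadow u t) <= enorm u * `|s - t|.
Proof.
rewrite enorm_shadow -dotpBl; apply: (le_trans (normr_dotp_le _ _)).
by rewrite mulrC ler_wpM2l ?enorm_ge0// (loop_lip LG).
Qed.

(** The fundamental period consists of three arcs on which the height is
    monotone; whether the highest point comes before the end of the period decides
    which of them rise. *)
Lemma shadow_length u w : u <> 0 ->
  (forall s t, dotp (G s) u - dotp (G t) u <= w) -> len (shadow u) 0 l <= 2 * w.
Proof.
move=> u0 hw; have l0 := loop_gt0 LG; have lip := shadow_lip u.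
have [A [B [/andP[A0 Al] [/andP[AB BA] _] _ up dn]]] := loop_updown_base u0.
pose h s := dotp (G s) u.
have hl s : h (s + l) = h s by rewrite /h (loop_period LG).
have incr a b : a <= b -> (forall s t, a <= s -> s <= t -> t <= b -> h s <= h t) ->
    len (shadow u) a b <= h b - h a.
  move=> ab m; apply: (len_control lip ab) => s t h1 h2 h3.
  by rewrite enorm_shadow ger0_norm// subr_ge0; exact: m.
have decr a b : a <= b -> (forall s t, a <= s -> s <= t -> t <= b -> h t <= h s) ->
    len (shadow u) a b <= h a - h b.
  move=> ab m.
  have -> : h a - h b = (fun s => - h s) b - (fun s => - h s) a by rewrite opprK addrC.
  apply: (@len_control _ _ (fun s => - h s) _ _ lip ab) => s t h1 h2 h3.
  have ht := m s t h1 h2 h3; rewrite enorm_shadow ler0_norm ?subr_le0//.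
  by rewrite opprB opprK [leRHS]addrC.
have h0l : h 0 = h l by rewrite -(hl 0) add0r.
have hAB := hw B A; rewrite -/(h B) -/(h A) in hAB.
have Al' : A <= A + l by rewrite lerDl ltW.
have lAl : l <= A + l by rewrite lerDr.
have [Bl|lB] := leP B l.
  rewrite (len_add lip A0 Al) (len_add lip (ltW AB) Bl).
  have i1 : len (shadow u) 0 A <= h 0 - h A.
    apply: decr => // s t s0 st tA; rewrite -(hl s) -(hl t); apply: dn.
    - by apply: (le_trans Bl); rewrite lerDr.
    - by rewrite lerD2r.
    - by rewrite lerD2r.
  have i2 := incr _ _ (ltW AB) up.
  have i3 : len (shadow u) B l <= h B - h l.
    by apply: decr => // s t s0 st tA; apply: dn => //; exact: le_trans lAl.
  by move: i1 i2 i3 hAB h0l; lra.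
have B0 : 0 <= B - l by rewrite subr_ge0 ltW.
have BlA : B - l <= A by rewrite lerBlDr ltW.
rewrite (len_add lip B0 (le_trans BlA Al)) (len_add lip BlA Al).
have hBl : h (B - l) = h B by rewrite -(hl (B - l)) subrK.
have i1 : len (shadow u) 0 (B - l) <= h (B - l) - h 0.
  apply: incr => // s t s0 st tB; rewrite -(hl s) -(hl t); apply: up.
  - by apply: (le_trans Al); rewrite lerDr.
  - by rewrite lerD2r.
  - by rewrite -lerBrDr.
have i2 : len (shadow u) (B - l) A <= h (B - l) - h A.
  apply: decr => // s t s0 st tB; rewrite -(hl s) -(hl t); apply: dn.
  - by rewrite -lerBlDr.
  - by rewrite lerD2r.
  - by rewrite lerD2r.
have i3 : len (shadow u) A l <= h l - h A.
  by apply: incr => // s t s0 st tB; apply: up => //; apply: (le_trans tB); exact: ltW.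
by move: i1 i2 i3 hAB h0l hBl; lra.
Qed.

(** Chords are not longer than the sums of their two projections, and each
    projection runs through its range twice. *)
Lemma loop_length_le w1 w2 : curve_length G 0 l = l%:E ->
  (forall s t, (G s).1 - (G t).1 <= w1) -> (forall s t, (G s).2 - (G t).2 <= w2) ->
  l <= 2 * w1 + 2 * w2.
Proof.
move=> cl h1 h2; have l0 := loop_gt0 LG.
have lip s t : enorm (G s - G t) <= 1 * `|s - t| by rewrite mul1r (loop_lip LG).
have e1 : (1, 0) <> 0 :> R * R by move=> -[] /eqP; rewrite oner_eq0.
have e2 : (0, 1) <> 0 :> R * R by move=> -[] /eqP; rewrite oner_eq0.
have d1 s : dotp (G s) (1, 0) = (G s).1 by rewrite /dotp /= mulr1 mulr0 addr0.
have d2 s : dotp (G s) (0, 1) = (G s).2 by rewrite /dotp /= mulr1 mulr0 add0r.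
have s1 : len (shadow (1, 0)) 0 l <= 2 * w1 by apply: shadow_length => // s t; rewrite !d1.
have s2 : len (shadow (0, 1)) 0 l <= 2 * w2 by apply: shadow_length => // s t; rewrite !d2.
have -> : l = len G 0 l by rewrite /len cl.
apply: (le_trans _ (lerD s1 s2)); apply: (len_lub lip (ltW l0)) => w pw.
have p1 := len_ub (shadow_lip (1, 0)) l pw; have p2 := len_ub (shadow_lip (0, 1)) l pw.
apply: (le_trans _ (lerD p1 p2)).
suff key x : chords G l x w <= chords (shadow (1, 0)) l x w + chords (shadow (0, 1)) l x w.
  exact: key.
elim: w x {pw p1 p2} => [|t w ih] x; first by rewrite !chords_nil addr0.
rewrite !chords_cons addrACA; apply: lerD => //.
by rewrite !enorm_shadow !d1 !d2; exact: enorm_le_l1.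
Qed.

End loop_length.

(** * Thin rectangles *)

Section rectangles.
Variable R : realType.
Implicit Types (h s t : R).

Definition rect h : set (R * R)%type := [set x | 0 <= x.1 <= 1 /\ 0 <= x.2 <= h].

Lemma rect_body h : 0 < h -> convex_body (rect h).
Proof.
move=> h0; split.
- have -> : rect h = [set` `[0, 1]] `*` [set` `[0, h]].
    by apply/seteqP; split => x /=; rewrite !in_itv.
  by apply: compact_setX; exact: segment_compact.
- move=> x y t; rewrite !inE /rect /= => -[/andP[a1 a2] /andP[a3 a4]] [/andP[b1 b2] /andP[b3 b4]].
  have t0 : 0 <= t%:num by []. have t1 : t%:num <= 1 by [].
  have c (p q M : R) : 0 <= p -> p <= M -> 0 <= q -> q <= M ->
      0 <= t%:num * p + (1 - t%:num) * q <= M.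
    move=> p0 pM q0 qM; have u0 : 0 <= 1 - t%:num by rewrite subr_ge0.
    rewrite addr_ge0 ?mulr_ge0//=.
    have -> : M = t%:num * M + (1 - t%:num) * M by ring.
    by apply: lerD; exact: ler_wpM2l.
  by split; exact: c.
- exists (1 / 2, h / 2); apply/interior_enormP.
  exists (Num.min (1 / 2) (h / 2)); first by rewrite lt_min !divr_gt0.
  move=> y hy; have := le_lt_trans (normr1_le_enorm _) hy; have := le_lt_trans (normr2_le_enorm _) hy.
  rewrite !pairE /= !lt_min !ltr_norml => /andP[_ /andP[? ?]] /andP[/andP[? ?] _].
  by split; apply/andP; split; lra.
Qed.

Lemma rect_corner h (x : R) : 0 < h -> 0 <= x <= 1 -> boundary (rect h) (x, 0).
Proof.
move=> h0 hx; apply/(boundaryE (rect_body h0)); split; first by split => //=; rewrite lexx ltW.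
move/interior_enormP => [r r0 hr]; have : rect h (x, - (r / 2)).
  apply: hr; have -> : (x, - (r / 2)) - (x, 0) = (0, - (r / 2)) :> R * R.
    by apply: pair_ext; rewrite !pairE /= ?subrr ?subr0.
  rewrite /enorm /= expr0n add0r sqrtr_sqr normrN gtr0_norm ?divr_gt0//; lra.
by move=> [_ /= /andP[]]; lra.
Qed.

Section rect_loop.
Variables (h : R).
Hypothesis h0 : 0 < h.
Local Notation l := (per (rect h)).
Local Notation g := (arc_param (boundary (rect h))).

Let P := per_arc_param (rect_body h0).
Let l0 : 0 < l. Proof. by have [] := P. Qed.

Lemma rect_range s : 0 <= s <= l -> 0 <= (g s).1 <= 1 /\ 0 <= (g s).2 <= h.
Proof.
move=> hs; have [_ _ _ gB _] := P.
have : (g @` [set` `[0, l]]) (g s) by exists s; rewrite //= in_itv.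
by rewrite gB; move/(boundaryE (rect_body h0)) => [].
Qed.

Variables (G : R -> R * R) (o : R).
Hypothesis LG : convex_loop l G.
Hypothesis GE : forall s t, 0 <= s <= l -> 0 <= t <= l -> enorm (G s - G t) = enorm (g s - g t).
Hypothesis G1 : forall s, 0 <= s <= l -> (G s).1 = (g s).1 - o.

Let reduce s : exists2 t, 0 <= t <= l & G t = G s.
Proof.
have [t /andP[t0 tl] e] := loop_reduce LG 0 s; exists t => //.
by rewrite t0 ltW//; rewrite add0r in tl.
Qed.

Lemma rect_width s : - o <= (G s).1 <= 1 - o.
Proof.
have [t ht <-] := reduce s; rewrite (G1 ht).
have [/andP[a b] _] := rect_range ht; apply/andP; split; lra.
Qed.

Lemma rect_dist s t : enorm (G s - G t) <= `|(G s).1 - (G t).1| + h.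
Proof.
have [s' hs <-] := reduce s; have [t' ht <-] := reduce t.
rewrite GE// (G1 hs) (G1 ht); apply: (le_trans (enorm_le_l1 _)); rewrite !pairE.
have -> : (g s').1 - o - ((g t').1 - o) = (g s').1 - (g t').1 by ring.
rewrite lerD2l ler_norml.
have [_ /andP[a b]] := rect_range hs; have [_ /andP[c d]] := rect_range ht.
apply/andP; split; lra.
Qed.

(** The loop is isometric to the boundary and has the same first coordinates, so
    that second coordinates agree up to sign and translation. *)
Lemma rect_height s t : (G s).2 - (G t).2 <= h.
Proof.
apply: (le_trans (ler_norm _)).
have [s' hs <-] := reduce s; have [t' ht <-] := reduce t.
have e : ((G s').2 - (G t').2) ^+ 2 = ((g s').2 - (g t').2) ^+ 2.
  have := congr1 (fun x => x ^+ 2) (GE hs ht); rewrite !enorm_sq /dotp !pairE (G1 hs) (G1 ht).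
  have -> : (g s').1 - o - ((g t').1 - o) = (g s').1 - (g t').1 by ring.
  by rewrite -!expr2 => /addrI.
rewrite -sqrtr_sqr e sqrtr_sqr ler_norml.
have [_ /andP[a b]] := rect_range hs; have [_ /andP[c d]] := rect_range ht.
apply/andP; split; lra.
Qed.

Lemma rect_per_le : l <= 2 + 2 * h.
Proof.
have -> : 2 + 2 * h = 2 * 1 + 2 * h by rewrite mulr1.
apply: (loop_length_le LG); last exact: rect_height.
  have [_ _ _ _ len] := P.
  by rewrite (curve_length_congr GE) len ?subr0// ltW.
move=> s t; have /andP[a b] := rect_width s; have /andP[c d] := rect_width t; lra.
Qed.

Lemma rect_corner_param x : 0 <= x <= 1 -> exists s, (G s).1 = x - o.
Proof.
move=> hx; have [_ _ _ gB _] := P; have := rect_corner h0 hx.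
rewrite -gB => -[s /=]; rewrite in_itv /= => hs e.
by exists s; rewrite (G1 hs) e.
Qed.

(** The leftmost and the rightmost point are at distance 1 and the perimeter is at
    most [2 + 2 h]; hence both arcs between them have length between 1 and
    [1 + 2 h], and the abscissa, whose speed is at most one, has to follow the
    distance to the leftmost point along the boundary up to [2 h]. *)
Lemma rect_fold : exists A, [/\ 0 <= A, 2 <= l & forall s, A <= s <= A + l ->
  Num.min (s - A) (A + l - s) - 2 * h <= (G s).1 - (G A).1 <= Num.min (s - A) (A + l - s)].
Proof.
have e1 : (1, 0) <> 0 :> R * R by move=> -[] /eqP; rewrite oner_eq0.
have [A [B [/andP[A0 _] [/andP[AB BA] _] rng _ _]]] := loop_updown_base LG e1.
have d1 s : dotp (G s) (1, 0) = (G s).1 by rewrite /dotp /= mulr1 mulr0 addr0.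
have GA : (G A).1 = - o.
  have [|s es] := @rect_corner_param 0; first by rewrite lexx ler01.
  have := rng s; rewrite !d1 es sub0r => /andP[a _]; apply/le_anti; rewrite a.
  by case/andP: (rect_width A).
have GB : (G B).1 = 1 - o.
  have [|s es] := @rect_corner_param 1; first by rewrite lexx ler01.
  have := rng s; rewrite !d1 es => /andP[_ a]; apply/le_anti; rewrite a andbT.
  by case/andP: (rect_width B).
have lip s t : s <= t -> `|(G s).1 - (G t).1| <= t - s.
  move=> st; rewrite -fstB; apply: (le_trans (normr1_le_enorm _)).
  by apply: (le_trans (loop_lip LG _ _)); rewrite distrC ger0_norm// subr_ge0.
have GAl : (G (A + l)).1 = - o by rewrite (loop_period LG).
have := lip _ _ (ltW AB); have := lip _ _ (ltW BA); rewrite GA GB GAl.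
rewrite !ler_norml => /andP[p1 p2] /andP[q1 q2]; have lh := rect_per_le.
exists A; split => //; first by move: p1 p2 q1 q2; lra.
move=> s /andP[As sA]; rewrite GA opprK le_min.
have := lip _ _ As; have := lip _ _ sA; rewrite GA GAl !ler_norml => /andP[u1 u2] /andP[v1 v2].
have low : Num.min (s - A) (A + l - s) - 2 * h <= (G s).1 + o.
  rewrite lerBlDr ge_min; have [sB|Bs] := leP s B.
    have := lip _ _ sB; rewrite GB ler_norml => /andP[w1 w2].
    by apply/orP; left; move: w1 w2 p1 p2 lh; lra.
  have := lip _ _ (ltW Bs); rewrite GB ler_norml => /andP[w1 w2].
  by apply/orP; right; move: w1 w2 q1 q2 lh; lra.
rewrite low /=; apply/andP; split; [move: v1 v2|move: u1 u2]; lra.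
Qed.

(** With [rect_fold] the boundary is close to a folded interval, whose sum of
    distances is [sum_fold_absdiff]. The grid starts at the last grid point [k]
    before the leftmost point, with an error of one step. *)
Lemma rect_sum_le (n : nat) : (0 < n)%N ->
  \sum_(0 <= i < n.*2) \sum_(0 <= j < n.*2) enorm (grid l G n.*2 i - grid l G n.*2 j) <=
  l / n.*2%:R * (4 * (n%:R * n.+1%:R * n.+2%:R / 3)) +
  n.*2%:R ^+ 2 * (3 * h + 2 * (l / n.*2%:R)).
Proof.
move=> n0; have [A [A0 _ fold]] := rect_fold.
have N0 : 0 < n.*2%:R :> R by rewrite ltr0n double_gt0.
have [d dE] : exists d, d = l / n.*2%:R by eexists.
have d0 : 0 < d by rewrite dE divr_gt0.
have Nd : n.*2%:R * d = l by rewrite dE mulrC divfK// gt_eqF.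
have [k /andP[k1 k2]] := nat_floor (divr_ge0 A0 (ltW d0)).
rewrite ler_pdivlMr// in k1; rewrite ltr_pdivrMr// -(natr1 k) mulrDl mul1r in k2.
pose V i := grid l G n.*2 (k + i).
pose D (m : nat) : R := (minn m (n.*2 - m))%:R.
have VN i : grid l G n.*2 (i + n.*2) = grid l G n.*2 i.
  by apply: (grid_period LG); move: n0; lia.
have Vx m : (m < n.*2)%N -> d * D m - 2 * h - d <= (V m).1 - (G A).1 <= d * D m + d.
  move=> mN; have pE : A + m%:R * d = A + m%:R * d by [].
  have mNr : m%:R * d <= n.*2%:R * d by rewrite ler_pM2r// ler_nat ltnW.
  have in1 : A <= A + m%:R * d <= A + l.
    by rewrite lerDl mulr_ge0 ?ler0n ?(ltW d0)//= -Nd lerD2l.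
  have := fold _ in1.
  have -> : Num.min (A + m%:R * d - A) (A + l - (A + m%:R * d)) = d * D m.
    have -> : A + m%:R * d - A = d * m%:R by ring.
    have -> : A + l - (A + m%:R * d) = d * (n.*2 - m)%:R.
      by rewrite natrB ?(ltnW mN)// -Nd; ring.
    rewrite /D; have [mm|mm] := leqP m (n.*2 - m).
      by rewrite min_l// ler_pM2l// ler_nat.
    by rewrite min_r// ler_pM2l// ler_nat ltnW.
  have : `|(V m).1 - (G (A + m%:R * d)).1| <= d.
    rewrite -fstB; apply: (le_trans (normr1_le_enorm _)).
    apply: (le_trans (loop_lip LG _ _)); rewrite -dE natrD mulrDl distrC ger0_norm; lra.
  rewrite ler_norml => /andP[a1 a2] /andP[b1 b2].
  by apply/andP; split; [move: a1 b1|move: a2 b2]; lra.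
rewrite -(@sum_period_shift R n.*2 _ k) => [|i]; last first.
  by apply: eq_bigr => j _; rewrite VN.
apply: (@le_trans _ _ (\sum_(0 <= i < n.*2) \sum_(0 <= j < n.*2) (d * `|D i - D j| + (3 * h + 2 * d)))).
  apply: ler_sum_nat => i /andP[_ iN].
  rewrite -(@sum_period_shift R n.*2 (fun j => enorm (grid l G n.*2 (k + i) - grid l G n.*2 j)) k) => [|j]; last by rewrite VN.
  apply: ler_sum_nat => j /andP[_ jN].
  apply: (le_trans (rect_dist _ _)).
  have := Vx _ iN; have := Vx _ jN; rewrite /V /grid -!dE => /andP[a1 a2] /andP[b1 b2].
  have e : d * `|D i - D j| = `|d * D i - d * D j| by rewrite -mulrBr normrM (gtr0_norm d0).
  rewrite e; move: a1 a2 b1 b2.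
  move: (d * D i) (d * D j) (G _).1 (G _).1 (G _).1 => p q x y z a1 a2 b1 b2.
  have := ler_norm (p - q); have := ler_norm (q - p); rewrite (distrC q) => c1 c2.
  by rewrite -lerBrDr ler_norml; apply/andP; split; lra.
have sE : \sum_(0 <= i < n.*2) \sum_(0 <= j < n.*2) (d * `|D i - D j| + (3 * h + 2 * d)) =
   d * (\sum_(0 <= i < n.*2) \sum_(0 <= j < n.*2) `|D i - D j|) + n.*2%:R ^+ 2 * (3 * h + 2 * d).
  under eq_bigr do rewrite big_split /= sumr_const_nat subn0 -mulr_sumr.
  rewrite big_split /= sumr_const_nat subn0 -mulr_sumr; congr (_ + _).
  by rewrite -[LHS]mulr_natl -[in LHS](mulr_natl _ n.*2); ring.
rewrite sE -dE lerD2r ler_pM2l//; exact: sum_fold_absdiff.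
Qed.

(** The double sum over the folded interval is asymptotically [N ^ 3 / 6] with
    [N = 2 n], which gives the constant 1 / 6. *)
Lemma rect_theta_le : (theta (rect h) <= (l / 6 + 3 * h)%:E)%E.
Proof.
have Kb := rect_body h0; have [A [_ l2 _]] := rect_fold.
rewrite (theta_integral Kb LG GE) lee_fin mulrA -invfM -expr2 ler_pdivrMl ?exprn_gt0//.
apply/ler_addgt0Pr => e e0.
have [M hM] := nat_above (6 * l ^+ 3 / e).
pose n := M.+2; have hn := lt_le_trans hM (natr_le_of_ge2 R (leqnn n)).
have n0 : 0 < n%:R :> R by rewrite ltr0n.
have n1 : 1 <= n%:R :> R by rewrite ler1n.
rewrite ltr_pdivrMr// in hn.
have nn0 : (0 < n.*2)%N by rewrite double_gt0.
have hT := double_riemann_sum Kb LG nn0; have hS := rect_sum_le (ltn0Sn _ : 0 < n)%N.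
set T := Int _ _ _ in hT *; set S := \sum_(0 <= i < n.*2) _ in hT hS.
rewrite ler_norml in hT; case/andP: hT => _ hT.
have NE : n.*2%:R = 2 * n%:R :> R by rewrite -mul2n natrM.
rewrite -(natr1 n.+1) -(natr1 n) NE in hS; rewrite NE in hT.
have h1 : (l / (2 * n%:R)) ^+ 2 * S <= (l / (2 * n%:R)) ^+ 2 *
  (l / (2 * n%:R) * (4 * (n%:R * (n%:R + 1) * (n%:R + 1 + 1) / 3)) +
  (2 * n%:R) ^+ 2 * (3 * h + 2 * (l / (2 * n%:R)))).
  by apply: ler_wpM2l; [exact: sqr_ge0|exact: hS].
clearbody S T; move: (n%:R : R) n0 n1 h1 hn hT => x n0 n1 h1 hn hT.
have e1 : (l / (2 * x)) ^+ 2 * (l / (2 * x) * (4 * (x * (x + 1) * (x + 1 + 1) / 3)) +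
  (2 * x) ^+ 2 * (3 * h + 2 * (l / (2 * x)))) =
  l ^+ 2 * (l / 6 + 3 * h) + l ^+ 3 * (3 / 2 / x + 1 / 3 / x / x).
  by field; rewrite gt_eqF.
have e2 : 2 * l ^+ 2 * (l / (2 * x)) = l ^+ 3 / x by field; rewrite gt_eqF.
have l3 : 0 < l ^+ 3 by rewrite exprn_gt0.
have e3 : l ^+ 3 * (1 / 3 / x / x) <= l ^+ 3 / x.
  rewrite ler_pM2l// ler_pdivrMr// mulVf ?gt_eqF// ler_pdivrMr// mul1r; lra.
have e4 : 6 * (l ^+ 3 / x) < e by rewrite mulrA ltr_pdivrMr// [ltRHS]mulrC.
have e5 : l ^+ 3 * (3 / 2 / x) = 3 / 2 * (l ^+ 3 / x) by field; rewrite gt_eqF.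
have e6 : 0 < l ^+ 3 / x by rewrite divr_gt0.
rewrite e1 [l ^+ 3 * _]mulrDr e5 in h1; rewrite e2 in hT.
move: h1 hT e3 e4 e6; lra.
Qed.

End rect_loop.

(** A rectangle of width 1 has perimeter at least 2, so that a height of order
    [c - 1 / 6] suffices. *)
Lemma rectangles_sharp (c : R) : 1 / 6 < c -> exists K : set (R * R)%type,
  convex_body K /\ (theta K <= (c * per K)%:E)%E.
Proof.
move=> c6; have [h hE] : exists h, h = (c - 1 / 6) / 3 by eexists.
have h0 : 0 < h by rewrite hE divr_gt0// subr_gt0.
have Kb := rect_body h0; exists (rect h); split => //.
have [G [LG _ GE [ o G1]]] := boundary_loop Kb (per_arc_param Kb).
apply: (le_trans (rect_theta_le h0 LG GE G1)); rewrite lee_fin.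
have [A [_ l2 _]] := rect_fold h0 LG GE G1.
have : 0 <= (c - 1 / 6) * (per (rect h) - 1).
  by rewrite mulr_ge0 ?subr_ge0 ?(ltW c6)//; lra.
by rewrite hE; move: l2; lra.
Qed.

End rectangles.

Theorem theorem5p1 (R : realType) :
  (forall K : set (R * R)%type,
      convex_body K -> ((per K / 6)%:E < theta K)%E) /\
  (forall c : R, 1 / 6 < c ->
      exists K : set (R * R)%type,
        convex_body K /\ (theta K <= (c * per K)%:E)%E).
Proof.
by split=> [K|c]; [exact: theta_gt|exact: rectangles_sharp].
Qed.
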